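(* Let $\beta: \mathrm{ind}^G_{H\oplus C}(\sigma)\to\Psi$ be the $\mathbb{C}$-linear map determined by $\beta(\Delta(m,\varphi))=\varphi_m$ for all $m\in\mathbb{Z}$, $\varphi\in\mathcal{D}'(\bar K)^{\mathcal{O}_{\bar K}^*}$. Then $\beta$ induces an exact sequence of $G$-representations $$0\longrightarrow \mathrm{Ker}\,\beta\longrightarrow \mathrm{ind}^G_{H\oplus C}(\sigma)\stackrel{\beta}{\longrightarrow}\Psi\longrightarrow 0 .$$ The subspace $\mathrm{Ker}\,\beta$ has a basis consisting of the elements $$v_m=\Delta(m,\delta_0)-\Delta(m+1,\mu_{B,1,0})\qquad (m\in\mathbb{Z}),$$ where $\delta_0\in \mathcal{D}'(\bar K)^{\mathcal{O}_{\bar K}^*}$ is the delta-function at $0$ (that is, $\delta_0(f)=f(0)$) and $\mu_{B,1,0}\in\mu(\bar K)\subset \mathcal{D}'(\bar K)^{\mathcal{O}_{\bar K}^*}$. Moreover, $\mathrm{Ker}\,\beta$ is an irreducible $G$-representation which is isomorphic to the $G$-representation $\mathrm{ind}^G_{H\oplus C}(\chi_0)$, where the character $\chi_0:H\oplus C\to\mathbb{C}^*$ is given by $\chi_0(a\oplus c)=q^{-c}$.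
   Context: **The field $K$.** Let $q$ be a power of a prime $p$, and let $K$ be one of the following two-dimensional local fields: (i) $K=\mathbb{F}_q((u))((t))$; (ii) $K=L((t))$, with $L$ a finite extension of $\mathbb{Q}_p$ with residue field $\mathbb{F}_q$ and $u$ a uniformizer of $L$; (iii) $K=M\{\{u\}\}$, with $M$ a finite extension of $\mathbb{Q}_p$ with residue field $\mathbb{F}_q$ and $t$ a uniformizer of $M$, where $M\{\{u\}\}$ is the completion of $\mathrm{Frac}(\mathcal{O}_M[[u]])$ with respect to the discrete valuation given by the height one prime ideal $\mathfrak{m}_M[[u]]$. $K$ is a discrete valuation field with uniformizer $t$; $\mathcal{O}$ is its valuation ring, $\mathcal{O}(i)=t^i\mathcal{O}$ ($i\in\mathbb{Z}$), and $\bar K=\mathcal{O}/\mathcal{O}(1)$ is the residue field ($\mathbb{F}_q((u))$, $L$, $\mathbb{F}_q((u))$ respectively), a local field with residue field $\mathbb{F}_q$, uniformizer $u$, valuation ring $\mathcal{O}_{\bar K}$. $\mathcal{O}'\subset\mathcal{O}$ is the subring of elements whose image in $\bar K$ lies in $\mathcal{O}_{\bar K}$. Every element of $K^*$ is uniquely $t^au^bg$ with $a,b\in\mathbb{Z}$, $g\in{\mathcal{O}'}^*$. Let $B\subset K$ be the subring $\mathbb{F}_q[[u]]((t))$, $\mathcal{O}_L((t))$, $M\cdot\mathcal{O}_M[[u]]$ respectively. **Measures.** For $i\le j$, $\mathcal{O}(i)/\mathcal{O}(j)$ is a locally compact totally disconnected group, a base of neighbourhoods of $0$ being the open compact subgroups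 $(u^kB\cap\mathcal{O}(i))/(u^kB\cap\mathcal{O}(j))$, $k\in\mathbb{Z}$. For such a group $A$: $\mathcal{D}(A)$ is the space of $\mathbb{C}$-valued locally constant compactly supported functions, $\mathcal{D}'(A)$ its full linear dual (distributions), $\mu(A)\subset\mathcal{D}'(A)$ the one-dimensional space of $\mathbb{C}$-valued Haar measures. An isomorphism $g$ of groups acts by $(gf)(x)=f(g^{-1}x)$, $(gT)(f)=T(g^{-1}f)$. Put $\mu(\mathcal{O}(r)\mid\mathcal{O}(s))=\mu(\mathcal{O}(s)/\mathcal{O}(r))$ if $r\ge s$ and $\mu(\mathcal{O}(r)/\mathcal{O}(s))^*$ if $r\le s$. There are canonical associative isomorphisms $\mu(\mathcal{O}(r)\mid\mathcal{O}(s))\otimes\mu(\mathcal{O}(s)\mid\mathcal{O}(w))\to\mu(\mathcal{O}(r)\mid\mathcal{O}(w))$ (from products of Haar measures and duality), and $g\in K^*$ maps $\mu(\mathcal{O}(r)\mid\mathcal{O}(s))$ to $\mu(g\mathcal{O}(r)\mid g\mathcal{O}(s))$. For $s\le r$, $\mu_{B,r,s}\in\mu(\mathcal{O}(s)/\mathcal{O}(r))$ is the Haar measure with value $1$ on $(B\cap\mathcal{O}(s))/(B\cap\mathcal{O}(r))$; for $s\ge r$, $\mu_{B,r,s}$ is the dual element of $\mu_{B,s,r}$. **Groups.** $\widehat{K^*}$ is the group of pairs $(g,\mu)$, $g\in K^*$, $0\ne\mu\in\mu(\mathcal{O}\mid g\mathcal{O})$, with $(g_1,\mu_1)(g_2,\mu_2)=(g_1g_2,\mu_1\otimes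 g_1(\mu_2))$. $\widetilde{K^*}$ is the subgroup of pairs with $\mu\in q^{\mathbb{Z}}\mu_{B,0,b}$, where $g\mathcal{O}=\mathcal{O}(b)$. The group ${\mathcal{O}'}^*$ embeds as a central subgroup by $g\mapsto(g,1)$. $G=\mathrm{Heis}(3,\mathbb{Z})$ is $\mathbb{Z}^3$ with $(a_1,b_1,c_1)(a_2,b_2,c_2)=(a_1+a_2,b_1+b_2,c_1+c_2+a_1b_2)$, and $G$ is identified with $\widetilde{K^*}/{\mathcal{O}'}^*$ by $(a,b,c)\mapsto$ class of $(u^at^b,q^{-c}\mu_{B,0,b})$. **Distributions on $K$.** $\mathcal{D}'_{\mathcal{O}}(K)=\varinjlim_s\varinjlim_{r>s}\mathcal{D}'(\mathcal{O}(s)/\mathcal{O}(r))\otimes_{\mathbb{C}}\mu(\mathcal{O}\mid\mathcal{O}(r))$. Transition maps: for $s'<s$, direct image of distributions under $\mathcal{O}(s)/\mathcal{O}(r)\hookrightarrow\mathcal{O}(s')/\mathcal{O}(r)$ (dual to restriction of functions); for $r<r'$, write $\mu(\mathcal{O}\mid\mathcal{O}(r))=\mu(\mathcal{O}\mid\mathcal{O}(r'))\otimes\mu(\mathcal{O}(r)/\mathcal{O}(r'))$ and use the inverse image $\mathcal{D}'(\mathcal{O}(s)/\mathcal{O}(r))\otimes\mu(\mathcal{O}(r)/\mathcal{O}(r'))\to\mathcal{D}'(\mathcal{O}(s)/\mathcal{O}(r'))$ (dual to integration of functions along the fibres of $\mathcal{O}(s)/\mathcal{O}(r')\to\mathcal{O}(s)/\mathcal{O}(r)$).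 $(g,\mu)\in\widehat{K^*}$ acts by $T\otimes\nu\mapsto g(T)\otimes(\mu\otimes g(\nu))$. Hence $G$ acts on $\mathcal{D}'_{\mathcal{O}}(K)^{{\mathcal{O}'}^*}$. **The space $\Psi$.** For $\varphi\in\mathcal{D}'(\bar K)^{\mathcal{O}_{\bar K}^*}$ and $l\in\mathbb{Z}$ let $\varphi_l=t^l(\varphi)\otimes\mu_{B,0,l+1}\in\mathcal{D}'_{\mathcal{O}}(K)^{{\mathcal{O}'}^*}$, where $t^l(\varphi)\in\mathcal{D}'(\mathcal{O}(l)/\mathcal{O}(l+1))$. $\Psi$ is the $\mathbb{C}$-linear span of all $\varphi_l$; it is $G$-invariant. **Induced representations.** For groups $G_1\subset G_2$ and a representation $\tau$ of $G_1$ on $V$, $\mathrm{ind}^{G_2}_{G_1}(\tau)$ is the space of functions $f:G_2\to V$ with $f(g_2g_1)=\tau(g_1^{-1})f(g_2)$ and support contained in finitely many left cosets $gG_1$, with action $(g\cdot f)(x)=f(g^{-1}x)$. Let $H=\{(a,0,0)\}$, $P=\{(0,b,0)\}$, $C=\{(0,0,c)\}$ in $G$ (each identified with $\mathbb{Z}$); $H\oplus C\subset G$ via $a\oplus c\mapsto(a,0,c)$. Let $\sigma:H\oplus C\to\mathrm{Aut}_{\mathbb{C}}(\mathcal{D}'(\bar K)^{\mathcal{O}_{\bar K}^*})$, $\sigma(a\oplus c)(\varphi)=q^{-c-a}\,a(\varphi)$, where $a(\varphi)=u^a(\varphi)$. Restricting to $P\cong G/(H\oplus C)$ identifies $\mathrm{ind}^G_{H\oplus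 C}(\sigma)$ with finitely supported functions $P=\mathbb{Z}\to\mathcal{D}'(\bar K)^{\mathcal{O}_{\bar K}^*}$; $\Delta(m,\varphi)$ is the function with value $\varphi$ at $m$ and $0$ at all $n\ne m$. *)

(* Defs.v *)
From HB Require Import structures.
From mathcomp Require Import all_boot all_order all_algebra all_field.
From mathcomp Require Import all_classical all_reals all_analysis.
From mathcomp Require Import complex ring.
From mathcomp Require Import freeg.

Set Implicit Arguments.
Unset Strict Implicit.
Unset Printing Implicit Defensive.

Import Order.TTheory GRing.Theory Num.Theory.

Local Open Scope classical_set_scope.
Local Open Scope ring_scope.

Section PowerSeriesRing.
Variable F : idomainType.

Definition pseries : Type := nat -> F.

HB.instance Definition _ := Choice.copy pseries (nat -> F).
HB.instance Definition _ := GRing.Zmodule.copy pseries (nat -> F).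

Implicit Types f g h : pseries.

Definition ps_const (c : F) : pseries := fun n => if n == 0%N then c else 0.

Definition ps_X : pseries := fun n => (n == 1%N)%:R.

Definition ps_mul f g : pseries :=
  fun n => \sum_(i < n.+1) f i * g (n - i)%N.

Let trunc n f : {poly F} := \poly_(i < n) f i.

Let truncE n f i : (i < n)%N -> (trunc n f)`_i = f i.
Proof. by move=> lt_in; rewrite coef_poly lt_in. Qed.

Let ps_mulE n f g (P Q : {poly F}) :
    (forall i, (i <= n)%N -> P`_i = f i) ->
    (forall i, (i <= n)%N -> Q`_i = g i) ->
  forall i, (i <= n)%N -> (P * Q)`_i = ps_mul f g i.
Proof.
move=> Pf Qg i le_in; rewrite coefM; apply: eq_bigr => j _.
rewrite Pf ?Qg //; last by rewrite (leq_trans _ le_in) // -ltnS.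
by rewrite (leq_trans (leq_subr _ _)).
Qed.

Let ps_mulA : associative ps_mul.
Proof.
move=> f g h; apply/funext => n.
have tE k i : (i <= n)%N -> (trunc n.+1 k)`_i = k i by move=> ?; rewrite truncE.
rewrite -(@ps_mulE n f (ps_mul g h) (trunc n.+1 f)
            (trunc n.+1 g * trunc n.+1 h)) //; last 2 first.
- by move=> i; exact: tE.
- by apply: ps_mulE => i; exact: tE.
rewrite -(@ps_mulE n (ps_mul f g) h (trunc n.+1 f * trunc n.+1 g)
            (trunc n.+1 h)) //; first by rewrite mulrA.
- by apply: ps_mulE => i; exact: tE.
- by move=> i; exact: tE.
Qed.

Let ps_mulC : commutative ps_mul.
Proof.
move=> f g; apply/funext => n.
have tE k i : (i <= n)%N -> (trunc n.+1 k)`_i = k i by move=> ?; rewrite truncE.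
rewrite -(@ps_mulE n f g (trunc n.+1 f) (trunc n.+1 g)) //; try exact: tE.
rewrite -(@ps_mulE n g f (trunc n.+1 g) (trunc n.+1 f)) //; try exact: tE.
by rewrite mulrC.
Qed.

Let ps_mul1 : left_id (ps_const 1) ps_mul.
Proof.
move=> f; apply/funext => n; rewrite /ps_mul big_ord_recl /= subn0 mul1r.
by rewrite big1 ?addr0 // => i _; rewrite /ps_const /= mul0r.
Qed.

Let ps_mulDl : left_distributive ps_mul +%R.
Proof.
move=> f g h; apply/funext => n; rewrite /ps_mul.
rewrite [RHS](_ : _ = \sum_(i < n.+1) f i * h (n - i)%N
                      + \sum_(i < n.+1) g i * h (n - i)%N) //.
by rewrite -big_split /=; apply: eq_bigr => i _; rewrite -mulrDl.
Qed.

Let ps_oner_neq0 : ps_const 1 != 0.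
Proof. by apply/eqP => /(congr1 (@^~ 0%N)) /eqP; rewrite oner_eq0. Qed.

HB.instance Definition _ := GRing.Zmodule_isComNzRing.Build pseries
  ps_mulA ps_mulC ps_mul1 ps_mulDl ps_oner_neq0.

Definition ps_unit : {pred pseries} := fun f => `[< exists g, g * f = 1 >].

Definition ps_inv f : pseries :=
  if ps_unit f then xget 0 [set g | g * f = 1] else f.

Let ps_mulVx : {in ps_unit, left_inverse 1 ps_inv *%R}.
Proof.
move=> f uf; rewrite /ps_inv ifT //; move/asboolP: uf => [g gf].
by have := @xgetPex _ 0 [set g : pseries | g * f = 1] (ex_intro _ g gf).
Qed.

Let ps_unitPl f g : g * f = 1 -> ps_unit f.
Proof. by move=> gf; apply/asboolP; exists g. Qed.

Let ps_inv_out : {in [predC ps_unit], ps_inv =1 id}.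
Proof. by move=> f; rewrite inE /ps_inv => /negbTE; rewrite /in_mem /= => ->. Qed.

HB.instance Definition _ := GRing.ComNzRing_hasMulInverse.Build pseries
  ps_mulVx ps_unitPl ps_inv_out.

Let ps_idomain : GRing.integral_domain_axiom pseries.
Proof.
move=> f g fg0; apply/norP => -[f0 g0].
have low k : k != 0 :> pseries ->
    exists2 n, k n != 0 & forall i, (i < n)%N -> k i = 0.
  move=> k0; have exn : exists n, k n != 0.
    apply: contrapT => /forallNP ek; move/eqP: k0; apply.
    by apply/funext => n; apply/eqP; apply: contraT => /ek.
  exists (ex_minn exn); case: ex_minnP => m km min_m // i lt_im.
  by apply/eqP; apply: contraTT lt_im => /min_m; rewrite -leqNgt.
have [n fn lfn] := low _ f0; have [m gm lgm] := low _ g0.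
have : (f * g) (n + m)%N = 0 by rewrite fg0.
have lt_n : (n < (n + m).+1)%N by rewrite ltnS leq_addr.
rewrite [LHS](bigD1 (Ordinal lt_n)) //= addKn big1 ?addr0.
  by apply/eqP; rewrite mulf_neq0.
move=> i ne_in; have [lt_in|le_ni] := ltnP i n; first by rewrite lfn ?mul0r.
have lt_ni : (n < i)%N by rewrite ltn_neqAle le_ni eq_sym andbT.
by rewrite lgm ?mulr0 // ltn_subLR ?ltn_add2r // -ltnS.
Qed.

HB.instance Definition _ := GRing.ComUnitRing_isIntegral.Build pseries ps_idomain.

End PowerSeriesRing.

Definition laurent (F : fieldType) : fieldType := {fraction (pseries F)}.

Definition series_of (F : idomainType) (A : set F) : set (pseries F) :=
  [set f | forall n, A (f n)].

(* Normalized valuations; the value at [0] is irrelevant. *)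
Definition discrete_valuation (K : fieldType) (v : K -> int) : Prop :=
  [/\ forall x y, x != 0 -> y != 0 -> v (x * y) = v x + v y,
      forall x y, x != 0 -> y != 0 -> x + y != 0 ->
        Num.min (v x) (v y) <= v (x + y)
    & exists2 x, x != 0 & v x = 1].

Definition vball (K : fieldType) (v : K -> int) (n : int) : set K :=
  [set x | x = 0 \/ n <= v x].

(* [K] is complete for the discrete valuation [v] and [E] is dense in [K]. *)
Definition completion_of (K : fieldType) (v : K -> int) (E : set K) : Prop :=
  [/\ discrete_valuation v,
      forall x n, exists2 y, E y & vball v n (x - y)
    & forall s : nat -> K,
        (forall n, exists N, forall i j, (N <= i)%N -> (N <= j)%N ->
           vball v n (s i - s j)) ->
        exists l, forall n, exists N, forall i, (N <= i)%N ->
           vball v n (s i - l)].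

Definition padic_val (p : nat) (x : rat) : int :=
  (logn p `|numq x|%N)%:Z - (logn p `|denq x|%N)%:Z.

Definition is_Qp (p : nat) (Q : fieldType) (j : {rmorphism rat -> Q})
    (v : Q -> int) : Prop :=
  completion_of v (range j) /\ forall x, x != 0 -> v (j x) = padic_val p x.

Section PadicExtension.
Variables (p : nat) (k : finFieldType) (Q : fieldType).
Variables (j : {rmorphism rat -> Q}) (v : Q -> int) (L : fieldExtType Q).

(* The integral closure of [Z_p = vball v 0] in [L]. *)
Definition integers : set L :=
  [set x | exists P : {poly Q},
     [/\ P \is monic, forall i, vball v 0 P`_i
       & root (map_poly (in_alg L) P) x]].

Definition max_ideal : set L :=
  [set x | integers x /\ (x = 0 \/ ~ integers x^-1)].

Definition has_residue_field : Prop :=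
  exists rho : L -> k,
    [/\ rho 1 = 1,
        forall x y, integers x -> integers y -> rho (x + y) = rho x + rho y,
        forall x y, integers x -> integers y -> rho (x * y) = rho x * rho y,
        forall z, exists2 x, integers x & rho x = z
      & forall x, integers x -> (rho x = 0 <-> max_ideal x)].

(* [L] is a finite extension of [Q = Q_p] with residue field [k] and
   uniformizer [pi]. *)
Definition padic_extension (pi : L) : Prop :=
  [/\ is_Qp p j v, has_residue_field, pi != 0
    & max_ideal = [set pi * x | x in integers]].

End PadicExtension.

Arguments integers {Q} v L _.
Arguments max_ideal {Q} v L _.

(* [tdO] is the valuation ring, [tdO'] its subring of elements whose residue is
   integral, and [tdB] the subring [B]. *)
Record two_dim_data := TwoDimData {
  tdK :> fieldType;
  tdt : tdK;
  tdu : tdK;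
  tdO : set tdK;
  tdO' : set tdK;
  tdB : set tdK
}.

(* [F((t))], for a local field [F] with valuation ring [OF] and uniformizer [u];
   the residue of a power series in [t] is its constant coefficient. *)
Definition laurent_data (F : fieldType) (OF : set F) (u : F) : two_dim_data :=
  let fr := @tofrac (pseries F) in
  @TwoDimData (laurent F) (fr (ps_X F)) (fr (ps_const u))
    (range fr)
    (fr @` [set f | OF (f 0%N)])
    [set x | exists n, (fr @` series_of OF) (fr (ps_X F) ^+ n * x)].

Section CurlyBraces.
Variables (Q : fieldType) (v : Q -> int) (M : fieldExtType Q).
Variables (K : fieldType) (iota : pseries M -> K) (w : K -> int).

Let OM := integers v M.
Let A := series_of OM.

(* [iota] embeds [A = O_M[[u]]] into [K]; it is unspecified outside [A].
   [w] is the valuation of the prime ideal [m_M[[u]]]: it is nonnegative on [A],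
   with centre [m_M[[u]]], and normalized. *)
Definition is_curly : Prop :=
  [/\ iota 1 = 1,
      forall f g, A f -> A g -> iota (f + g) = iota f + iota g,
      forall f g, A f -> A g -> iota (f * g) = iota f * iota g,
      forall f, A f -> f != 0 ->
        [/\ iota f != 0, 0 <= w (iota f)
          & 0 < w (iota f) <-> series_of (max_ideal v M) f]
    & completion_of w
        [set x | exists f g, [/\ A f, A g, g != 0 & x = iota f / iota g]]].

(* The valuation ring of the residue field [F_q((u))] is [F_q[[u]]], the image
   of [O_M[[u]]]. *)
Definition curly_data (t : M) : two_dim_data :=
  let OK := vball w 0 in
  @TwoDimData K (iota (ps_const t)) (iota (ps_X M))
    OK
    [set x | OK x /\ exists2 f, A f & vball w 1 (x - iota f)]
    [set x | exists a b f, [/\ OM a, OM b, b != 0, A f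
       & x = iota (ps_const a) / iota (ps_const b) * iota f]].

End CurlyBraces.

Inductive two_dim_local_field (p : nat) (k : finFieldType) :
    two_dim_data -> Prop :=
| EqualChar :
    two_dim_local_field p k
      (laurent_data (F := laurent k) (range (@tofrac (pseries k)))
         (tofrac (ps_X k)))
| LaurentPadic (Q : fieldType) (j : {rmorphism rat -> Q}) (v : Q -> int)
    (L : fieldExtType Q) (u : L) :
    padic_extension p k j v u ->
    two_dim_local_field p k (laurent_data (F := L) (integers v L) u)
| CurlyPadic (Q : fieldType) (j : {rmorphism rat -> Q}) (v : Q -> int)
    (M : fieldExtType Q) (t : M)
    (K : fieldType) (iota : pseries M -> K) (w : K -> int) :
    padic_extension p k j v t -> is_curly v iota w ->
    two_dim_local_field p k (curly_data v iota w t).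

Section LinearAlgebra.
Variables (F : fieldType) (V W : lmodType F).

Definition is_subspace (U : set V) : Prop :=
  U 0 /\ forall a x y, U x -> U y -> U (a *: x + y).

Definition lspan (S : set V) : set V :=
  [set x | forall U, is_subspace U -> S `<=` U -> U x].

Definition linear_on (U : set V) (f : V -> W) : Prop :=
  forall a x y, U x -> U y -> f (a *: x + y) = a *: f x + f y.

Definition is_basis (I : eqType) (U : set V) (b : I -> V) : Prop :=
  lspan (range b) = U /\
  forall (s : seq I) (c : I -> F), uniq s ->
    \sum_(i <- s) c i *: b i = 0 -> {in s, forall i, c i = 0}.

(* The full linear dual of [U]; a functional is extended by [0] outside [U]. *)
Definition dual (U : set V) : set (V -> F^o) :=
  [set l | (forall a x y, U x -> U y -> l (a *: x + y) = a *: l x + l y) /\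
           forall x, ~ U x -> l x = 0].

End LinearAlgebra.

Section QuotientSpace.
Variables (F : fieldType) (V : lmodType F) (S : set V).

Lemma lspan_subspace : is_subspace (lspan S).
Proof.
split=> [U [U0 _] _ //|a x y xS yS U sU SU].
by case: (sU) => _; apply; [exact: xS|exact: yS].
Qed.

Let N0 : lspan S 0. Proof. by case: lspan_subspace. Qed.
Let ND x y : lspan S x -> lspan S y -> lspan S (x + y).
Proof. by move=> xS yS; rewrite -[x]scale1r; apply: lspan_subspace.2. Qed.
Let NZ a x : lspan S x -> lspan S (a *: x).
Proof. by move=> xS; rewrite -[_ *: _]addr0; apply: lspan_subspace.2. Qed.
Let NN x : lspan S x -> lspan S (- x).
Proof. by move=> xS; rewrite -scaleN1r; apply: NZ. Qed.

Definition quot_rel (x y : V) : bool := `[< lspan S (x - y) >].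

Lemma quot_rel_refl : reflexive quot_rel.
Proof. by move=> x; apply/asboolP; rewrite subrr. Qed.

Lemma quot_rel_sym : symmetric quot_rel.
Proof.
by move=> x y; apply/asboolP/asboolP => /NN; rewrite opprB.
Qed.

Lemma quot_rel_trans : transitive quot_rel.
Proof.
move=> y x z /asboolP xy /asboolP yz; apply/asboolP.
by rewrite -(subrKA y); apply: ND.
Qed.

Canonical quot_equiv := EquivRel quot_rel quot_rel_refl quot_rel_sym quot_rel_trans.

Definition quot : Type := {eq_quot quot_equiv}%qT.

HB.instance Definition _ := Choice.on quot.
HB.instance Definition _ := EqQuotient.on quot.

Definition quot_pi (x : V) : quot := (\pi_quot x)%qT.

Lemma quot_piP x y : quot_pi x = quot_pi y <-> lspan S (x - y).
Proof.
split=> [/(@eqquotP _ quot_rel quot)/asboolP //|xy].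
by apply/(@eqquotP _ quot_rel quot)/asboolP.
Qed.

Lemma quot_reprK : cancel (fun x : quot => repr x) quot_pi.
Proof. by move=> x; rewrite /quot_pi reprK. Qed.

Let rpi x : lspan S (repr (quot_pi x) - x).
Proof. by apply/quot_piP; rewrite quot_reprK. Qed.

Let q0 : quot := quot_pi 0.
Let qadd (x y : quot) := quot_pi (repr x + repr y).
Let qopp (x : quot) := quot_pi (- repr x).
Let qscale a (x : quot) := quot_pi (a *: repr x).

Let qaddE x y : qadd (quot_pi x) (quot_pi y) = quot_pi (x + y).
Proof. by apply/quot_piP; rewrite opprD addrACA; apply: ND. Qed.
Let qoppE x : qopp (quot_pi x) = quot_pi (- x).
Proof. by apply/quot_piP; rewrite -opprD; apply: NN. Qed.
Let qscaleE a x : qscale a (quot_pi x) = quot_pi (a *: x).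
Proof. by apply/quot_piP; rewrite -scalerBr; apply: NZ. Qed.

Let qind (P : quot -> Prop) : (forall x, P (quot_pi x)) -> forall x, P x.
Proof. by move=> Ppi x; rewrite -[x]quot_reprK; exact: Ppi. Qed.

Let qaddA : associative qadd.
Proof.
by elim/qind=> x; elim/qind=> y; elim/qind=> z; rewrite !qaddE addrA.
Qed.
Let qaddC : commutative qadd.
Proof. by elim/qind=> x; elim/qind=> y; rewrite !qaddE addrC. Qed.
Let qadd0 : left_id q0 qadd.
Proof. by elim/qind=> x; rewrite qaddE add0r. Qed.
Let qaddN : left_inverse q0 qopp qadd.
Proof. by elim/qind=> x; rewrite qoppE qaddE addNr. Qed.

HB.instance Definition _ :=
  GRing.isZmodule.Build quot qaddA qaddC qadd0 qaddN.

Let qscaleA a b x : qscale a (qscale b x) = qscale (a * b) x.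
Proof. by elim/qind: x => x; rewrite !qscaleE scalerA. Qed.
Let qscale1 : left_id 1 qscale.
Proof. by elim/qind=> x; rewrite qscaleE scale1r. Qed.
Let qscaleDr : right_distributive qscale +%R.
Proof.
move=> a; elim/qind=> x; elim/qind=> y.
by rewrite [_ + _]qaddE !qscaleE [RHS]qaddE scalerDr.
Qed.
Let qscaleDl x : {morph qscale^~ x : a b / a + b}.
Proof.
by move=> a b; elim/qind: x => x; rewrite !qscaleE [RHS]qaddE scalerDl.
Qed.

HB.instance Definition _ := GRing.Zmodule_isLmodule.Build F quot
  qscaleA qscale1 qscaleDr qscaleDl.

End QuotientSpace.

Section Representations.
Variables (F : fieldType) (G : groupType).

Definition is_rep (V : lmodType F) (U : set V) (act : G -> V -> V) : Prop :=
  [/\ is_subspace U,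
      forall g x, U x -> U (act g x),
      forall g, linear_on U (act g),
      forall x, U x -> act 1%g x = x
    & forall g h x, U x -> act (g * h)%g x = act g (act h x)].

Definition is_rep_hom (V V' : lmodType F) (U : set V) (act : G -> V -> V)
    (U' : set V') (act' : G -> V' -> V') (f : V -> V') : Prop :=
  [/\ linear_on U f, forall x, U x -> U' (f x)
    & forall g x, U x -> f (act g x) = act' g (f x)].

Definition short_exact (V1 V2 V3 : lmodType F)
    (U1 : set V1) (act1 : G -> V1 -> V1) (U2 : set V2) (act2 : G -> V2 -> V2)
    (U3 : set V3) (act3 : G -> V3 -> V3)
    (i : V1 -> V2) (f : V2 -> V3) : Prop :=
  [/\ [/\ is_rep U1 act1, is_rep U2 act2 & is_rep U3 act3],
      is_rep_hom U1 act1 U2 act2 i /\ is_rep_hom U2 act2 U3 act3 f,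
      forall x, U1 x -> i x = 0 -> x = 0,
      i @` U1 = [set y | U2 y /\ f y = 0]
    & f @` U2 = U3].

Definition irreducible (V : lmodType F) (U : set V) (act : G -> V -> V) : Prop :=
  (exists2 x, U x & x != 0) /\
  forall U', is_subspace U' -> U' `<=` U ->
    (forall g x, U' x -> U' (act g x)) -> U' = [set 0] \/ U' = U.

Definition rep_isomorphic (V V' : lmodType F) (U : set V) (act : G -> V -> V)
    (U' : set V') (act' : G -> V' -> V') : Prop :=
  exists f, is_rep_hom U act U' act' f /\ set_bij U U' f.

(* [ind^G_H(tau)] for a representation [tau] of [H] on [U]. *)
Definition ind (H : set G) (V : lmodType F) (U : set V) (tau : G -> V -> V) :
    set (G -> V) :=
  [set f | [/\ forall x, U (f x),
      forall g h, H h -> f (g * h)%g = tau (h^-1)%g (f g)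
    & exists s : seq G, forall x, f x != 0 ->
        exists g h, [/\ g \in s, H h & x = (g * h)%g]]].

Definition ind_act (V : lmodType F) (g : G) (f : G -> V) : G -> V :=
  fun x => f (g^-1 * x)%g.

End Representations.

Definition heis : Type := (int * int * int)%type.
Definition Heis (a b c : int) : heis := (a, b, c).
Definition ha (g : heis) : int := g.1.1.
Definition hb (g : heis) : int := g.1.2.
Definition hc (g : heis) : int := g.2.

HB.instance Definition _ := Choice.copy heis (int * int * int)%type.

Definition heis_mul (g h : heis) : heis :=
  Heis (ha g + ha h) (hb g + hb h) (hc g + hc h + ha g * hb h).
Definition heis_inv (g : heis) : heis :=
  Heis (- ha g) (- hb g) (ha g * hb g - hc g).

Fact heis_mulA : associative heis_mul.
Proof.
move=> [[a b] c] [[a' b'] c'] [[a'' b''] c''].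
by congr (_, _, _); rewrite /ha /hb /hc /=; ring.
Qed.
Fact heis_mul1 : left_id (Heis 0 0 0) heis_mul.
Proof.
by move=> [[a b] c]; congr (_, _, _); rewrite /ha /hb /hc /=; ring.
Qed.
Fact heis_1mul : right_id (Heis 0 0 0) heis_mul.
Proof.
by move=> [[a b] c]; congr (_, _, _); rewrite /ha /hb /hc /=; ring.
Qed.
Fact heis_mulV : left_inverse (Heis 0 0 0) heis_inv heis_mul.
Proof.
by move=> [[a b] c]; congr (_, _, _); rewrite /ha /hb /hc /=; ring.
Qed.
Fact heis_Vmul : right_inverse (Heis 0 0 0) heis_inv heis_mul.
Proof.
by move=> [[a b] c]; congr (_, _, _); rewrite /ha /hb /hc /=; ring.
Qed.

HB.instance Definition _ := isGroup.Build heis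
  heis_mulA heis_mul1 heis_1mul heis_mulV heis_Vmul.

Definition HC : set heis := [set g | hb g = 0].

Section Distributions.
Variables (R : realType) (X : two_dim_data).

Local Notation C := R[i].

Definition lat (i : int) : set X := [set tdt X ^ i * x | x in @tdO X].

Definition nb (i k : int) : set X :=
  [set tdu X ^ k * x | x in @tdB X] `&` lat i.

(* [K] with the topology pulled back from [O(i)/O(j)] along
   [O(i) -> O(i)/O(j)]: the cosets of the subgroups
   [(u^k B :&: O(i)) + O(j)] in [O(i)] form a subbase. *)
Definition topo (i j : int) : Type := X.

Definition nb_cosets (i j : int) : set (set X) :=
  [set U | exists k, exists2 x, lat i x &
     U = [set x + y + z | y in nb i k & z in lat j]].

HB.instance Definition _ i j := Choice.on (topo i j).
HB.instance Definition _ i j := isSubBaseTopological.Build (topo i j)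
  (nb_cosets i j) id.

Definition func : Type := X -> C^o.
HB.instance Definition _ := GRing.Lmodule.copy func (X -> C^o).

Definition dist : Type := func -> C^o.
HB.instance Definition _ := GRing.Lmodule.copy dist (func -> C^o).

(* [D(O(i)/O(j))]: a function on [O(i)/O(j)] is an [O(j)]-periodic function on
   [O(i)], extended by [0]. *)
Definition test (i j : int) : set func :=
  [set f : func | [/\ forall x, ~ lat i x -> f x = 0,
      forall x y, lat i x -> lat j y -> f (x + y) = f x,
      forall x, lat i x -> \forall y \near (x : topo i j), f y = f x
    & exists A : set (topo i j),
        [/\ compact A, A `<=` lat i & forall x, f x != 0 -> A x]]].

Definition distr (i j : int) : set dist := dual (test i j).

(* The [C]-valued Haar measures, [0] included, are the translation invariant
   distributions. *)
Definition haar (i j : int) : set dist :=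
  [set T : dist | distr i j T /\
     forall a f, lat i a -> test i j f -> T (fun x => f (x + a)) = T f].

Definition push (s s' r : int) (T : dist) : dist :=
  fun f => if `[< test s' r f >]
           then T (fun x => if `[< lat s x >] then f x else 0) else 0.

(* The inverse image of [T] on [O(i)/O(j)] along
   [O(i)/O(k) -> O(i)/O(j)], for [m] in [mu(O(j)/O(k))].  For [T] a Haar measure
   this is the product [mu(O(i)/O(j)) x mu(O(j)/O(k)) -> mu(O(i)/O(k))]. *)
Definition pull (i j k : int) (T m : dist) : dist :=
  fun f => if `[< test i k f >]
           then T (fun x => m (fun y => if `[< lat j y >] then f (x + y) else 0))
           else 0.

Definition dist_act (g : X) (T : dist) : dist := fun f => T (fun x => f (g * x)).

(* An element of [mu(O(r)|O(s))] is a pair [(T, 0)] with [T] in [mu(O(s)/O(r))]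
   if [s <= r], and [(0, l)] with [l] in the dual of [mu(O(r)/O(s))] if
   [r < s]. *)
Definition line : Type := (dist * (dist -> C^o))%type.
HB.instance Definition _ := GRing.Lmodule.copy line (dist * (dist -> C^o))%type.

Definition mu (r s : int) : set line :=
  [set n : line | if s <= r then haar s r n.1 /\ n.2 = 0
                  else n.1 = 0 /\ dual (haar r s) n.2].

Definition line_act (g : X) (n : line) : line :=
  (dist_act g n.1, fun T => n.2 (dist_act g^-1 T)).

Definition dual_ext (i j : int) (l : dist -> C^o) : dist -> C^o :=
  fun T => if `[< haar i j T >] then l T else 0.

(* [mu(O(r)|O(s)) (x) mu(O(s)|O(w)) -> mu(O(r)|O(w))]; [xget] picks the only
   element of its set. *)
Definition tens (r s w : int) (n1 n2 : line) : line :=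
  if s <= r then
    if w <= s then (pull w s r n2.1 n1.1, 0)
    else if w <= r then
      (xget 0 [set T : dist | exists a b, [/\ haar s w a, haar w r b,
         n1.1 = pull s w r a b & T = n2.2 a *: b]], 0)
    else (0, dual_ext r w (fun b => n2.2 (pull s r w n1.1 b)))
  else
    if w <= s then
      if w <= r then
        (xget 0 [set T : dist | exists a b, [/\ haar w r a, haar r s b,
           n2.1 = pull w r s a b & T = n1.2 b *: a]], 0)
      else (0, dual_ext r w (fun a => n1.2 (pull r w s a n2.1)))
    else
      (0, dual_ext r w (fun T => xget 0 [set z : C^o | exists a b,
         [/\ haar r s a, haar s w b, T = pull r s w a b
           & z = n1.2 a * n2.2 b]])).

Definition haarB (s r : int) : dist :=
  xget 0 [set T : dist | haar s r T /\
    T (\1_[set x + y | x in @tdB X `&` lat s & y in lat r]) = 1].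

Definition muB (r s : int) : line :=
  if s <= r then (haarB s r, 0)
  else (0, xget 0 [set l | dual (haar r s) l /\ l (haarB r s) = 1]).

(* [(s, r, T, n)] stands for [T (x) n] in
   [D'(O(s)/O(r)) (x) mu(O|O(r))]. *)
Definition tensor : Type := (int * int * dist * line)%type.
HB.instance Definition _ := Choice.copy tensor (int * int * dist * line)%type.

Definition free_tensors : lmodType C := {freeg tensor / C}.

Definition gen (s r : int) (T : dist) (n : line) : free_tensors :=
  << (s, r, T, n) >>.

Inductive tensor_rel : free_tensors -> Prop :=
| RelLeft s r a T T' n : s < r -> distr s r T -> distr s r T' -> mu 0 r n ->
    tensor_rel (gen s r (a *: T + T') n - a *: gen s r T n - gen s r T' n)
| RelRight s r a T n n' : s < r -> distr s r T -> mu 0 r n -> mu 0 r n' ->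
    tensor_rel (gen s r T (a *: n + n') - a *: gen s r T n - gen s r T n')
| RelPush s' s r T n : s' < s -> s < r -> distr s r T -> mu 0 r n ->
    tensor_rel (gen s r T n - gen s' r (push s s' r T) n)
| RelPull s r r' T n m : s < r -> r < r' -> distr s r T -> mu 0 r' n ->
    haar r r' m ->
    tensor_rel (gen s r T (tens 0 r' r n (m, 0)) - gen s r' (pull s r r' T m) n).

(* The colimit of the spaces [D'(O(s)/O(r)) (x) mu(O|O(r))] is the subspace
   [colim] of [DO] spanned by the classes of the [T (x) n] with [s < r], [T] in
   [D'(O(s)/O(r))] and [n] in [mu(O|O(r))]; no relation holds in [DO] between
   the remaining generators. *)
Definition DO : lmodType C := quot (tensor_rel : set free_tensors).

Definition cls (s r : int) (T : dist) (n : line) : DO := quot_pi _ (gen s r T n).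

Definition colim : set DO :=
  lspan [set x | exists s r T n,
    [/\ s < r, distr s r T, mu 0 r n & x = cls s r T n]].

Definition ord (g : X) : int := xget 0 [set b | [set g * x | x in @tdO X] = lat b].

Definition tensor_act (g : X * line) (x : tensor) : free_tensors :=
  let: (s, r, T, n) := x in
  let b := ord g.1 in
  gen (s + b) (r + b) (dist_act g.1 T) (tens 0 b (r + b) g.2 (line_act g.1 n)).

(* The action of [(g, mu)] on [colim]; there it does not depend on the
   representative. *)
Definition DO_act (g : X * line) (x : DO) : DO :=
  quot_pi _ (fglift (tensor_act g) (repr x)).

Variable q : nat.

(* The representative [(u^a t^b, q^-c mu_{B,0,b})] of the class of [(a, b, c)]
   modulo the units of [O'].  On the invariants of these units in [colim], which
   contain [Psi], the action of the class is that of the representative. *)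
Definition heis_lift (g : heis) : X * line :=
  (tdu X ^ ha g * tdt X ^ hb g, (q%:R : C) ^ (- hc g) *: muB 0 (hb g)).

Definition G_act (g : heis) : DO -> DO := DO_act (heis_lift g).

(* The invariants of the units of [O_Kbar] in [D'(Kbar)], for [Kbar = O/O(1)];
   the units of [O'] map onto those of [O_Kbar = O'/O(1)]. *)
Definition Dbar : set dist :=
  [set T | distr 0 1 T /\
     forall h, h != 0 -> @tdO' X h -> @tdO' X h^-1 -> dist_act h T = T].

Definition delta0 : dist := fun f => if `[< test 0 1 f >] then f 0 else 0.

Definition phi_ (l : int) (phi : dist) : DO :=
  cls l (l + 1) (dist_act (tdt X ^ l) phi) (muB 0 (l + 1)).

Definition Psi : set DO := lspan [set phi_ l phi | l in setT & phi in Dbar].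

Definition sigma (h : heis) (phi : dist) : dist :=
  (q%:R : C) ^ (- hc h - ha h) *: dist_act (tdu X ^ ha h) phi.

Definition chi0 (h : heis) (z : C^o) : C^o := (q%:R : C) ^ (- hc h) * z.

Definition ind_sigma : set (heis -> dist) := ind HC Dbar sigma.

Definition ind_chi0 : set (heis -> C^o) := ind HC setT chi0.

(* The function supported on the coset of [(0, m, 0)] with value [phi] there;
   note that [(a, b, c) = (0, b, 0) (a, 0, c)]. *)
Definition Delta (m : int) (phi : dist) : heis -> dist :=
  fun g => if hb g == m then sigma (Heis (ha g) 0 (hc g))^-1%g phi else 0.

Definition is_beta (beta : (heis -> dist) -> DO) : Prop :=
  linear_on ind_sigma beta /\
  forall m phi, Dbar phi -> beta (Delta m phi) = phi_ m phi.

Definition Ker (beta : (heis -> dist) -> DO) : set (heis -> dist) :=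
  [set f | ind_sigma f /\ beta f = 0].

Definition v_ (m : int) : heis -> dist :=
  Delta m delta0 - Delta (m + 1) (muB 1 0).1.

End Distributions.

Arguments Psi R X _ : clear implicits.
Arguments ind_sigma R X q _ : clear implicits.
Arguments v_ R X q m _ : clear implicits.
Arguments ind_chi0 R q _ : clear implicits.

(* Main.v *)
(* On a common quotient [O(s)/O(r)], both the delta function at level [m] and
   the Haar measure at level [m + 1] are integration along [O(m + 1)], so that
   the [v_ m] lie in the kernel.  Conversely, let the finite sum of the classes
   of [phi_m] at level [m], for [m >= m0], vanish: the terms of level above [m0]
   live on [O(m0 + 1)], hence [phi_m0] kills the test functions of
   [O(m0)/O(m0 + 1)] vanishing at [0] and is a multiple of [delta0]; subtracting
   a multiple of [v_ m0] shortens the support of the element.  The value of the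
   term of level [m + 1] on the coset of a unit reads off the coefficient of
   [v_ m].  The element [(a, b, c)] maps [v_ m] to
   [q^(- c - a (m + 1)) v_ (m + b)], so the [v_ m] are eigenvectors of [H] for
   distinct characters permuted transitively by [P], whence irreducibility.  The
   three kinds of fields enter only through the structure of [B :&: O] modulo
   [t]: a complete valuation ring with uniformizer [u] and [q] residue classes. *)
Require Import Defs.
From HB Require Import structures.
From mathcomp Require Import all_boot all_order all_algebra all_field.
From mathcomp Require Import all_classical all_reals all_analysis.
From mathcomp Require Import complex ring zify.
From mathcomp Require Import finmap freeg.

Set Implicit Arguments.
Unset Strict Implicit.
Unset Printing Implicit Defensive.

Import Order.TTheory GRing.Theory Num.Theory.
Local Open Scope classical_set_scope.
Local Open Scope ring_scope.

(** * Integration of step functions on a filtered group *)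

(** Vanishing in the colimit cannot be read off a representative, since [DO] is a quotient of a free
    module by relations that change [s] and [r]. It is tested by pairing with a function f on
    O(s)/O(r): integrate f along O(r1)/O(r), restrict it to O(s1), apply the distribution. This
    respects a relation only for s small and r large, with bounds depending on the finitely many
    relations involved, so s and r are chosen afterwards. Evaluating the pairing needs explicit test
    functions; hence the topological definition is first reduced to functions supported on, and
    periodic under, members of a filtration. Completeness of the residue field enters here, through
    compactness of these members. The normalised measures multiply without constants, so each line
    has a basis in which the tensor product multiplies numbers. All scalars are then powers of q:
    u^a scales the Haar measure of O(s)/O(r) by q^(a(r-s)), while t does not scale it, as t and its
    inverse lie in B. The exponent a(m+1) arises because level m carries the measure line of
    O(m+1). *)

Record chain (V : comNzRingType) (N : int -> set V) (I : finType)
    (r : int -> I -> V) : Prop := Chain {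
  chain0 : forall k, N k 0;
  chainB : forall k x y, N k x -> N k y -> N k (x - y);
  chainS : forall k x, N (k + 1) x -> N k x;
  chain_r : forall k i, N k (r k i);
  chain_ex : forall k x, N k x -> exists i, N (k + 1) (x - r k i);
  chain_uniq : forall k i j, N (k + 1) (r k i - r k j) -> i = j }.

Section Chain.
Variables (C : fieldType) (V : comNzRingType) (N : int -> set V) (I : finType).
Variables (r : int -> I -> V).
Hypothesis chN : chain N r.
Implicit Types (f g : V -> C^o) (k l : int) (x y c : V).

Let N0 k : N k 0 := chain0 chN k.

Lemma chain_opp k x : N k x -> N k (- x).
Proof. by move=> Nx; rewrite -sub0r; apply: (chainB chN). Qed.

Lemma chainD k x y : N k x -> N k y -> N k (x + y).
Proof. by move=> Nx /chain_opp; rewrite -{2}[y]opprK; apply: (chainB chN). Qed.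

Lemma chainDr k x y : N k y -> N k (x + y) <-> N k x.
Proof.
move=> Ny; split=> [Nxy|Nx]; last exact: chainD.
by rewrite -(addrK y x); apply: (chainB chN).
Qed.

Lemma chain_le k l x : k <= l -> N l x -> N k x.
Proof.
move=> kl; have [n ->] : exists n : nat, l = k + n%:Z.
  by exists `|l - k|%N; lia.
elim: n => [|n IHn]; first by rewrite addr0.
by rewrite -addn1 PoszD addrA => /(chainS chN).
Qed.

Definition supported k f := forall x, f x != 0 -> N k x.
Definition periodic k f := forall x y, N k y -> f (x + y) = f x.
(** For the filtration of O(i)/O(j) this is the combinatorial form of compact support and local
    constancy, see [testE]. The members [N k] need not exhaust [V], so the support bound also
    confines [f] to their union. *)
Definition step_fun : set (V -> C^o) :=
  [set f | exists k l, supported k f /\ periodic l f].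

Definition coset k c : V -> C^o := fun x => (`[< N k (x - c) >])%:R.

Lemma supported_le k l f : k <= l -> supported l f -> supported k f.
Proof. by move=> kl sf x /sf; apply: chain_le. Qed.

Lemma periodic_le k l f : k <= l -> periodic k f -> periodic l f.
Proof. by move=> kl pf x y /(chain_le kl) /pf. Qed.

Lemma step_fun_range f : step_fun f ->
  forall m, exists k (n : nat), [/\ k <= m, supported k f & periodic (k + n%:Z) f].
Proof.
move=> [k [l [sf pf]]] m; exists (Num.min k m), `|Num.max l k - Num.min k m|%N.
split; first by lia.
- by apply: supported_le sf; lia.
- by apply: periodic_le pf; lia.
Qed.

Lemma step_fun_subspace : is_subspace step_fun.
Proof.
split=> [|a f g /step_fun_range ff /step_fun_range gg].
  by exists 0, 0; split=> [x|//]; rewrite eqxx.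
have [k [n [_ sf pf]]] := ff 0; have [k' [n' [kk' sg pg]]] := gg k.
exists k', (Num.max (k + n%:Z) (k' + n'%:Z)); split.
  move=> x; rewrite !fctE /=; have [->|fx _] := eqVneq (f x) 0.
    by rewrite scaler0 add0r => /sg.
  by apply: chain_le kk' _; apply: sf.
have pf' : periodic (Num.max (k + n%:Z) (k' + n'%:Z)) f by apply: periodic_le pf; lia.
have pg' : periodic (Num.max (k + n%:Z) (k' + n'%:Z)) g by apply: periodic_le pg; lia.
by move=> x y Ny; rewrite !fctE pf' ?pg'.
Qed.

Lemma step_fun_shift f k c : N k c -> step_fun f -> step_fun (fun x => f (x + c)).
Proof.
move=> Nc /step_fun_range /(_ k) [l [n [lk sf pf]]].
exists l, (l + n%:Z); split=> [x /sf /(chainB chN)/(_ (chain_le lk Nc))|x y Ny].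
  by rewrite addrK.
by rewrite (addrAC _ y) (pf _ y).
Qed.

Lemma coset_periodic k c : periodic k (coset k c).
Proof.
move=> x y Ny; congr ((_ : bool)%:R); apply/asboolP/asboolP; rewrite addrAC.
  by move/(chainDr _ Ny).
by move=> Nx; apply/(chainDr _ Ny).
Qed.

Lemma coset_step k l c : N l c -> step_fun (coset k c).
Proof.
move=> Nc; exists (Num.min k l), k; split; last exact: coset_periodic.
move=> x; rewrite /coset; case: asboolP => [Nx _|_]; last by rewrite eqxx.
rewrite -(subrK c x); apply: chainD; first by apply: chain_le Nx; lia.
by apply: chain_le Nc; lia.
Qed.

(** The index [i] is the digit of [x - c] at level [k]. Stating it for all [j] as a boolean lets a
    sum over digits collapse to one term. *)
Lemma coset_split k c x : N k (x - c) ->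
  exists i, forall j, `[< N (k + 1) (x - (c + r k j)) >] = (j == i).
Proof.
move=> Nx; have [i Ni] := chain_ex chN Nx; exists i => j.
apply/asboolP/eqP => [Nj|->]; last by rewrite opprD addrA.
apply: (chain_uniq chN (k := k)).
rewrite (_ : _ - _ = (x - c - r k i) - (x - (c + r k j))); last by ring.
exact: (chainB chN).
Qed.

Lemma coset_sum k c f x : (f x != 0 -> N k (x - c)) ->
  f x = \sum_i (f x * coset (k + 1) (c + r k i) x).
Proof.
move=> sf; rewrite -big_distrr /=; have [->|/sf/coset_split [i Ni]] := eqVneq (f x) 0.
  by rewrite mul0r.
rewrite (bigD1 i) //= big1 => [|j /negbTE ji]; last by rewrite /coset Ni ji.
by rewrite /coset Ni eqxx addr0 mulr1.
Qed.

(** Induction on the number [n] of levels between the coset that carries [f] and its period. At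
    [n = 0] the function is a multiple of one indicator; otherwise the coset is cut into its [#|I|]
    subcosets, each one level closer to the period. The centre [c] is only asked to lie in some
    [N l], because the cosets met need not contain 0. *)
Lemma step_fun_ind (P : set (V -> C^o)) : is_subspace P ->
  (forall k l c, N l c -> P (coset k c)) -> step_fun `<=` P.
Proof.
move=> [P0 PD] Pc f /step_fun_range /(_ 0) [k [n [_ sf pf]]].
have Psum (J : Type) (s : seq J) (F : J -> V -> C^o) :
    (forall j, P (F j)) -> P (\sum_(j <- s) F j).
  move=> PF; elim: s => [|j s IHs]; first by rewrite big_nil.
  by rewrite big_cons -[F j]scale1r; apply: PD.
suff {f sf pf} gen m l c f : N l c -> (forall x, f x != 0 -> N m (x - c)) ->
    periodic (m + n%:Z) f -> P f.
  by apply: (gen k k 0) => // x /sf; rewrite subr0.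
elim: n m l c f => [|n IHn] m l c f Nc sf pf.
  have -> : f = f c *: coset m c + 0.
    apply/funext => x; rewrite !fctE addr0 /coset.
    case: asboolP => [Nx|Nx]; last first.
      by rewrite scaler0; apply: contrapT => /eqP /sf.
    by rewrite -{1}(subrK c x) addrC pf ?addr0 // -[LHS]mulr1.
  by apply: PD => //; apply: Pc Nc.
have -> : f = \sum_i (fun x => f x * coset (m + 1) (c + r m i) x).
  by apply/funext => x; rewrite fct_sumE; apply: coset_sum (sf x).
apply: Psum => i; apply: (IHn (m + 1) (Num.min l m) (c + r m i)).
- apply: chainD; first by apply: chain_le Nc; lia.
  by apply: chain_le (chain_r chN m i); lia.
- by move=> x; rewrite /coset; case: asboolP; rewrite ?mulr0 ?eqxx.
- have eml : m + 1 + n%:Z = m + n.+1%:Z by lia.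
  rewrite eml => x y Ny; rewrite pf //; congr (_ * _).
  by apply: coset_periodic; apply: chain_le Ny; lia.
Qed.

Section Integral.
Let Q : C := #|I|%:R.
Hypothesis Q0 : Q != 0.

(** The sum of the values of [f] at all [n]-digit expansions starting at level [k]. The weight is
    applied at the bottom, at level [k + n], and is the mass of [N (k + n)] when [N 0] has mass
    1. *)
Fixpoint intg n k f : C :=
  if n is n'.+1 then \sum_i intg n' (k + 1) (fun x => f (x + r k i))
  else Q ^ (- k) * f 0.

Lemma eq_intg n k f g : (forall x, N k x -> f x = g x) -> intg n k f = intg n k g.
Proof.
elim: n k f g => [|n IHn] k f g fg /=; first by rewrite fg.
apply: eq_bigr => i _; apply: IHn => x Nx; apply: fg.
by apply: (chainD _ (chain_r chN k i)); apply: (chainS chN Nx).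
Qed.

Lemma intg_linear n k a f g : intg n k (a *: f + g) = a * intg n k f + intg n k g.
Proof.
elim: n k f g => [|n IHn] k f g /=; first by rewrite !fctE /= mulrDr mulrCA.
rewrite big_distrr -big_split /=; apply: eq_bigr => i _.
exact: (IHn (k + 1) (fun x => f (x + r k i)) (fun x => g (x + r k i))).
Qed.

Lemma periodic_r m k i f : periodic m f -> periodic m (fun x => f (x + r k i)).
Proof. by move=> pf x y Ny; rewrite (addrAC _ y) (pf _ y). Qed.

(** One further refinement replaces each coset by [#|I|] cosets on which [f] takes the same value,
    each with mass divided by [#|I|]. *)
Lemma intgS n k f : periodic (k + n%:Z) f -> intg n.+1 k f = intg n k f.
Proof.
elim: n k f => [|n IHn] k f pf.
  rewrite /= (eq_bigr (fun=> Q ^ (- (k + 1)) * f 0)) => [|i _].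
    rewrite sumr_const -mulr_natl mulrA; congr (_ * _).
    by rewrite opprD expfzDr // mulrCA exprN1 divff ?mulr1.
  by rewrite add0r -{1}[r k i]add0r pf // addr0; apply: (chain_r chN).
rewrite [LHS]/=; apply: eq_bigr => i _; apply: (IHn (k + 1)).
by apply: periodic_r; apply: periodic_le pf; lia.
Qed.

Lemma intg_addn n m k f : periodic (k + n%:Z) f -> intg (m + n) k f = intg n k f.
Proof.
move=> pf; elim: m => // m IHm; rewrite addSn intgS //.
by apply: periodic_le pf; lia.
Qed.

(** Translation by an element of [N k] permutes the digits at level [k]; the discrepancy
    [r k i + a - r k (p i)] lies in [N (k + 1)], where the induction hypothesis absorbs it. *)
Lemma intg_shift n k a f : N k a -> periodic (k + n%:Z) f ->
  intg n k (fun x => f (x + a)) = intg n k f.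
Proof.
elim: n k a f => [|n IHn] k a f Na pf /=; first by rewrite pf // addr0.
have /choice [p pP] i : exists j, N (k + 1) (r k i + a - r k j).
  by apply: (chain_ex chN); apply: (chainD _ Na); apply: (chain_r chN).
have p_inj : injective p.
  move=> i j pij; apply: (chain_uniq chN (k := k)).
  rewrite (_ : _ - _ = (r k i + a - r k (p i)) - (r k j + a - r k (p j))).
    exact: (chainB chN).
  by rewrite pij; ring.
rewrite [RHS](reindex_inj p_inj) /=; apply: eq_bigr => i _.
rewrite -(IHn _ _ (fun x => f (x + r k (p i))) (pP i)); last first.
  by apply: periodic_r; apply: periodic_le pf; lia.
by congr intg; apply/funext => x; congr (f _); ring.
Qed.

Lemma intg0 n k : intg n k (fun=> 0) = 0.
Proof. by elim: n k => [|n IHn] k /=; rewrite ?mulr0 ?big1. Qed.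

(** Exactly one representative [r k i] lies in [N (k + 1)], and it need not be 0. The other cosets
    miss the support, and the shift by [r k i] is absorbed by translation invariance. *)
Lemma intg_down n k f : supported (k + 1) f -> periodic (k + 1 + n%:Z) f ->
  intg n.+1 k f = intg n (k + 1) f.
Proof.
move=> sf pf /=; have [|i Ni] := @coset_split k 0 0; first by rewrite subrr; apply: N0.
have Nj j : N (k + 1) (r k j) <-> j = i.
  have := Ni j; rewrite !add0r => e; split=> [Nj|ji].
    by apply/eqP; rewrite -e; apply/asboolP/chain_opp.
  have : `[< N (k + 1) (- r k j) >] by rewrite e ji.
  by move/asboolP/chain_opp; rewrite opprK.
rewrite (bigD1 i) //= big1 ?addr0 => [|j /eqP ji].
  by apply: intg_shift => //; apply/Nj.
rewrite -(intg0 n (k + 1)); apply: eq_intg => x Nx; apply: contrapT => /eqP /sf.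
by rewrite (addrC x) => /(chainDr _ Nx) /Nj.
Qed.

Lemma intg_downn n m k f :
    supported (k + m%:Z) f -> periodic (k + m%:Z + n%:Z) f ->
  intg (m + n) k f = intg n (k + m%:Z) f.
Proof.
elim: m k => [|m IHm] k sf pf; first by rewrite add0n addr0.
have e : k + m.+1%:Z = k + 1 + m%:Z by lia.
rewrite e in sf pf *; rewrite addSn -IHm // intg_down //.
  by apply: supported_le sf; lia.
by apply: periodic_le pf; lia.
Qed.

(** The sum with the higher starting level is rewritten from the lower one, then both are refined to
    a common depth. This makes the choice in [chain_integral] unambiguous. *)
Lemma intg_uniq n k n' k' f :
    supported k f -> periodic (k + n%:Z) f ->
    supported k' f -> periodic (k' + n'%:Z) f -> intg n k f = intg n' k' f.
Proof.
wlog kk' : n k n' k' / k <= k' => [wl sf pf sf' pf'|].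
  by case/orP: (le_total k k') => ?; [|symmetry]; apply: wl.
have [m ->] : exists m : nat, k' = k + m%:Z by exists `|k' - k|%N; lia.
move=> sf pf sf' pf'; rewrite -intg_downn //.
rewrite -(intg_addn (m + n') pf) addnC intg_addn //.
by apply: periodic_le pf'; lia.
Qed.

Definition chain_integral f : C :=
  xget 0 [set z | exists k n,
    [/\ supported k f, periodic (k + n%:Z) f & z = intg n k f]].

Lemma chain_integralE n k f : supported k f -> periodic (k + n%:Z) f ->
  chain_integral f = intg n k f.
Proof.
move=> sf pf; apply: xget_unique; first by exists k, n.
by move=> _ [k' [n' [sf' pf' ->]]]; apply: intg_uniq.
Qed.

Lemma chain_integral_linear a f g : step_fun f -> step_fun g ->
  chain_integral (a *: f + g) = a * chain_integral f + chain_integral g.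
Proof.
move=> ff gg; have [k [n [_ sf pf]]] := step_fun_range ff 0.
have [k' [n' [kk' sg pg]]] := step_fun_range gg k.
pose m := absz (Num.max (k + n%:Z) (k' + n'%:Z) - k')%R.
have pf' : periodic (k' + m%:Z) f by apply: periodic_le pf; lia.
have pg' : periodic (k' + m%:Z) g by apply: periodic_le pg; lia.
have sf' : supported k' f by apply: supported_le sf.
rewrite !(@chain_integralE m k') ?intg_linear //.
  move=> x; rewrite !fctE /=; have [->|/sf' //] := eqVneq (f x) 0.
  by rewrite scaler0 add0r => /sg.
by move=> x y Ny; rewrite !fctE pf' ?pg'.
Qed.

Lemma chain_integral_shift k a f : N k a -> step_fun f ->
  chain_integral (fun x => f (x + a)) = chain_integral f.
Proof.
move=> Na /step_fun_range /(_ k) [l [n [lk sf pf]]].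
rewrite !(@chain_integralE n l) //.
- by apply: intg_shift => //; apply: chain_le Na.
- by move=> x /sf; move/(chainDr _ (chain_le lk Na)).
- by move=> x y Ny; rewrite (addrAC _ y) (pf _ y).
Qed.

Lemma chain_integral_coset k : chain_integral (coset k 0) = Q ^ (- k).
Proof.
rewrite (@chain_integralE 0 k) /= ?addr0; last exact: coset_periodic.
  by rewrite /coset; case: asboolP; rewrite subr0 ?mulr1 // => /(_ (N0 k)).
by move=> x; rewrite /coset; case: asboolP; rewrite ?eqxx // subr0.
Qed.

End Integral.

Section Invariant.
Variable T : (V -> C^o) -> C^o.
Hypothesis T_linear : forall a f g, step_fun f -> step_fun g ->
  T (a *: f + g) = a *: T f + T g.

Lemma linear_sum (J : Type) (s : seq J) (F : J -> V -> C^o) :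
  (forall j, step_fun (F j)) -> T (\sum_(j <- s) F j) = \sum_(j <- s) T (F j).
Proof.
move=> FF; have [s0 sD] := step_fun_subspace.
have T0 : T 0 = 0.
  have := T_linear 1 s0 s0.
  by rewrite scaler0 addr0 scale1r => /eqP;
     rewrite -subr_eq0 opprD addrA subrr sub0r oppr_eq0 => /eqP.
suff [] : step_fun (\sum_(j <- s) F j) /\ T (\sum_(j <- s) F j) = \sum_(j <- s) T (F j) by [].
elim: s => [|j s [IHs IHT]]; first by rewrite !big_nil.
rewrite !big_cons; split; first by rewrite -[F j]scale1r; apply: sD.
by have := T_linear 1 (FF j) IHs; rewrite !scale1r => ->; rewrite IHT.
Qed.

Lemma linear_coset k l c : N l c ->
  T (coset k c) = \sum_i T (coset (k + 1) (c + r k i)).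
Proof.
move=> Nc; rewrite -linear_sum; last first.
  move=> i; apply: (@coset_step _ (Num.min l k)).
  apply: chainD; first by apply: chain_le Nc; lia.
  by apply: chain_le (chain_r chN k i); lia.
congr T; apply/funext => x; rewrite fct_sumE (@coset_sum k c).
  apply: eq_bigr => i _; rewrite /coset; case: (asboolP (N (k + 1) _)) => Ni.
    case: asboolP => [_|[]]; first by rewrite mulr1.
    rewrite (_ : x - c = x - (c + r k i) + r k i); last by ring.
    by apply: (chainD _ (chain_r chN k i)); apply: (chainS chN Ni).
  by rewrite mulr0.
by rewrite /coset; case: asboolP; rewrite ?eqxx.
Qed.

End Invariant.
End Chain.

(** * A list of properties shared by the three kinds of fields *)

(* [tdB :&: tdO] maps onto the valuation ring of the residue field, and [resW k]
   is the preimage in [tdO] of the [k]-th power of its maximal ideal. *)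
Definition resW (X : two_dim_data) (k : int) : set X :=
  [set x | exists b o, [/\ tdB b, tdO b, @tdO X o & x = tdu X ^ k * b + tdt X * o]].
Arguments resW X k _ : clear implicits.

(** Modulo [t], the ring [tdB :&: tdO] acts as the valuation ring of the residue field: its
    multiples by negative powers of [u] exhaust the residue field ([res_absorb]), it has [q] classes
    modulo [u] ([res_digits]), and it is complete ([res_complete]). Completeness is phrased with
    [resW], hence modulo [t] only; [sub_complete] lifts it to O(i)/O(j). *)
Record two_dim_axioms (X : two_dim_data) (q : nat) : Prop := TwoDimAxioms {
  O1 : @tdO X 1;
  OB : forall x y, tdO x -> tdO y -> @tdO X (x - y);
  OM : forall x y, tdO x -> tdO y -> @tdO X (x * y);
  B1 : @tdB X 1;
  BB : forall x y, tdB x -> tdB y -> @tdB X (x - y);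
  BM : forall x y, tdB x -> tdB y -> @tdB X (x * y);
  t0 : tdt X != 0;
  u0 : tdu X != 0;
  Ot : tdO (tdt X);
  OtV : ~ tdO (tdt X)^-1;
  Ou : tdO (tdu X);
  OuV : tdO (tdu X)^-1;
  Bt : tdB (tdt X);
  BtV : tdB (tdt X)^-1;
  Bu : tdB (tdu X);
  O'E : @tdO' X = resW X 0;
  res_absorb : forall x, tdO x -> exists k : nat, resW X 0 (tdu X ^+ k * x);
  res_digits : exists d : 'I_q -> X,
    [/\ forall i, tdB (d i) /\ tdO (d i),
        forall b, tdB b -> tdO b -> exists i, resW X 1 (b - d i)
      & forall i j, resW X 1 (d i - d j) -> i = j];
  res_complete : forall x : nat -> X, (forall n, tdB (x n) /\ tdO (x n)) ->
    (forall n : nat, resW X n%:Z (x n.+1 - x n)) ->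
    exists y, forall n : nat, resW X n%:Z (y - x n)
}.

(** * Arithmetic of the lattices O(i) and of the basic subgroups *)

Section TwoDim.
Variables (X : two_dim_data) (q : nat).
Hypothesis aX : two_dim_axioms X q.
Implicit Types (i j k l : int) (x y z b o : X).

Local Notation t := (tdt X).
Local Notation u := (tdu X).
Local Notation O := (@tdO X).
Local Notation B := (@tdB X).
Local Notation lat := (@lat X).
Local Notation nb := (@nb X).

Lemma O0 : O 0. Proof. by rewrite -(subrr 1); apply: (OB aX); exact: (O1 aX). Qed.
Lemma ON x : O x -> O (- x).
Proof. by move=> Ox; rewrite -sub0r; apply: (OB aX) Ox; apply: O0. Qed.
Lemma OD x y : O x -> O y -> O (x + y).
Proof. by move=> Ox /ON Oy; rewrite -[y]opprK; apply: (OB aX). Qed.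
Lemma B0 : B 0. Proof. by rewrite -(subrr 1); apply: (BB aX); exact: (B1 aX). Qed.

Lemma exprz_closed (S : set X) x : S 1 -> (forall y z, S y -> S z -> S (y * z)) ->
  S x -> S x^-1 -> forall k : int, S (x ^ k).
Proof.
move=> S1 SM Sx SV; have Sn y n : S y -> S (y ^+ n).
  by move=> Sy; elim: n => [//|n IHn]; rewrite exprS; apply: SM.
by case=> n; rewrite ?NegzE -?exprz_inv; apply: Sn.
Qed.

Lemma Bt_exp k : B (t ^ k).
Proof.
by apply: exprz_closed; [exact: (B1 aX)|exact: (BM aX)|exact: (Bt aX)|exact: (BtV aX)].
Qed.
Lemma Ou_exp k : O (u ^ k).
Proof.
by apply: exprz_closed; [exact: (O1 aX)|exact: (OM aX)|exact: (Ou aX)|exact: (OuV aX)].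
Qed.
Lemma Bu_exp (n : nat) : B (u ^+ n).
Proof.
elim: n => [|n IHn]; first exact: (B1 aX).
by rewrite exprS; apply: (BM aX) => //; exact: (Bu aX).
Qed.
Lemma Ot_exp (n : nat) : O (t ^+ n).
Proof.
elim: n => [|n IHn]; first exact: (O1 aX).
by rewrite exprS; apply: (OM aX) => //; exact: (Ot aX).
Qed.

Lemma te0 k : t ^ k != 0. Proof. by apply: expfz_neq0; apply: (t0 aX). Qed.
Lemma ue0 k : u ^ k != 0. Proof. by apply: expfz_neq0; apply: (u0 aX). Qed.

Lemma latE i x : lat i x <-> O (t ^ (- i) * x).
Proof.
split=> [[ o Oo <-]|Ox]; first by rewrite mulrA -expfzDr ?(t0 aX) // addNr mul1r.
by exists (t ^ (- i) * x) => //; rewrite mulrA -expfzDr ?(t0 aX) // subrr mul1r.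
Qed.

Lemma lat_0 i : lat i 0.
Proof. by apply/latE; rewrite mulr0; apply: O0. Qed.
Lemma lat_B i x y : lat i x -> lat i y -> lat i (x - y).
Proof. by rewrite !latE mulrBr; apply: (OB aX). Qed.
Lemma lat_N i x : lat i x -> lat i (- x).
Proof. by rewrite !latE mulrN; apply: ON. Qed.
Lemma lat_D i x y : lat i x -> lat i y -> lat i (x + y).
Proof. by rewrite !latE mulrDr; apply: OD. Qed.
Lemma lat_Dr i x y : lat i y -> lat i (x + y) <-> lat i x.
Proof. by move=> Ly; split=> [/lat_B/(_ Ly)|/lat_D]; rewrite ?addrK //; apply. Qed.
Lemma lat_le i j x : i <= j -> lat j x -> lat i x.
Proof.
rewrite !latE => ij Ox; have [n jn] : exists n : nat, - i = n%:Z - j.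
  by exists `|j - i|%N; lia.
by rewrite jn expfzDr ?(t0 aX) // -mulrA; apply: (OM aX) => //; apply: Ot_exp.
Qed.
Lemma lat_O i x o : O o -> lat i x -> lat i (o * x).
Proof. by rewrite !latE mulrCA => Oo; apply: (OM aX). Qed.
Lemma lat_shift i a x : lat (i + a) (t ^ a * x) <-> lat i x.
Proof. by rewrite !latE mulrA -expfzDr ?(t0 aX) // opprD addrNK. Qed.
Lemma lat_u i a x : lat i (u ^ a * x) <-> lat i x.
Proof.
split=> [/(lat_O (Ou_exp (- a)))|]; last exact/lat_O/Ou_exp.
by rewrite mulrA -expfzDr ?(u0 aX) // addNr mul1r.
Qed.

Definition sub (i j k : int) : set X := [set y + z | y in nb i k & z in lat j].

(** All powers of [t] lie in B, so an element of u^k B in O(i) can be divided by t^i u^k without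
    leaving B, and the quotient lies in O. *)
Lemma subE i j k x : sub i j k x <->
  exists b o, [/\ B b, O b, O o & x = t ^ i * u ^ k * b + t ^ j * o].
Proof.
split=> [[y [[b Bb <-] Ly] [z [ o Oo <-] <-]]|[b [ o [Bb Ob Oo ->]]]].
  exists (t ^ (- i) * b), o; split => //.
  - by apply: (BM aX) => //; apply: Bt_exp.
  - by move/lat_u/latE: Ly.
  - by congr (_ + _); rewrite mulrACA -expfzDr ?(t0 aX) // subrr mul1r.
exists (t ^ i * u ^ k * b); last by exists (t ^ j * o) => //; exists o.
split; first by exists (t ^ i * b); [apply: (BM aX) => //; apply: Bt_exp|ring].
by rewrite -mulrA; exists (u ^ k * b) => //; apply: (OM aX) => //; apply: Ou_exp.
Qed.

Lemma resWE k : resW X k = sub 0 1 k.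
Proof. by apply/funext => x; apply/propext; rewrite subE expr0z mul1r expr1z. Qed.

Lemma sub_0 i j k : sub i j k 0.
Proof. by apply/subE; exists 0, 0; split; rewrite ?mulr0 ?addr0 //; [exact: B0|exact: O0..]. Qed.

Lemma sub_B i j k x y : sub i j k x -> sub i j k y -> sub i j k (x - y).
Proof.
move=> /subE [b [ o [Bb Ob Oo ->]]] /subE [b' [ o' [Bb' Ob' Oo' ->]]].
apply/subE; exists (b - b'), (o - o'); split; last by ring.
- exact: (BB aX). - exact: (OB aX). - exact: (OB aX).
Qed.
Lemma sub_N i j k x : sub i j k x -> sub i j k (- x).
Proof. by move=> Sx; rewrite -sub0r; apply: sub_B Sx; apply: sub_0. Qed.
Lemma sub_D i j k x y : sub i j k x -> sub i j k y -> sub i j k (x + y).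
Proof. by move=> Sx /sub_N Sy; rewrite -[y]opprK; apply: sub_B. Qed.

Lemma sub_le i j k l x : k <= l -> sub i j l x -> sub i j k x.
Proof.
move=> kl /subE [b [ o [Bb Ob Oo ->]]].
have [n ->] : exists n : nat, l = k + n%:Z by exists `|l - k|%N; lia.
apply/subE; exists (u ^+ n * b), o; split => //.
- by apply: (BM aX) => //; apply: Bu_exp.
- by apply: (OM aX) => //; apply: (Ou_exp n).
- by rewrite expfzDr ?(u0 aX) // !mulrA.
Qed.

Lemma lat_sub i j k x : lat j x -> sub i j k x.
Proof.
move=> Lx; exists 0; last by exists x; rewrite ?add0r.
by split; [exists 0; rewrite ?mulr0 //; apply: B0|apply: lat_0].
Qed.

Lemma sub_lat i j k x : i <= j -> sub i j k x -> lat i x.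
Proof. by move=> ij [y [_ Ly]] [z Lz <-]; apply: lat_D Ly _; apply: lat_le Lz. Qed.

Lemma sub_lel i i' j k x : i <= i' -> sub i' j k x -> sub i j k x.
Proof.
move=> ii [y [By Ly]] [z Lz <-]; exists y; last by exists z.
by split => //; apply: lat_le Ly.
Qed.

Lemma sub_ler i j j' k x : j' <= j -> sub i j k x -> sub i j' k x.
Proof. by move=> jj [y By] [z Lz <-]; exists y => //; exists z => //; apply: lat_le Lz. Qed.

(** The O(j)-part of [x] already lies in O(i') because i' <= j, so the other part, being a
    difference, lies there too. *)
Lemma sub_capl i i' j k x : i' <= j -> lat i' x -> sub i j k x -> sub i' j k x.
Proof.
move=> ij Lx [y [By Ly]] [z Lz xE]; exists y; last by exists z.
split=> //; rewrite -(addrK z y) xE; apply: lat_B Lx _; exact: lat_le Lz.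
Qed.

(** The image in O(i)/O(j') of the basic subgroup of O(i)/O(j) is the basic subgroup of the same
    level. *)
Lemma sub_addr i j j' k x : j' <= j ->
  sub i j' k x <-> exists n z, [/\ sub i j k n, lat j' z & x = n + z].
Proof.
move=> jj; split=> [[y By [z Lz <-]]|[n [z [/(sub_ler jj) Sn Lz ->]]]].
  by exists y, z; split => //; exists y => //; exists 0; rewrite ?addr0 //; apply: lat_0.
by apply: sub_D Sn _; apply: lat_sub.
Qed.

Lemma sub_shift i j k a c x :
  sub (i + a) (j + a) (k + c) (u ^ c * t ^ a * x) <-> sub i j k x.
Proof.
suff {i j k a c x} gen i j k a c x : sub i j k x ->
    sub (i + a) (j + a) (k + c) (u ^ c * t ^ a * x).
  split=> [/(gen _ _ _ (- a) (- c))|]; last exact: gen.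
  rewrite !addrK mulrA (_ : u ^ (- c) * t ^ (- a) * (u ^ c * t ^ a) = 1) ?mul1r //.
  rewrite mulrACA -!expfzDr ?(u0 aX) ?(t0 aX) // !addNr mul1r //.
move=> /subE [b [ o [Bb Ob Oo ->]]]; apply/subE; exists b, (u ^ c * o); split => //.
  by apply: (OM aX) => //; apply: Ou_exp.
by rewrite !expfzDr ?(u0 aX) ?(t0 aX) //; ring.
Qed.

(** Induction on [j - i]: a power of [u] makes the leading coefficient in [t] integral by
    [res_absorb], and the remainder lies in O(i+1). The smaller of the two levels serves for
    both. *)
Lemma sub_total i j x : i <= j -> lat i x -> exists k, sub i j k x.
Proof.
move=> ij; have [n ->] : exists n : nat, j = i + n%:Z by exists `|j - i|%N; lia.
elim: n i x {ij} => [|n IHn] i x Lx; first by exists 0; apply: lat_sub; rewrite addr0.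
have [k] := res_absorb aX ((latE _ _).1 Lx); rewrite resWE => Wx.
have [n0 [z [Sn Lz xE]]] := (sub_addr 0 0 _ (isT : 1 <= n.+1%:Z)).1 Wx.
have e : i + n.+1%:Z = i + 1 + n%:Z by lia.
have [l Sl] : exists l, sub (i + 1) (i + 1 + n%:Z) l (u ^ (- k%:Z) * t ^ i * z).
  by apply: IHn; rewrite -mulrA lat_u addrC lat_shift.
have /(sub_shift _ _ _ i (- k%:Z)) := Sn; rewrite !add0r (addrC _ i) => Sk.
exists (Num.min l (- k%:Z)).
have -> : x = u ^ (- k%:Z) * t ^ i * n0 + u ^ (- k%:Z) * t ^ i * z.
  rewrite -mulrDr -xE exprnP [RHS]mulrACA -expfzDr ?(u0 aX) // addNr mul1r.
  by rewrite mulrA -expfzDr ?(t0 aX) // subrr mul1r.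
rewrite e in Sk *; apply: sub_D; first by apply: sub_le Sk; lia.
by apply: sub_lel (sub_le _ Sl); lia.
Qed.
End TwoDim.

(** * Digits, completeness and compactness in O(i)/O(j) *)

Section Topology.
Variables (X : two_dim_data) (q : nat).
Hypothesis aX : two_dim_axioms X q.
Implicit Types (i j k l : int) (x y z : X).

Local Notation t := (tdt X).
Local Notation u := (tdu X).
Local Notation O := (@tdO X).
Local Notation B := (@tdB X).

(** O(i)/O(i+m) is an m-fold extension of copies of the residue field, so consecutive levels have
    index [q ^ m]. A digit is a residue digit placed at t^i together with a digit for
    O(i+1)/O(i+m). *)
Lemma sub_chain i (m : nat) : exists (I : finType) (r : int -> I -> X),
  #|I| = (q ^ m)%N /\ chain (sub i (i + m%:Z)) r.
Proof.
suff gen : forall m i, exists (I : finType) (r : int -> I -> X),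
    #|I| = (q ^ m)%N /\ forall k,
    [/\ forall a, sub i (i + m%:Z) k (r k a),
        forall x, sub i (i + m%:Z) k x ->
          exists a, sub i (i + m%:Z) (k + 1) (x - r k a)
      & forall a b, sub i (i + m%:Z) (k + 1) (r k a - r k b) -> a = b].
  have [I [r [cI rP]]] := gen m i; exists I, r; split=> //; split=> k.
  - exact: (sub_0 aX).
  - exact: (sub_B aX).
  - by move=> x; apply: (sub_le aX); lia.
  - by case: (rP k).
  - by case: (rP k).
  - by case: (rP k).
have [d [dBO d_ex d_uniq]] := res_digits aX.
elim=> {i m} [|m IHm] i.
  exists unit, (fun _ _ => 0); split; first by rewrite card_unit.
  move=> k; rewrite addr0; split=> [_|x /(sub_lat aX (lexx i)) Lx|[] [] //].
    exact: (sub_0 aX).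
  by exists tt; rewrite subr0; apply: (lat_sub aX).
have [I [r [cI rP]]] := IHm (i + 1).
pose r' k (a : 'I_q * I) := u ^ k * t ^ i * d a.1 + r k a.2.
have e : i + 1 + m%:Z = i + m.+1%:Z by lia.
rewrite e in rP; exists ('I_q * I)%type, r'; split.
  by rewrite card_prod card_ord cI expnS.
have res k x : sub i (i + 1) k (u ^ k * t ^ i * x) <-> resW X 0 x.
  by rewrite (resWE aX) -(sub_shift aX 0 1 0 i k) !add0r (addrC 1).
have res1 k x : sub i (i + 1) (k + 1) (u ^ k * t ^ i * x) <-> resW X 1 x.
  by rewrite (resWE aX) -(sub_shift aX 0 1 1 i k) !add0r (addrC 1) (addrC 1).
have Bsub k b : B b -> O b -> sub i (i + m.+1%:Z) k (u ^ k * t ^ i * b).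
  move=> Bb Ob; apply/(subE aX); exists b, 0; split=> //; first exact: (O0 aX).
  by rewrite mulr0 addr0 (mulrC (u ^ k)).
move=> k; have [rN r_ex r_uniq] := rP k; split=> [a|x Sx|a b Sab].
- have [Bd Od] := dBO a.1; apply: (sub_D aX); first exact: Bsub.
  by apply: (sub_lel aX) (rN _); lia.
- have /(subE aX) [b [ o [Bb Ob Oo xE]]] := Sx.
  have [a Wa] := d_ex b Bb Ob; have im : i + 1 <= i + m.+1%:Z by lia.
  have [n [z [Sn Lz nz]]] := (sub_addr aX i (k + 1) _ im).1 ((res1 k _).2 Wa).
  (* [z] is the carry: subtracting the leading digit leaves an element of O(i+1), which the
     remaining digits must represent. *)
  have [|a' Sa'] := r_ex (z + t ^ (i + m.+1%:Z) * o).
    have Lo : lat (i + m.+1%:Z) (t ^ (i + m.+1%:Z) * o) by exists o.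
    apply: (sub_D aX) (lat_sub aX _ _ Lo).
    apply: (sub_capl aX (i := i)) Lz _; first by lia.
    rewrite (_ : z = u ^ k * t ^ i * b - u ^ k * t ^ i * d a - n); last by rewrite -mulrBr nz; ring.
    apply: (sub_B aX); last by apply: (sub_le aX) Sn; lia.
    by have [Bd Od] := dBO a; apply: (sub_B aX); apply: Bsub.
  exists (a, a'); rewrite /r' /= (_ : x - _ = n + (z + t ^ (i + m.+1%:Z) * o - r k a')).
    by apply: (sub_D aX) Sn _; apply: (sub_lel aX) Sa'; lia.
  by rewrite xE (mulrC (t ^ i)) -[u ^ k * t ^ i * b](subrK (u ^ k * t ^ i * d a)) -mulrBr nz; ring.
- have rr : lat (i + 1) (r k a.2 - r k b.2).
    by apply: (lat_B aX); apply: (sub_lat aX) (rN _); lia.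
  have ab1 : a.1 = b.1.
    apply: d_uniq; apply/(res1 k).
    rewrite (_ : _ * _ = r' k a - r' k b - (r k a.2 - r k b.2)); last by rewrite /r'; ring.
    apply: (sub_B aX); last exact: (lat_sub aX).
    by apply: (sub_ler aX) Sab; lia.
  have ab2 : a.2 = b.2.
    apply: r_uniq; apply: (sub_capl aX (i := i)) rr _; first by lia.
    by rewrite (_ : _ - _ = r' k a - r' k b) // /r' ab1; ring.
  by case: a b ab1 ab2 {Sab rr} => ? ? [? ?] /= -> ->.
Qed.

Lemma sub_nested i j (x : nat -> X) :
  (forall n, sub i j n%:Z (x n.+1 - x n)) ->
  forall n m, sub i j n%:Z (x (n + m)%N - x n).
Proof.
move=> Sx n; elim=> [|m IHm]; first by rewrite addn0 subrr; apply: (sub_0 aX).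
rewrite addnS -(subrK (x (n + m)%N) (x _.+1)) -addrA; apply: (sub_D aX) IHm.
by apply: (sub_le aX) (Sx _); lia.
Qed.

(** Induction on the length [j - i]. The sequence first converges modulo O(i+1) to some [y], by
    completeness of the residue field; the errors, corrected into O(i+1), form a Cauchy sequence
    there with limit [w] by induction, and [y - w] is the limit sought. *)
Lemma sub_complete i j (x : nat -> X) : i <= j -> lat i (x 0%N) ->
  (forall n, sub i j n%:Z (x n.+1 - x n)) ->
  exists y, forall n, sub i j n%:Z (y - x n).
Proof.
move=> ij; have [m ->] : exists m : nat, j = i + m%:Z by exists `|j - i|%N; lia.
elim: m i x {j ij} => [|m IHm] i x L0 Sx.
  exists (x 0%N) => n; rewrite -opprB; apply: (sub_N aX); apply: (lat_sub aX).
  by have := sub_nested Sx 0 n; rewrite add0n !addr0 => /(sub_lat aX (lexx _)).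
have e : i + 1 + m%:Z = i + m.+1%:Z by lia.
have im : i + 1 <= i + m.+1%:Z by lia.
have [y Sy] : exists y, forall n : nat, sub i (i + 1) n%:Z (y - x n).
  have Sx1 n : sub i (i + 1) n%:Z (x n.+1 - x n) by apply: (sub_ler aX) (Sx n).
  have [k Wk] := res_absorb aX ((latE aX _ _).1 L0).
  (* Multiplication by [t ^ (- i)] moves the leading coefficient to level 0, and [k] is chosen so
     that all terms of the sequence get integral residues. *)
  pose g z := u ^ k%:Z * t ^ (- i) * z.
  have gB z z' : g (z - z') = g z - g z' by rewrite /g; ring.
  have gE n z : sub i (i + 1) n z <-> resW X (n + k%:Z) (g z).
    by rewrite (resWE aX) -(sub_shift aX i (i + 1) n (- i) k%:Z) subrr addrAC subrr add0r.
  have W0 n : resW X 0 (g (x n)).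
    rewrite (resWE aX) -(subrK (g (x 0%N)) (g _)) -gB; apply: (sub_D aX).
      have := sub_nested Sx1 0 n; rewrite add0n gE (resWE aX).
      by apply: (sub_le aX); lia.
    by move: Wk; rewrite (resWE aX) mulrA.
  have /choice [b bP] n : exists b, [/\ B b, O b & lat 1 (g (x n) - b)].
    have [b [ o [Bb Ob Oo ->]]] := W0 n; exists b; split=> //.
    by rewrite expr0z mul1r addrAC subrr add0r; exists o.
  have [n|n|y Wy] := res_complete aX (x := b).
  - by case: (bP n).
  - have [_ _ l1] := bP n; have [_ _ l2] := bP n.+1.
    rewrite (resWE aX) (_ : b _ - _ = g (x n.+1 - x n) + ((g (x n) - b n) - (g (x n.+1) - b n.+1))).
      apply: (sub_D aX); last by apply: (lat_sub aX); apply: (lat_B aX).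
      by have := Sx1 n; rewrite gE (resWE aX); apply: (sub_le aX); lia.
    by rewrite gB; ring.
  pose y' := u ^ (- k%:Z) * t ^ i * y.
  have gy : g y' = y.
    rewrite /g /y' mulrA mulrACA -!expfzDr ?(t0 aX) ?(u0 aX) // subrr addNr.
    by rewrite !mul1r.
  exists y' => n.
  (* The scaling by [u ^ k] costs [k] levels of precision, so level [n] is reached at index
     [n + k]. *)
  rewrite -(subrK (x (n + k)%N) y') -addrA; apply: (sub_D aX); last exact: sub_nested.
  have : resW X (n + k)%N%:Z (g y' - g (x (n + k)%N)).
    have [_ _ l1] := bP (n + k)%N.
    rewrite gy (resWE aX) (_ : _ - _ = (y - b (n + k)%N) - (g (x (n + k)%N) - b (n + k)%N)).
      apply: (sub_B aX); last exact: (lat_sub aX).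
      by have := Wy (n + k)%N; rewrite (resWE aX).
    by ring.
  rewrite -gB => W; have : sub i (i + 1) (n%:Z) (y' - x (n + k)%N) by rewrite gE.
  by [].
have /choice [z zP] n : exists z, lat (i + 1) z /\ sub i (i + m.+1%:Z) n%:Z (y - x n - z).
  have /(sub_addr aX _ _ _ im) [a [z [Sa Lz ->]]] := Sy n.
  by exists z; rewrite addrK.
have [|n|w Sw] := IHm (i + 1) z; first by case: (zP 0%N).
  have [Lz Sz] := zP n; have [Lz' Sz'] := zP n.+1.
  rewrite e; apply: (sub_capl aX (i := i)) => //; first exact: (lat_B aX).
  rewrite (_ : _ - _ = (y - x n - z n) - (y - x n.+1 - z n.+1) - (x n.+1 - x n)); last by ring.
  apply: (sub_B aX) (Sx n); apply: (sub_B aX) => //.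
  by apply: (sub_le aX) Sz'; lia.
exists (y - w) => n; have [_ Sz] := zP n.
rewrite (_ : _ - _ = (y - x n - z n) - (w - z n)); last by ring.
by apply: (sub_B aX) Sz _; have := Sw n; rewrite e; apply: (sub_lel aX); lia.
Qed.

Lemma nbhs_sub i j k (x : topo X i j) : lat i (x : X) ->
  nbhs x [set y : topo X i j | sub i j k ((y : X) - x)].
Proof.
move=> Lx; apply: open_nbhs_nbhs; split; last first.
  by rewrite /= subrr; apply: (sub_0 aX).
exists [set [set y : topo X i j | sub i j k ((y : X) - x)]]; last by rewrite bigcup_set1.
move=> _ ->; apply: finI_from1; exists k, (x : X) => //.
apply/funext => y /=; apply/propext; split.
  by move=> [n nbn [z Lz nz]]; exists n => //; exists z => //; rewrite -addrA nz addrC subrK.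
by move=> [n nbn [z Lz <-]]; exists n => //; exists z => //; ring.
Qed.

Lemma finI_sub i j (V : set X) x : finI_from (@nb_cosets X i j) id V -> V x ->
  exists k, forall y, sub i j k (y - x) -> V y.
Proof.
move=> [E sE <-] Vx.
have ex_k (W : set X) : W \in E -> exists k, forall y : X, sub i j k (y - x) -> W y.
  move=> WE; have /set_mem[k [z Lz WE']] := sE W WE.
  exists k => y Sy; have := Vx W WE; rewrite /= WE' => -[n nbn [z' Lz' xE]].
  have [n' nbn' [w Lw nw]] : sub i j k (y - x + (n + z')).
    by apply: (sub_D aX) Sy _; exists n => //; exists z'.
  by exists n' => //; exists w => //; rewrite -addrA nw -xE; ring.
have [k kE] : exists k, forall W, W \in E ->
    forall y : X, sub i j k (y - x) -> W y.
  suff gen (s : seq (set X)) : {subset s <= E} -> exists k, forall W, W \in s ->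
      forall y : X, sub i j k (y - x) -> W y by apply: (gen (enum_fset E)).
  elim: s => [|W s IHs] sE'; first by exists 0.
  have [k1 k1W] := ex_k W (sE' W (mem_head _ _)).
  have [W' W's|k2 k2s] := IHs; first by apply: sE'; rewrite inE W's orbT.
  exists (Num.max k1 k2) => W'; rewrite inE => /predU1P[->|/k2s W's] y Sy.
    by apply: k1W; apply: (sub_le aX) Sy; lia.
  by apply: W's; apply: (sub_le aX) Sy; lia.
by exists k => y Sy W WE; apply: kE.
Qed.

Lemma nbhs_subP i j (x : topo X i j) (A : set (topo X i j)) :
  nbhs x A -> exists k, forall y : X, sub i j k (y - x) -> A y.
Proof.
rewrite nbhsE => -[U [[D sD UE] Ux] sUA].
have : (\bigcup_(V in D) V) x by rewrite UE.
move=> [V DV Vx]; have [k kV] := finI_sub (sD V DV) Vx.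
by exists k => y /kV Vy; apply: sUA; rewrite -UE; exists V.
Qed.

(** At each finer level an ultrafilter selects one of finitely many cosets. The chosen centres form
    a Cauchy sequence, and the ultrafilter converges to its limit, which [sub_complete] provides. *)
Lemma sub_compact i j k : i <= j -> compact (sub i j k : set (topo X i j)).
Proof.
move=> ij; rewrite compact_ultra => U UU Uk.
have [m jE] : exists m : nat, j = i + m%:Z by exists `|j - i|%N; lia.
have [I [r [_ ch]]] := sub_chain i m; rewrite -jE in ch.
pose co n c : set (topo X i j) := [set z | sub i j n ((z : X) - c)].
have step n c : U (co n c) -> exists c', U (co (n + 1) c').
  move=> Uc; apply: contrapT => /forallNP nU.
  have : \forall z \near U, forall a, (~` co (n + 1) (c + r n a)) z.
    apply: filter_forall => a.
    by have [/nU|] := in_ultra_setVsetC (co (n + 1) (c + r n a)) UU.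
  move=> /(filterI Uc) /filter_ex [z [/(coset_split ch) [a /(_ a)] /=]].
  by rewrite eqxx => /asboolP Sa /(_ a).
have ex n : exists c, U (co n c).
  suff [c Uc] : exists c, U (co (k + `|n - k|%N%:Z) c).
    exists c; apply: filterS Uc => z; apply: (sub_le aX); lia.
  elim: `|n - k|%N => [|d [c /step]]; last by rewrite -addrA -PoszD addn1.
  by exists 0; rewrite addr0 /co /=; under eq_fun do rewrite subr0.
have /choice [x xP] n := ex (n : nat)%:Z.
have Sx (n : nat) : sub i j n%:Z (x n.+1 - x n).
  have /(filterI (xP n)) /filter_ex [z [/= S1 S2]] := xP n.+1.
  rewrite (_ : _ - _ = ((z : X) - x n) - ((z : X) - x n.+1)); last by ring.
  by apply: (sub_B aX) => //; apply: (sub_le aX) S2; lia.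
have Sk (n : nat) : k <= n%:Z -> sub i j k (x n).
  have /filter_ex [z [/= S1 S2]] : U (co n%:Z (x n) `&` sub i j k) by exact: filterI.
  move=> kn; rewrite (_ : x n = (z : X) - ((z : X) - x n)); last by ring.
  by apply: (sub_B aX) => //; apply: (sub_le aX) S1.
have L0 : lat i (x 0%N).
  have := sub_nested Sx 0 `|k|; rewrite add0n => S0.
  rewrite (_ : x 0%N = x `|k|%N - (x `|k|%N - x 0%N)); last by ring.
  by apply: (lat_B aX); apply: (sub_lat aX ij); [apply: Sk; lia|exact: S0].
have [y Sy] := sub_complete ij L0 Sx.
have Ly : sub i j k y.
  rewrite -(subrK (x `|k|%N) y); apply: (sub_D aX); last by apply: Sk; lia.
  by apply: (sub_le aX) (Sy _); lia.
exists y; split=> //= A /(nbhs_subP) [l sA].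
apply: filterS (xP `|l|%N) => z Sz; apply: sA.
rewrite (_ : _ - _ = ((z : X) - x `|l|%N) - (y - x `|l|%N)); last by ring.
by apply: (sub_B aX); [apply: (sub_le aX) Sz|apply: (sub_le aX) (Sy _)]; lia.
Qed.

(** From right to left, [sub_compact] supplies the compact set. Conversely, compactness of the set
    [A] turns the local periods of [f] into one period, and the local support bounds into one
    bound. *)
Lemma testE (R : realType) i j : i <= j -> @test R X i j = step_fun (sub i j).
Proof.
move=> ij; apply/seteqP; split=> f; last first.
  move=> [k [l [sf pf]]]; split.
  - move=> x Lx; apply: contrapT => /eqP /sf /(sub_lat aX ij) //.
  - by move=> x y _ Ly; apply: pf; apply: (lat_sub aX).
  - move=> x Lx; apply: filterS (nbhs_sub l Lx) => y Sy.
    by rewrite -(pf (x : X) _ Sy) addrC subrK.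
  - exists (sub i j k); split; first exact: sub_compact.
      by move=> x /(sub_lat aX ij).
    by [].
move=> [f0 fj fl [A [cA sA Af]]].
have nc := (compact_near_coveringP _).1 cA.
(* The filter of large integers: near-covering compactness then yields a single level valid on all
   of [A]. *)
pose F : set_system int := filter_from setT (fun k => [set l | k <= l]).
have FF : Filter F.
  apply: filter_from_filter; first by exists 0.
  by move=> k l _ _; exists (Num.max k l) => // m /=; lia.
have [l _ /(_ l (lexx _)) pl] : \near F,
    A `<=` (fun k x => forall y : X, sub i j k y -> f (x + y) = f x) F.
  apply: nc => x Ax; have Lx := sA _ Ax.
  have [k kf] := nbhs_subP (fl x Lx).
  exists ([set y : topo X i j | sub i j k ((y : X) - x)], [set l | k <= l]).
    by split; [exact: nbhs_sub|exists k].
  move=> [x' l] [/= Sx' kl] y /(sub_le aX kl) Sy.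
  rewrite (kf x' Sx') (kf (x' + y)) //.
  by rewrite addrAC; apply: (sub_D aX).
have [k _ /(_ k (lexx _)) sk] : \near F, A `<=` (fun k x => sub i j (- k) x) F.
  apply: nc => x Ax; have Lx := sA _ Ax.
  have [k kx] := sub_total aX ij Lx.
  exists ([set y : topo X i j | sub i j k ((y : X) - x)], [set l | - k <= l]).
    by split; [exact: nbhs_sub|exists (- k)].
  move=> [x' l'] [/= Sx' kl]; rewrite -(subrK (x : X) x').
  by apply: (sub_le aX (l := k)); [lia|exact: (sub_D aX)].
exists (- k), l; split=> [x /Af /sk //|x y Sy].
have [Ax|nAx] := pselect (A x); first exact: pl.
(* For [x] outside [A] the period is used at [x + y] in the opposite direction; if both points are
   outside, both values are 0. *)
have [Axy|nAxy] := pselect (A (x + y)).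
  by rewrite -[in RHS](addrK y x) (pl _ Axy) //; apply: (sub_N aX).
have z z' : ~ A z' -> f z' = 0 by move=> nA; apply: contrapT => /eqP /Af.
by rewrite !z.
Qed.
End Topology.

(** * Test functions and Haar measures *)

Lemma int_diff (i j : int) : i <= j -> exists m : nat, j = i + m%:Z.
Proof. by move=> ij; exists `|j - i|%N; lia. Qed.

Section Haar.
Variables (R : realType) (X : two_dim_data) (q : nat).
Hypothesis aX : two_dim_axioms X q.
Hypothesis q_gt1 : (1 < q)%N.
Implicit Types (i j k l : int) (x y z : X) (f g : func R X) (T S : dist R X).

Local Notation u := (tdu X).
Local Notation B := (@tdB X).
Local Notation C := R[i].
Local Notation test := (@test R X).
Local Notation distr := (@distr R X).
Local Notation haar := (@haar R X).
Local Notation haarB := (@haarB R X).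
Local Notation qq := (q%:R : C).

Lemma q0 : qq != 0.
Proof. by rewrite pnatr_eq0; lia. Qed.

Definition cosetf i j k (c : X) : func R X := coset _ (sub i j) k c.

Lemma cosetf_in i j k c x : sub i j k (x - c) -> cosetf i j k c x = 1.
Proof. by rewrite /cosetf /coset => /asboolP ->. Qed.

Lemma cosetf_out i j k c x : ~ sub i j k (x - c) -> cosetf i j k c x = 0.
Proof. by rewrite /cosetf /coset; case: asboolP. Qed.

Lemma test_ind i j (P : set (func R X)) : i <= j -> is_subspace P ->
  (forall k c, lat i c -> P (cosetf i j k c)) -> test i j `<=` P.
Proof.
move=> ij sP Pc f; rewrite (testE aX) //; have [m jE] := int_diff ij.
have [I [r [_ ch]]] := sub_chain aX i m; rewrite -jE in ch.
apply: (step_fun_ind ch sP) => k l c /(sub_lat aX ij) Lc; exact: Pc.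
Qed.

Lemma test_subspace i j : i <= j -> is_subspace (test i j).
Proof.
move=> ij; rewrite (testE aX) //; have [m jE] := int_diff ij.
have [I [r [_ ch]]] := sub_chain aX i m; rewrite -jE in ch.
exact: (step_fun_subspace _ ch).
Qed.

Lemma test_cosetf i j k c : i <= j -> lat i c -> test i j (cosetf i j k c).
Proof.
move=> ij Lc; rewrite (testE aX) //; have [m jE] := int_diff ij.
have [I [r [_ ch]]] := sub_chain aX i m; rewrite -jE in ch.
have [l Sl] := sub_total aX ij Lc; exact: (coset_step _ ch _ Sl).
Qed.

Lemma test_shift i j c f : i <= j -> lat i c -> test i j f -> test i j (fun x => f (x + c)).
Proof.
move=> ij Lc; rewrite (testE aX) //; have [m jE] := int_diff ij.
have [I [r [_ ch]]] := sub_chain aX i m; rewrite -jE in ch.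
have [l Sl] := sub_total aX ij Lc; exact: (step_fun_shift ch Sl).
Qed.

Lemma cosetf_shift i j k c a : (fun x => cosetf i j k c (x + a)) = cosetf i j k (c - a).
Proof. by apply/funext => x; rewrite /cosetf /coset opprB addrA. Qed.

Lemma distr0 i j T : i <= j -> distr i j T -> T 0 = 0.
Proof.
move=> ij [lT _]; have [f0 _] := test_subspace ij.
by have := lT 1 0 0 f0 f0; rewrite scaler0 addr0 scale1r => /esym/(canRL (addrK _)); rewrite subrr.
Qed.

Lemma distr_subspace i j : i <= j -> is_subspace (distr i j).
Proof.
move=> ij; split=> [|a T S [lT T0] [lS S0]].
  by split=> // a f g _ _; rewrite !fctE scaler0 addr0.
split=> [b f g ff fg|f nf].
  by rewrite !fctE lT // lS // !scalerDr !scalerA (mulrC a) addrACA.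
by rewrite !fctE T0 // S0 // scaler0 addr0.
Qed.

Lemma distr_eq i j T S : i <= j -> distr i j T -> distr i j S ->
  (forall k c, lat i c -> T (cosetf i j k c) = S (cosetf i j k c)) -> T = S.
Proof.
move=> ij dT dS TS; apply/funext => f.
have [tf|nf] := pselect (test i j f); last by rewrite dT.2 // dS.2.
have [t0 tD] := test_subspace ij.
suff [] : [set f | test i j f /\ T f = S f] f by [].
move: f tf; apply: test_ind => //; last by move=> k c Lc; split; [exact: test_cosetf|exact: TS].
split=> [|a f g [tf Tf] [tg Tg]]; first by split; rewrite // (distr0 ij dT) (distr0 ij dS).
by split; [exact: tD|rewrite dT.1 // dS.1 // Tf Tg].
Qed.

Lemma haar_subspace i j : i <= j -> is_subspace (haar i j).
Proof.
move=> ij; have [d0 dD] := distr_subspace ij; split=> [|a T S [dT iT] [dS iS]].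
  by split.
by split=> [|c f Lc tf]; [exact: dD|rewrite !fctE iT // iS].
Qed.

(** Invariance moves the centre to 0, and a member of the filtration is the union of q^(j-i)
    translates of the next one, so each level divides the mass by q^(j-i). *)
Lemma haar_cosetf i j k c T : i <= j -> lat i c -> haar i j T ->
  T (cosetf i j k c) = qq ^ (- (k * (j - i))) * T (cosetf i j 0 0).
Proof.
move=> ij Lc [[lT T0] iT]; have [m jE] := int_diff ij.
have -> : T (cosetf i j k c) = T (cosetf i j k 0).
  by rewrite -(iT c (cosetf i j k c)) ?cosetf_shift ?subrr //; apply: test_cosetf.
have [I [r [cI ch]]] := sub_chain aX i m; rewrite -jE in ch.
have lT' a f g : step_fun (sub i j) f -> step_fun (sub i j) g ->
    T (a *: f + g) = a *: T f + T g.
  by rewrite -(testE aX) //; apply: lT.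
have TS l : T (cosetf i j l 0) = qq ^ (j - i) * T (cosetf i j (l + 1) 0).
  rewrite /cosetf (linear_coset ch lT' l (sub_0 aX i j 0)).
  rewrite (eq_bigr (fun=> T (cosetf i j (l + 1) 0))) => [|a _].
    by rewrite sumr_const cI (_ : j - i = m); [rewrite -[LHS]mulr_natl natrX|lia].
  have Lr : lat i (r l a) := sub_lat aX ij (chain_r ch l a).
  rewrite add0r -[coset _ _ _ _]/(cosetf i j (l + 1) (r l a)).
  by rewrite -(iT (r l a)) ?cosetf_shift ?subrr //; apply: test_cosetf.
have TSn l (n : nat) : T (cosetf i j l 0) = qq ^ (n%:Z * (j - i)) * T (cosetf i j (l + n%:Z) 0).
  elim: n => [|n IHn]; first by rewrite mul0r mul1r addr0.
  rewrite IHn TS mulrA -expfzDr ?q0 //; congr (_ ^ _ * T (cosetf _ _ _ _)); lia.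
case: (leP 0 k) => k0.
  have [n kE] : exists n : nat, k = n by exists `|k|%N; lia.
  have := TSn 0 n; rewrite add0r -kE => ->.
  by rewrite mulrA -expfzDr ?q0 // addNr mul1r.
have [n kE] : exists n : nat, - k = n by exists `|k|%N; lia.
by rewrite (TSn k n) -kE subrr mulNr.
Qed.

Lemma haar_exists i j : i <= j -> exists T, haar i j T /\ T (cosetf i j 0 0) = 1.
Proof.
move=> ij; have [m jE] := int_diff ij.
have [I [r [cI ch]]] := sub_chain aX i m; rewrite -jE in ch.
have Q0 : (#|I|%:R : C) != 0 by rewrite cI natrX expf_neq0 ?q0.
pose J : dist R X := fun f => if `[< test i j f >] then @chain_integral C _ (sub i j) I r f else 0.
have JE f : test i j f -> J f = @chain_integral C _ (sub i j) I r f.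
  by rewrite /J => /asboolP ->.
have tS f : test i j f -> step_fun (sub i j) f by rewrite (testE aX).
exists J; split; last first.
  rewrite JE; last by apply: test_cosetf => //; apply: (lat_0 aX).
  by rewrite (chain_integral_coset ch Q0) oppr0.
have [t0 tD] := test_subspace ij.
split; first split=> [a f g tf tg|f].
- by rewrite !JE //; [rewrite (chain_integral_linear ch Q0) //; exact: tS|exact: tD].
- by rewrite /J; case: asboolP.
move=> a f La tf; rewrite !JE //; last exact: test_shift.
have [l Sl] := sub_total aX ij La.
by apply: (chain_integral_shift ch Q0 Sl); apply: tS.
Qed.

Lemma haar_eq i j T S : i <= j -> haar i j T -> haar i j S ->
  T (cosetf i j 0 0) = S (cosetf i j 0 0) -> T = S.
Proof.
move=> ij hT hS TS; apply: (distr_eq ij hT.1 hS.1) => k c Lc.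
by rewrite (haar_cosetf k ij Lc hT) (haar_cosetf k ij Lc hS) TS.
Qed.

Lemma indicE i j : (\1_[set x + y | x in B `&` lat i & y in lat j] : func R X) = cosetf i j 0 0.
Proof.
apply/funext => x; rewrite indicE /cosetf /coset subr0; congr ((_ : bool)%:R).
apply/idP/asboolP => [/set_mem [y [By Ly] [z Lz <-]]|[y [ [b Bb <-] Ly] [z Lz <-]]].
  by exists y; [split=> //; exists y; rewrite ?mul1r|exists z].
apply/mem_set; exists (u ^ 0 * b); last by exists z.
by split => //; rewrite mul1r.
Qed.

Lemma haarBP i j T : i <= j -> haar i j T -> T (cosetf i j 0 0) = 1 -> T = haarB i j.
Proof.
move=> ij hT T1; rewrite /haarB indicE; apply/esym/xget_unique; first by split.
by move=> S [hS S1]; apply: (haar_eq ij) => //; rewrite T1 S1.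
Qed.

Lemma haarB_haar i j : i <= j -> haar i j (haarB i j).
Proof. by move=> ij; have [T [hT T1]] := haar_exists ij; rewrite -(haarBP ij hT T1). Qed.

Lemma haarB1 i j : i <= j -> haarB i j (cosetf i j 0 0) = 1.
Proof. by move=> ij; have [T [hT T1]] := haar_exists ij; rewrite -(haarBP ij hT T1). Qed.

Lemma haarB_cosetf i j k c : i <= j -> lat i c ->
  haarB i j (cosetf i j k c) = qq ^ (- (k * (j - i))).
Proof.
by move=> ij Lc; rewrite (haar_cosetf k ij Lc (haarB_haar ij)) haarB1 // mulr1.
Qed.

Lemma haarE i j T : i <= j -> haar i j T -> T = (T (cosetf i j 0 0) : C) *: haarB i j.
Proof.
move=> ij hT; apply: (haar_eq ij hT).
  by rewrite -[_ *: _]addr0; apply: (haar_subspace ij).2;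
    [exact: haarB_haar|exact: (haar_subspace ij).1].
by rewrite fctE haarB1 // -[LHS]mulr1.
Qed.

Lemma haarZ i j (a : C) T : i <= j -> haar i j T -> haar i j (a *: T).
Proof.
move=> ij hT; rewrite -[_ *: _]addr0; apply: (haar_subspace ij).2 => //.
exact: (haar_subspace ij).1.
Qed.

End Haar.

(** * Direct and inverse images of distributions *)

Section Transfer.
Variables (R : realType) (X : two_dim_data) (q : nat).
Hypothesis aX : two_dim_axioms X q.
Hypothesis q_gt1 : (1 < q)%N.
Implicit Types (i j k l : int) (x y z : X) (f g : func R X) (T S m : dist R X).

Local Notation t := (tdt X).
Local Notation u := (tdu X).
Local Notation O := (@tdO X).
Local Notation C := R[i].
Local Notation test := (@test R X).
Local Notation distr := (@distr R X).
Local Notation haar := (@haar R X).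
Local Notation haarB := (@haarB R X).
Local Notation qq := (q%:R : C).

Definition restr j f : func R X := fun x => if `[< lat j x >] then f x else 0.

(* Integration along the fibres of [O(i)/O(k) -> O(i)/O(j)]. *)
Definition fib j m f : func R X := fun x => m (restr j (fun y => f (x + y))).

Lemma testP i j f : i <= j -> test i j f <-> exists k l,
  (forall x, f x != 0 -> sub i j k x) /\ (forall x y, sub i j l y -> f (x + y) = f x).
Proof. by move=> ij; rewrite (testE aX). Qed.

Lemma lat_asbool j x y : lat j y -> `[< lat j (x + y) >] = `[< lat j x >].
Proof. by move=> Ly; apply: asbool_equiv_eq; apply: (lat_Dr aX). Qed.

Lemma restr_in j f x : lat j x -> restr j f x = f x.
Proof. by rewrite /restr => /asboolP ->. Qed.
Lemma restr_out j f x : ~ lat j x -> restr j f x = 0.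
Proof. by rewrite /restr; case: asboolP. Qed.
Lemma restr_linear j (a : C) f g : restr j (a *: f + g) = a *: restr j f + restr j g.
Proof.
apply/funext => x; rewrite !fctE /restr; case: asboolP => // _.
by rewrite scaler0 addr0.
Qed.

Lemma test_restr s s' r f : s' <= s -> s <= r -> test s' r f -> test s r (restr s f).
Proof.
move=> ss sr /(testP _ (le_trans ss sr)) [k [l [sf pf]]]; apply/(testP _ sr).
exists k, l; split=> [x|x y Sy].
  rewrite /restr; case: asboolP => [Lx /sf|_]; last by rewrite eqxx.
  exact: (sub_capl aX).
have Ly := sub_lat aX sr Sy.
rewrite /restr (pf _ y) //; last exact: (sub_lel aX ss).
by rewrite lat_asbool.
Qed.

Lemma fib_restr_test i j k f x : i <= j -> j <= k -> test i k f ->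
  test j k (restr j (fun y => f (x + y))).
Proof.
move=> ij jk tf; have ik := le_trans ij jk.
have [Lx|nLx] := pselect (lat i x).
  apply: (test_restr ij jk); rewrite (_ : (fun y => _) = fun y => f (y + x)).
    exact: (test_shift aX).
  by apply/funext => y; rewrite addrC.
rewrite (_ : restr _ _ = 0); first exact: (test_subspace R aX jk).1.
apply/funext => y; rewrite /restr; case: asboolP => // Ly; case: tf => f0 _ _ _.
by rewrite f0 // (lat_Dr aX) //; apply: (lat_le aX ij).
Qed.

Lemma fib_linear i j k m (a : C) f g : i <= j -> j <= k -> haar j k m ->
  test i k f -> test i k g -> fib j m (a *: f + g) = a *: fib j m f + fib j m g.
Proof.
move=> ij jk [ [lm _] _] tf tg; apply/funext => x.
rewrite !fctE /fib -lm; [|exact: (fib_restr_test x ij jk)..].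
by rewrite -restr_linear.
Qed.

(** A period of the integrated function splits as [n + z] with [n] a period of [f] and [z] in O(j);
    the invariance of the Haar measure [m] removes [z]. *)
Lemma fib_test i j k m f : i <= j -> j <= k -> haar j k m -> test i k f ->
  test i j (fib j m f).
Proof.
move=> ij jk hm tf; have ik := le_trans ij jk; have m0 := distr0 aX jk hm.1.
have /(testP _ ik) [k' [l [sf pf]]] := tf.
apply/(testP _ ij); exists k', l; split=> [x fx|x y /(sub_addr aX _ _ _ jk) [n [z [Sn Lz ->]]]].
  have [y [Ly fy]] : exists y, lat j y /\ f (x + y) != 0.
    apply: contrapT => /forallNP nf; move/eqP: fx; apply.
    rewrite -m0; congr (m _); apply/funext => y; rewrite /restr; case: asboolP => // Ly.
    by apply: contrapT => fy; apply: (nf y); split=> //; apply/eqP.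
  rewrite -(addrK y x); apply: (sub_B aX); last exact: (lat_sub aX).
  exact/(sub_ler aX jk)/sf.
rewrite /fib; have tx := fib_restr_test x ij jk tf.
rewrite -[RHS](hm.2 z _ Lz tx); congr (m _); apply/funext => w; rewrite /restr.
rewrite lat_asbool //.
by case: asboolP => // _; rewrite -(pf (x + (w + z)) _ Sn); congr (f _); ring.
Qed.

Lemma pullE i j k T m f : test i k f -> pull i j k T m f = T (fib j m f).
Proof. by move=> /asboolP; rewrite /pull => ->. Qed.

Lemma pull_out i j k T m f : ~ test i k f -> pull i j k T m f = 0.
Proof. by rewrite /pull; case: asboolP. Qed.

Lemma pull_distr i j k T m : i <= j -> j <= k -> distr i j T -> haar j k m ->
  distr i k (pull i j k T m).
Proof.
move=> ij jk dT hm; have [t0 tD] := test_subspace R aX (le_trans ij jk).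
split=> [a f g tf tg|f /pull_out //].
rewrite !pullE //; last exact: tD.
by rewrite (fib_linear _ ij jk) // dT.1 //; apply: (fib_test ij jk).
Qed.

Lemma pull_linearl i j k (a : C) T S m :
  pull i j k (a *: T + S) m = a *: pull i j k T m + pull i j k S m.
Proof.
apply/funext => f; rewrite !fctE /pull; case: asboolP => _ //.
by rewrite scaler0 addr0.
Qed.

Lemma pull_linearr i j k (a : C) T m n : i <= j -> j <= k -> distr i j T ->
  haar j k m -> haar j k n ->
  pull i j k T (a *: m + n) = a *: pull i j k T m + pull i j k T n.
Proof.
move=> ij jk dT hm hn; apply/funext => f; rewrite !fctE.
have [tf|tf] := pselect (test i k f); last by rewrite !pull_out // scaler0 addr0.
rewrite !pullE // -dT.1; [|exact: (fib_test ij jk)..].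
by congr (T _).
Qed.

Lemma pull_haar i j k T m : i <= j -> j <= k -> haar i j T -> haar j k m ->
  haar i k (pull i j k T m).
Proof.
move=> ij jk hT hm; split; first exact: pull_distr hT.1 hm.
move=> a f La tf; rewrite !pullE //; last exact: (test_shift aX (le_trans ij jk)).
rewrite -(hT.2 a (fib j m f) La); last exact: (fib_test ij jk).
by congr (T _); apply/funext => x; congr (m _); apply/funext => y; rewrite /restr addrAC.
Qed.

(** Each fibre over the image of the coset meets it in a coset of level [l] in O(j)/O(k), whose mass
    is the stated power of q; the other fibres miss it. *)
Lemma fib_cosetf i j k l c : i <= j -> j <= k ->
  fib j (haarB j k) (cosetf R i k l c) = (qq ^ (- (l * (k - j)))) *: cosetf R i j l c.
Proof.
move=> ij jk; apply/funext => x; rewrite fctE /fib.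
have [Sx|nSx] := pselect (sub i j l (x - c)); last first.
  rewrite cosetf_out // scaler0 -(distr0 aX jk (haarB_haar R aX q_gt1 jk).1).
  congr (haarB _ _ _); apply/funext => y; rewrite /restr; case: asboolP => // Ly.
  rewrite cosetf_out // => Sxy; apply: nSx.
  rewrite (_ : x - c = x + y - c - y); last by ring.
  by apply: (sub_B aX); [exact: (sub_ler aX jk)|exact: (lat_sub aX)].
have [n [z [Sn Lz xcE]]] := (sub_addr aX _ _ _ jk).1 Sx.
rewrite cosetf_in // -[RHS]/(_ * 1) mulr1 -(@haarB_cosetf R _ _ aX q_gt1 j k l (- z)) //;
  last exact: (lat_N aX).
congr (haarB _ _ _); apply/funext => y; rewrite /restr /cosetf /coset opprK.
have -> : x + y - c = n + (y + z) by rewrite addrAC xcE; ring.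
case: asboolP => Ly; last first.
  case: asboolP => // Syz; case: Ly.
  by have := sub_lat aX jk Syz; rewrite (lat_Dr aX).
congr ((_ : bool)%:R); apply/asboolP/asboolP => Sy.
  apply: (sub_capl aX jk (i := i)); first exact: (lat_D aX).
  by rewrite -(addKr n (y + z)); apply: (sub_D aX) Sy; apply: (sub_N aX).
by apply: (sub_D aX) Sn _; apply: (sub_lel aX ij).
Qed.

Lemma pull_cosetf i j k l c T : i <= j -> j <= k -> lat i c -> distr i j T ->
  pull i j k T (haarB j k) (cosetf R i k l c) = qq ^ (- (l * (k - j))) * T (cosetf R i j l c).
Proof.
move=> ij jk Lc dT; have ik := le_trans ij jk.
have [t0 _] := test_subspace R aX ij.
rewrite pullE ?fib_cosetf //; last exact: (test_cosetf _ aX).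
rewrite -[_ *: _]addr0 dT.1 // ?(distr0 aX ij dT) ?addr0 //; exact: (test_cosetf _ aX).
Qed.

(** The volume factor of [pull_cosetf] is 1 at level 0, where the measures are normalised. It is
    because of this that the elements [muB] multiply without constants. *)
Lemma pull_haarB i j k : i <= j -> j <= k -> pull i j k (haarB i j) (haarB j k) = haarB i k.
Proof.
move=> ij jk; apply: (haarBP aX q_gt1 (le_trans ij jk)).
  by apply: pull_haar => //; apply: (haarB_haar _ aX).
rewrite pull_cosetf //; last exact: (haarB_haar R aX q_gt1 ij).1.
  by rewrite mul0r oppr0 mul1r (haarB1 _ aX).
exact: (lat_0 aX).
Qed.

(** Fubini: integration along O(k)/O(l) and then along O(j)/O(k) is integration along O(j)/O(l) for
    the product measure. *)
Lemma fib_fib i j k l m n f : i <= j -> j <= k -> k <= l -> haar k l n ->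
  test i l f -> fib j m (fib k n f) = fib j (pull j k l m n) f.
Proof.
move=> ij jk kl hn tf; have jl := le_trans jk kl.
apply/funext => x; rewrite {1 3}/fib.
rewrite pullE; last exact: (fib_restr_test x ij jl).
congr (m _); apply/funext => y; rewrite {1}/restr; case: asboolP => Ly.
  congr (n _); apply/funext => z; rewrite /restr; case: (asboolP (lat k z)) => // Lz.
  case: asboolP => [_|[]]; first by rewrite addrA.
  by apply: (lat_D aX) Ly _; apply: (lat_le aX) Lz.
rewrite /fib -(distr0 aX kl hn.1); congr (n _); apply/funext => z; rewrite /restr.
case: (asboolP (lat k z)) => // Lz; case: asboolP => // Lyz; case: Ly.
by move/(lat_Dr aX): Lyz; apply; apply: (lat_le aX) Lz.
Qed.

Lemma fib_restr i j k m f : i <= j -> j <= k -> haar j k m ->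
  fib j m (restr i f) = restr i (fib j m f).
Proof.
move=> ij jk hm; apply/funext => x; rewrite {2}/restr; case: asboolP => Lx.
  congr (m _); apply/funext => y; rewrite {1 3}/restr; case: (asboolP (lat j y)) => // Ly.
  by rewrite restr_in //; apply: (lat_D aX) Lx _; apply: (lat_le aX) Ly.
rewrite -(distr0 aX jk hm.1); congr (m _); apply/funext => y.
rewrite {1}/restr; case: (asboolP (lat j y)) => // Ly.
by rewrite restr_out // => /(lat_Dr aX) Lxy; apply: Lx; apply: Lxy; apply: (lat_le aX) Ly.
Qed.

Lemma restr_restr i j f : i <= j -> restr j (restr i f) = restr j f.
Proof.
move=> ij; apply/funext => x; rewrite {1 3}/restr; case: asboolP => // Lx.
by rewrite restr_in //; apply: (lat_le aX) Lx.
Qed.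

Lemma pushE s s' r T f : test s' r f -> push s s' r T f = T (restr s f).
Proof. by move=> /asboolP; rewrite /push => ->. Qed.

Lemma push_out s s' r T f : ~ test s' r f -> push s s' r T f = 0.
Proof. by rewrite /push; case: asboolP. Qed.

(** Covers two kinds of multipliers at once: the monomials [u ^ c * t ^ a], and the units of O', for
    which [a = c = 0]. *)
Definition shifts (h : X) i j a c :=
  h != 0 /\ forall k x, sub (i + a) (j + a) (k + c) (h * x) <-> sub i j k x.

Lemma shifts_ut i j a c : shifts (u ^ c * t ^ a) i j a c.
Proof.
split=> [|k x]; last exact: (sub_shift aX).
by rewrite mulf_neq0 ?(te0 aX) ?(ue0 aX).
Qed.

Lemma test_mul h i j a c f : i <= j -> shifts h i j a c ->
  test (i + a) (j + a) f <-> test i j (fun x => f (h * x)).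
Proof.
move=> ij [h0 sh]; have ij' : i + a <= j + a by lia.
split=> [/(testP _ ij') [k [l [sf pf]]]|/(testP _ ij) [k [l [sf pf]]]].
  apply/(testP _ ij); exists (k - c), (l - c); split=> [x /sf|x y].
    by rewrite -sh subrK.
  by rewrite -sh subrK mulrDr => /pf.
apply/(testP _ ij'); exists (k + c), (l + c); split=> [x|x y].
  by rewrite -(mulVKf h0 x) => /sf; rewrite sh.
by rewrite -(mulVKf h0 x) -(mulVKf h0 y) sh -mulrDr => /pf.
Qed.

Lemma dist_act_distr h i j a c T : i <= j -> shifts h i j a c ->
  distr i j T -> distr (i + a) (j + a) (dist_act h T).
Proof.
move=> ij sh dT; split=> [b f g|f] tf => [tg|].
  by rewrite /dist_act -dT.1 //; apply/(test_mul _ ij sh).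
by rewrite /dist_act dT.2 // => /(test_mul _ ij sh).
Qed.

Lemma dist_act_linear h (a : C) T S :
  dist_act h (a *: T + S) = a *: dist_act h T + dist_act h S.
Proof. by []. Qed.

Lemma shifts_lat h i j a c x : i <= j -> shifts h i j a c -> lat (i + a) (h * x) <-> lat i x.
Proof.
move=> ij [h0 sh]; have ij' : i + a <= j + a by lia.
split=> [/(sub_total aX ij') [k Sk]|/(sub_total aX ij) [k /sh Sk]].
  by apply: (sub_lat aX ij (k := k - c)); rewrite -sh subrK.
exact: (sub_lat aX ij' Sk).
Qed.

Lemma dist_act_haar h i j a c T : i <= j -> shifts h i j a c ->
  haar i j T -> haar (i + a) (j + a) (dist_act h T).
Proof.
move=> ij sh [dT iT]; split=> [|b f Lb tf]; first exact: dist_act_distr sh dT.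
have h0 := sh.1.
have Lb' : lat i (h^-1 * b) by rewrite -(shifts_lat _ ij sh) mulVKf.
rewrite /dist_act -(iT _ (fun x => f (h * x)) Lb'); last exact/(test_mul _ ij sh).
by congr (T _); apply/funext => x; rewrite mulrDr mulVKf.
Qed.

Lemma dist_act_cosetf h i j a c k b T : i <= j -> shifts h i j a c ->
  dist_act h T (cosetf R (i + a) (j + a) k b) = T (cosetf R i j (k - c) (h^-1 * b)).
Proof.
move=> ij [h0 sh]; congr (T _); apply/funext => x; congr ((_ : bool)%:R).
by apply/asboolP/asboolP; rewrite -sh subrK mulrBr mulVKf.
Qed.

(** The transported measure gives the subgroup of level [c] in the target the mass 1 of the source
    subgroup of level 0; for the normalised measure of the target that mass is q^(-c(j-i)). The
    shift [a] does not enter the factor. *)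
Lemma dist_act_haarB h i j a c : i <= j -> shifts h i j a c ->
  dist_act h (haarB i j) = qq ^ (c * (j - i)) *: haarB (i + a) (j + a).
Proof.
move=> ij sh; have ij' : i + a <= j + a by lia.
have hB := haarB_haar R aX q_gt1 ij.
rewrite [LHS](haarE aX q_gt1 ij' (dist_act_haar ij sh hB)); congr (_ *: _).
rewrite (dist_act_cosetf _ _ _ ij sh) mulr0 (haarB_cosetf _ aX) //; last exact: (lat_0 aX).
by congr (_ ^ _); ring.
Qed.

Lemma dist_act_mul (h h' : X) T : dist_act (h * h') T = dist_act h (dist_act h' T).
Proof.
by apply/funext => f; rewrite /dist_act; congr (T _); apply/funext => x; rewrite mulrA.
Qed.

Lemma dist_act_1 T : dist_act 1 T = T.
Proof. by apply/funext => f; rewrite /dist_act; congr (T _); apply/funext => x; rewrite mul1r. Qed.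

Lemma dist_act_pull c a i j k T m : i <= j -> j <= k ->
  dist_act (u ^ c * t ^ a) (pull i j k T m) =
  pull (i + a) (j + a) (k + a) (dist_act (u ^ c * t ^ a) T) (dist_act (u ^ c * t ^ a) m).
Proof.
move=> ij jk; have ik := le_trans ij jk; apply/funext => f; rewrite {1}/dist_act.
have sh := shifts_ut i k a c.
have [tf|tf] := pselect (test (i + a) (k + a) f); last first.
  by rewrite !pull_out // -(test_mul _ ik sh).
rewrite !pullE // -?(test_mul _ ik sh) //.
congr (T _); apply/funext => x; congr (m _); apply/funext => y; rewrite /restr mulrDr.
congr (if _ then _ else _).
by apply/asboolP/asboolP; rewrite (shifts_lat _ jk (shifts_ut j k a c)).
Qed.

Lemma dist_act_push c a s s' r T : s' <= s -> s <= r ->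
  dist_act (u ^ c * t ^ a) (push s s' r T) =
  push (s + a) (s' + a) (r + a) (dist_act (u ^ c * t ^ a) T).
Proof.
move=> ss sr; have s'r := le_trans ss sr; apply/funext => f; rewrite {1}/dist_act.
have sh := shifts_ut s' r a c.
have [tf|tf] := pselect (test (s' + a) (r + a) f); last first.
  by rewrite !push_out // -(test_mul _ s'r sh).
rewrite !pushE // -?(test_mul _ s'r sh) //.
congr (T _); apply/funext => x; rewrite /restr; congr (if _ then _ else _).
by apply/asboolP/asboolP; rewrite (shifts_lat _ sr (shifts_ut s r a c)).
Qed.

End Transfer.

(** * The lines of Haar measures *)

Section Lines.
Variables (R : realType) (X : two_dim_data) (q : nat).
Hypothesis aX : two_dim_axioms X q.
Hypothesis q_gt1 : (1 < q)%N.
Implicit Types (i j k r s w : int) (T S m : dist R X) (n : line R X).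

Local Notation t := (tdt X).
Local Notation u := (tdu X).
Local Notation C := R[i].
Local Notation haar := (@haar R X).
Local Notation haarB := (@haarB R X).
Local Notation muB := (@muB R X).
Local Notation mu := (@mu R X).
Local Notation qq := (q%:R : C).

Let hB i j (ij : i <= j) : haar i j (haarB i j) := haarB_haar R aX q_gt1 ij.
Let hZ i j a (ij : i <= j) : haar i j (a *: haarB i j) := haarZ a ij (hB ij).

Lemma haar_scale i j T : i <= j -> haar i j T -> exists a : C, T = a *: haarB i j.
Proof. by move=> ij /(haarE aX q_gt1 ij) ->; exists (T (cosetf R i j 0 0)). Qed.

Lemma haarB_scale_inj i j (a b : C) : i <= j ->
  a *: haarB i j = b *: haarB i j -> a = b.
Proof.
move=> ij /(congr1 (fun T : dist R X => T (cosetf R i j 0 0))).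
by rewrite !fctE (haarB1 R aX q_gt1 ij) -[LHS]/(a * 1) -[RHS]/(b * 1) !mulr1.
Qed.

Lemma pull_scale i j k (a b : C) : i <= j -> j <= k ->
  pull i j k (a *: haarB i j) (b *: haarB j k) = (a * b) *: haarB i k.
Proof.
move=> ij jk.
have -> : b *: haarB j k = (b - 1) *: haarB j k + haarB j k.
  by rewrite scalerBl scale1r subrK.
rewrite (pull_linearr aX _ ij jk (hZ a ij).1 (hB jk) (hB jk)).
have -> : pull i j k (a *: haarB i j) (haarB j k) = a *: haarB i k.
  rewrite -(pull_haarB R aX q_gt1 ij jk) -[a *: haarB i j]addr0 pull_linearl.
  rewrite [X in _ + X](_ : _ = 0) ?addr0 //.
  by apply/funext => f; rewrite /pull; case: asboolP.
by rewrite scalerA -scalerDl mulrBl mul1r subrK mulrC.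
Qed.

Lemma dual_scale r s l (a : C) T : r <= s -> dual (haar r s) l -> haar r s T ->
  l (a *: T) = a *: l T.
Proof.
move=> rs [ll _] hT; have -> : a *: T = (a - 1) *: T + T.
  by rewrite scalerBl scale1r subrK.
by rewrite ll // scalerBl scale1r subrK.
Qed.

Lemma dual_eq r s l l' : r <= s -> dual (haar r s) l -> dual (haar r s) l' ->
  l (haarB r s) = l' (haarB r s) -> l = l'.
Proof.
move=> rs dl dl' ell; apply/funext => T.
have [hT|nT] := pselect (haar r s T); last by rewrite dl.2 ?dl'.2.
by have [a ->] := haar_scale rs hT; rewrite !(dual_scale _ rs) ?ell //; apply: hB.
Qed.

Lemma dual_subspace r s : is_subspace (dual (haar r s)).
Proof.
split=> [|a l l' [ll l0] [ll' l0']].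
  by split=> // a x y _ _; rewrite !fctE scaler0 addr0.
split=> [b f g ff fg|f nf].
  by rewrite !fctE ll // ll' // !scalerDr !scalerA (mulrC a) addrACA.
by rewrite !fctE l0 // l0' // scaler0 addr0.
Qed.

Lemma dual_extP r s l :
  (forall a x y, haar r s x -> haar r s y -> l (a *: x + y) = a *: l x + l y) ->
  r <= s -> dual (haar r s) (dual_ext r s l).
Proof.
move=> ll rs; have [_ hD] := haar_subspace R X rs.
split=> [a x y hx hy|x nx]; rewrite /dual_ext; last by case: asboolP.
by do 3![case: asboolP => [_|[]]; last by [|exact: hD]]; apply: ll.
Qed.

Lemma dual_ext_haarB r s l : r <= s -> dual_ext r s l (haarB r s) = l (haarB r s).
Proof. by move=> rs; rewrite /dual_ext; case: asboolP => // -[]; apply: hB. Qed.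

Lemma muB_le r s : s <= r -> muB r s = (haarB s r, 0).
Proof. by rewrite /Defs.muB => ->. Qed.

Lemma muB_lt r s : r < s -> exists l,
  [/\ muB r s = (0, l), dual (haar r s) l & l (haarB r s) = 1].
Proof.
move=> rs; have rs' := ltW rs.
pose l0 : dist R X -> C^o := dual_ext r s (fun T => T (cosetf R r s 0 0)).
have dl0 : dual (haar r s) l0 by apply: dual_extP.
have l01 : l0 (haarB r s) = 1 by rewrite /l0 dual_ext_haarB // (haarB1 _ aX).
exists l0; split=> //; rewrite /Defs.muB leNgt rs /=; congr (_, _).
apply: xget_unique; first by split.
by move=> l [dl l1]; apply: (dual_eq rs') => //; rewrite l01.
Qed.

(** The coordinate of [n] in the basis [muB r s] of its line ([muE]). It reduces computations with
    measures and their duals to scalars, whatever the order of [r] and [s]. *)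
Definition mucoef r s n : C :=
  if s <= r then n.1 (cosetf R s r 0 0) else n.2 (haarB r s).

Lemma mucoef_linear r s (a : C) n n' : mucoef r s (a *: n + n') = a * mucoef r s n + mucoef r s n'.
Proof. by rewrite /mucoef; case: ifP. Qed.

Lemma mu_subspace r s : is_subspace (mu r s).
Proof.
rewrite /Defs.mu; case: (leP s r) => sr.
  have [h0 hD] := haar_subspace R X sr; split=> [//|a n n' [hn n2] [hn' n2']].
  by split; [exact: hD|rewrite /= n2 n2' scaler0 addr0].
have [h0 hD] := dual_subspace r s; split=> [//|a n n' [n1 hn] [n1' hn']].
by split; [rewrite /= n1 n1' scaler0 addr0|exact: hD].
Qed.

Lemma muB_mu r s : mu r s (muB r s).
Proof.
rewrite /Defs.mu /=; have [sr|rs] := leP s r.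
  by rewrite /Defs.muB sr; split=> //; apply: hB.
by have [l [-> dl _]] := muB_lt rs.
Qed.

Lemma mucoef_muB r s : mucoef r s (muB r s) = 1.
Proof.
rewrite /mucoef; have [sr|rs] := leP s r.
  by rewrite /Defs.muB sr /= (haarB1 _ aX).
by have [l [-> _ l1]] := muB_lt rs.
Qed.

Lemma muZ r s a n : mu r s n -> mu r s (a *: n).
Proof.
move=> mn; rewrite -[_ *: _]addr0; apply: (mu_subspace r s).2 => //.
exact: (mu_subspace r s).1.
Qed.

Lemma mucoefZ r s (a : C) n : mucoef r s (a *: n) = a * mucoef r s n.
Proof. by rewrite /mucoef; case: ifP. Qed.

Lemma mucoef_inj r s n n' : mu r s n -> mu r s n' -> mucoef r s n = mucoef r s n' -> n = n'.
Proof.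
rewrite /Defs.mu /mucoef /=; case: n n' => [T l] [T' l'] /=; case: leP => sr.
  by move=> [hT ->] [hT' ->] /(haar_eq aX q_gt1 sr hT hT') ->.
by move=> [-> dl] [-> dl'] /(dual_eq (ltW sr) dl dl') ->.
Qed.

Lemma muE r s n : mu r s n -> n = mucoef r s n *: muB r s.
Proof.
move=> mn; apply: (mucoef_inj mn); first exact/muZ/muB_mu.
by rewrite mucoefZ mucoef_muB mulr1.
Qed.

(** Checked in each of the six orderings in the definition of [tens]. Where [xget] ranges over
    factorisations of a Haar measure, these differ only in how a scalar is distributed over the
    factors; [pull_scale] fixes the product of the scalars, so the value picked is unique. *)
Lemma tens_muB r s w (a b : C) :
  tens r s w (a *: muB r s) (b *: muB s w) = (a * b) *: muB r w.
Proof.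
rewrite /tens; case: (leP s r) => sr; case: (leP w s) => ws.
- have wr := le_trans ws sr.
  rewrite /Defs.muB sr ws wr /= pull_scale // mulrC.
  by congr (_, _); rewrite scaler0.
- have [l [-> [ll l0] l1]] := muB_lt ws; have sw := ltW ws.
  have bl c : (b *: l) (c *: haarB s w) = b * c.
    by rewrite fctE (dual_scale _ sw) // ?l1 -?[c *: 1]/(c * 1) ?mulr1 //; apply: hB.
  rewrite (muB_le sr) /=; case: (leP w r) => wr.
    rewrite /Defs.muB wr /=; congr (_, _); last by rewrite scaler0.
    apply: xget_unique.
      exists (1 *: haarB s w), (a *: haarB w r); split; try exact: hZ.
        by rewrite pull_scale // mul1r.
      by rewrite bl mulr1 scalerA mulrC.
    move=> T [c [d [/(haar_scale sw) [c' ->] /(haar_scale wr) [d' ->]]]].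
    rewrite pull_scale // => /(haarB_scale_inj sr) -> ->.
    by rewrite bl scalerA; congr (_ *: _); ring.
  have rw := ltW wr; have [l' [-> dl' l1']] := muB_lt wr.
  congr (_, _); first by rewrite scaler0.
  apply: (dual_eq rw); last first.
  + rewrite dual_ext_haarB // -[haarB r w]scale1r pull_scale // bl scale1r fctE /= l1'.
    by rewrite -[RHS]/(_ * 1); ring.
  + rewrite -[_ *: _]addr0; apply: (dual_subspace r w).2 => //.
    exact: (dual_subspace r w).1.
  apply: dual_extP => // c x y hx hy.
  rewrite (pull_linearr aX _ sr rw (hZ a sr).1 hx hy) !fctE ll.
  + by rewrite !scalerDr !scalerA (mulrC b).
  + by apply: (pull_haar aX) => //; apply: hZ.
  + by apply: (pull_haar aX) => //; apply: hZ.
- have [l [-> [ll l0] l1]] := muB_lt sr; have rs := ltW sr.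
  have bl c : (a *: l) (c *: haarB r s) = a * c.
    by rewrite fctE (dual_scale _ rs) // ?l1 -?[c *: 1]/(c * 1) ?mulr1 //; apply: hB.
  rewrite (muB_le ws) /=; case: (leP w r) => wr.
    rewrite /Defs.muB wr /=; congr (_, _); last by rewrite scaler0.
    apply: xget_unique.
      exists (b *: haarB w r), (1 *: haarB r s); split; try exact: hZ.
        by rewrite pull_scale // mulr1.
      by rewrite bl mulr1 scalerA.
    move=> T [c [d [/(haar_scale wr) [c' ->] /(haar_scale rs) [d' ->]]]].
    rewrite pull_scale // => /(haarB_scale_inj ws) -> ->.
    by rewrite bl scalerA; congr (_ *: _); ring.
  have rw := ltW wr; have [l' [-> dl' l1']] := muB_lt wr.
  congr (_, _); first by rewrite scaler0.
  apply: (dual_eq rw); last first.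
  + rewrite dual_ext_haarB // -[haarB r w]scale1r pull_scale // bl scale1r fctE /= l1'.
    by rewrite -[RHS]/(_ * 1); ring.
  + rewrite -[_ *: _]addr0; apply: (dual_subspace r w).2 => //.
    exact: (dual_subspace r w).1.
  apply: dual_extP => // c x y hx hy.
  rewrite pull_linearl !fctE ll.
  + by rewrite !scalerDr !scalerA (mulrC a).
  + by apply: (pull_haar aX) => //; apply: hZ.
  + by apply: (pull_haar aX) => //; apply: hZ.
- have rs := ltW sr; have sw := ltW ws; have rw := lt_trans sr ws; have rw' := ltW rw.
  have [l [-> [ll l0] l1]] := muB_lt sr.
  have [l' [-> [ll' l0'] l1']] := muB_lt ws.
  have al c : (a *: l) (c *: haarB r s) = a * c.
    by rewrite fctE (dual_scale _ rs) // ?l1 -?[c *: 1]/(c * 1) ?mulr1 //; apply: hB.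
  have bl c : (b *: l') (c *: haarB s w) = b * c.
    by rewrite fctE (dual_scale _ sw) // ?l1' -?[c *: 1]/(c * 1) ?mulr1 //; apply: hB.
  have [l'' [-> dl'' l1'']] := muB_lt rw.
  congr (_, _); first by rewrite scaler0.
  set F := fun T : dist R X => xget _ _.
  have FE c : F (c *: haarB r w) = c * (a * b).
    apply: xget_unique.
      exists (c *: haarB r s), (1 *: haarB s w); split; try exact: hZ.
        by rewrite pull_scale // mulr1.
      by rewrite /= al bl; ring.
    move=> z [c' [d' [/(haar_scale rs) [c1 ->] /(haar_scale sw) [d1 ->]]]].
    by rewrite pull_scale // => /(haarB_scale_inj rw') -> ->; rewrite /= al bl; ring.
  apply: (dual_eq rw'); last first.
  + rewrite dual_ext_haarB // -[haarB r w]scale1r FE scale1r fctE /= l1''.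
    by rewrite -[RHS]/(_ * 1); ring.
  + rewrite -[_ *: _]addr0; apply: (dual_subspace r w).2 => //.
    exact: (dual_subspace r w).1.
  apply: dual_extP => // c x y /(haar_scale rw') [x' ->] /(haar_scale rw') [y' ->].
  by rewrite scalerA -scalerDl !FE -[c *: _]/(c * (x' * (a * b))); ring.
Qed.

Lemma tensE r s w n1 n2 : mu r s n1 -> mu s w n2 ->
  tens r s w n1 n2 = (mucoef r s n1 * mucoef s w n2) *: muB r w.
Proof. by move=> /muE {1}-> /muE {1}->; rewrite tens_muB. Qed.

Lemma ut_inv c b : (u ^ c * t ^ b)^-1 = u ^ (- c) * t ^ (- b).
Proof. by rewrite invfM !invr_expz. Qed.

(** For [r < s] the line is a dual, so the inverse factor of the Haar measure appears; this changes
    [s - r] into [r - s], and one formula serves both orders. *)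
Lemma line_act_muB c b r s :
  line_act (u ^ c * t ^ b) (muB r s) = qq ^ (c * (r - s)) *: muB (r + b) (s + b).
Proof.
rewrite /line_act; case: (leP s r) => sr.
  rewrite /Defs.muB sr lerD2r sr /=; congr (_, _); last by rewrite scaler0.
  by apply: (dist_act_haarB _ aX) => //; apply: (shifts_ut aX).
have rs := ltW sr; have sr' : r + b < s + b by rewrite ltrD2r.
have rs' := ltW sr'.
have [l [-> [ll l0] l1]] := muB_lt sr; have [l' [-> dl' l1']] := muB_lt sr'.
congr (_, _); first by rewrite /= scaler0.
have sh := shifts_ut aX (r + b) (s + b) (- b) (- c).
have sh1 := shifts_ut aX r s b c.
have hact T : haar (r + b) (s + b) T -> haar r s (dist_act (u ^ c * t ^ b)^-1 T).
  by move=> /(dist_act_haar aX q_gt1 rs' sh); rewrite !addrK ut_inv.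
apply: (dual_eq rs').
- split=> [a x y hx hy|x nx]; first by rewrite -ll //; apply: hact.
  apply: l0 => /= /(dist_act_haar aX q_gt1 rs sh1); rewrite -dist_act_mul mulfV ?dist_act_1 //.
  exact: sh1.1.
- rewrite -[_ *: _]addr0; apply: (dual_subspace _ _).2 => //.
  exact: (dual_subspace _ _).1.
rewrite /= ut_inv (dist_act_haarB R aX q_gt1 rs' sh) !addrK -[RHS]/(_ *: l' _) l1'.
rewrite (dual_scale _ rs) // ?l1; [|exact: hB].
by congr (_ ^ _ *: _); ring.
Qed.

End Lines.

(** * The colimit *)

Section Span.
Variables (F : fieldType) (V : lmodType F).
Implicit Types (S : set V) (x y : V).

Lemma lspan_incl S x : S x -> lspan S x.
Proof. by move=> Sx U _; apply. Qed.
Lemma lspan0 S : lspan S 0. Proof. exact: (lspan_subspace S).1. Qed.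
Lemma lspanZD S a x y : lspan S x -> lspan S y -> lspan S (a *: x + y).
Proof. exact: (lspan_subspace S).2. Qed.
Lemma lspanZ S a x : lspan S x -> lspan S (a *: x).
Proof. by move=> Sx; rewrite -[_ *: _]addr0; apply: lspanZD => //; exact: lspan0. Qed.
Lemma lspanD S x y : lspan S x -> lspan S y -> lspan S (x + y).
Proof. by move=> Sx Sy; rewrite -[x]scale1r; apply: lspanZD. Qed.

Lemma quot_pi_linear S a x y :
  quot_pi S (a *: x + y) = a *: quot_pi S x + quot_pi S y.
Proof.
have rpi z : lspan S (z - repr (quot_pi S z)).
  by apply/(quot_piP S); rewrite quot_reprK.
have piD z w : quot_pi S z + quot_pi S w = quot_pi S (z + w).
  rewrite -[LHS]/(quot_pi S (repr (quot_pi S z) + repr (quot_pi S w))).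
  by apply/esym/quot_piP; rewrite opprD addrACA; apply: lspanD.
have piZ z : a *: quot_pi S z = quot_pi S (a *: z).
  rewrite -[LHS]/(quot_pi S (a *: repr (quot_pi S z))).
  by apply/esym/quot_piP; rewrite -scalerBr; apply: lspanZ.
by rewrite piZ piD.
Qed.

Lemma quot_pi_eq0 S x : quot_pi S x = 0 <-> lspan S x.
Proof.
have -> : 0 = quot_pi S 0.
  by have := quot_pi_linear S 0 0 0; rewrite scaler0 addr0 scale0r add0r.
by rewrite quot_piP subr0.
Qed.
End Span.

Lemma fglift_linear (F : fieldType) (K : choiceType) (M : lmodType F) (f : K -> M)
    (a : F) (x y : {freeg K / F}) :
  fglift f (a *: x + y) = a *: fglift f x + fglift f y.
Proof.
have fB : {morph fglift f : x y / x - y} := lift_is_additive f.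
have f0 : fglift f 0 = 0 by rewrite -[in LHS](subrr 0) fB subrr.
have fN z : fglift f (- z) = - fglift f z by rewrite -sub0r fB f0 sub0r.
have fD z w : fglift f (z + w) = fglift f z + fglift f w by rewrite -{1}[w]opprK fB fN opprK.
have fS (J : Type) (s : seq J) (G : J -> {freeg K / F}) :
    fglift f (\sum_(j <- s) G j) = \sum_(j <- s) fglift f (G j).
  by elim: s => [|j s IHs]; rewrite ?big_nil ?big_cons // fD IHs.
rewrite fD; congr (_ + _).
rewrite -{2}(freeg_sumE x) -[a *: x]/(fgscale a x) /fgscale !fS scaler_sumr.
by apply: eq_bigr => z _; rewrite !liftU scalerA.
Qed.

Section Colimit.
Variables (R : realType) (X : two_dim_data) (q : nat).
Hypothesis aX : two_dim_axioms X q.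
Hypothesis q_gt1 : (1 < q)%N.
Implicit Types (i j k l r s : int) (T S m : dist R X) (n : line R X) (h : heis).

Local Notation t := (tdt X).
Local Notation u := (tdu X).
Local Notation C := R[i].
Local Notation distr := (@distr R X).
Local Notation haar := (@haar R X).
Local Notation haarB := (@haarB R X).
Local Notation muB := (@muB R X).
Local Notation mu := (@mu R X).
Local Notation rel := (@tensor_rel R X : set (free_tensors R X)).
Local Notation qq := (q%:R : C).
Local Notation pi := (quot_pi rel).

Lemma piB (x y : free_tensors R X) : pi (x - y) = pi x - pi y.
Proof. by rewrite addrC -scaleN1r quot_pi_linear scaleN1r addrC. Qed.

Lemma piZ (a : C) (x : free_tensors R X) : pi (a *: x) = a *: pi x.
Proof.
have p0 : pi 0 = 0 by apply/quot_pi_eq0; exact: lspan0.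
by rewrite -[a *: x]addr0 quot_pi_linear p0 addr0.
Qed.

Lemma rel_pi (x y : free_tensors R X) : tensor_rel (x - y) -> pi x = pi y.
Proof. by move=> xy; apply/(quot_piP rel); apply: lspan_incl. Qed.

Lemma cls_linearl s r (a : C) T T' n : s < r -> distr s r T -> distr s r T' ->
  mu 0 r n -> cls s r (a *: T + T') n = a *: cls s r T n + cls s r T' n.
Proof.
move=> sr dT dT' mn; rewrite /cls -quot_pi_linear; apply: rel_pi.
by rewrite opprD addrA; apply: RelLeft.
Qed.

Lemma cls_linearr s r (a : C) T n n' : s < r -> distr s r T ->
  mu 0 r n -> mu 0 r n' -> cls s r T (a *: n + n') = a *: cls s r T n + cls s r T n'.
Proof.
move=> sr dT mn mn'; rewrite /cls -quot_pi_linear; apply: rel_pi.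
by rewrite opprD addrA; apply: RelRight.
Qed.

Lemma cls_scaler s r (a : C) T n : s < r -> distr s r T -> mu 0 r n ->
  cls s r T (a *: n) = a *: cls s r T n.
Proof.
move=> sr dT mn; have -> : a *: n = (a - 1) *: n + n by rewrite scalerBl scale1r subrK.
by rewrite cls_linearr // scalerBl scale1r subrK.
Qed.

Lemma cls_push s' s r T n : s' < s -> s < r -> distr s r T -> mu 0 r n ->
  cls s r T n = cls s' r (push s s' r T) n.
Proof. by move=> *; apply: rel_pi; apply: RelPush. Qed.

Lemma cls_pull s r r' T n m : s < r -> r < r' -> distr s r T -> mu 0 r' n ->
  haar r r' m -> cls s r T (tens 0 r' r n (m, 0)) = cls s r' (pull s r r' T m) n.
Proof. by move=> *; apply: rel_pi; apply: RelPull. Qed.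

(** [u] is a unit of O, so only the exponent of [t] matters, and O(b) determines b because the
    inverse of [t] is not in O. *)
Lemma ord_lift h : ord (heis_lift R X q h).1 = hb h.
Proof.
have lat_eq : [set u ^ ha h * t ^ hb h * x | x in @tdO X] = lat (hb h).
  apply/seteqP; split=> [_ [x Ox <-]|_ [x Ox <-]].
    by rewrite -mulrA (lat_u aX); exists x.
  exists (u ^ (- ha h) * x); first by apply: (OM aX) => //; apply: (Ou_exp aX).
  by rewrite mulrACA -expfzDr ?(u0 aX) // subrr mul1r.
apply: xget_unique => // b; rewrite /= lat_eq => hb_b.
have le_lat b1 b2 : lat b1 `<=` @lat X b2 -> b2 <= b1.
  move=> sub; rewrite leNgt; apply/negP => lt.
  have /sub/(latE aX) : @lat X b1 (t ^ b1) by exists 1; rewrite ?mulr1 //; exact: (O1 aX).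
  rewrite -expfzDr ?(t0 aX) // => Ob; apply: (OtV aX).
  have -> : t^-1 = t ^ (- b2 + b1) * t ^+ absz (b2 - b1 - 1)%R.
    by rewrite exprnP -expfzDr ?(t0 aX) // -exprN1; congr (_ ^ _); lia.
  by apply: (OM aX) => //; apply: (Ot_exp aX).
by apply/eqP; rewrite eq_le !le_lat // hb_b.
Qed.

(** The exponent [- hc h] is the scalar built into [heis_lift]; [- ha h * r] is the factor by which
    u^(ha h) acts on [muB 0 r]. *)
Lemma tens_act h r n : mu 0 r n ->
  tens 0 (hb h) (r + hb h) (heis_lift R X q h).2 (line_act (heis_lift R X q h).1 n) =
  (qq ^ (- hc h - ha h * r) * mucoef 0 r n) *: muB 0 (r + hb h).
Proof.
move=> mn; rewrite {1}(muE aX q_gt1 mn) /heis_lift /=.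
have -> : line_act (u ^ ha h * t ^ hb h) (mucoef 0 r n *: muB 0 r) =
    (mucoef 0 r n * qq ^ (- (ha h * r))) *: muB (hb h) (r + hb h).
  rewrite -scalerA -[X in muB X (r + hb h)]add0r.
  have := line_act_muB R aX q_gt1 (ha h) (hb h) 0 r.
  by rewrite sub0r mulrN => <-.
rewrite (tens_muB aX q_gt1); congr (_ *: _).
by rewrite expfzDr ?(q0 R q_gt1) //; ring.
Qed.

Lemma tensor_actE h s r T n : mu 0 r n ->
  fglift (tensor_act (heis_lift R X q h)) (gen s r T n) =
  gen (s + hb h) (r + hb h) (dist_act (heis_lift R X q h).1 T)
    ((qq ^ (- hc h - ha h * r) * mucoef 0 r n) *: muB 0 (r + hb h)).
Proof.
move=> mn; rewrite /gen liftU scale1r /tensor_act ord_lift.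
by rewrite tens_act.
Qed.

Let hl h := heis_lift R X q h.
Let sh h i j : shifts (hl h).1 i j (hb h) (ha h) := shifts_ut aX i j (hb h) (ha h).
Let muBZ a r : mu 0 r (a *: muB 0 r) := muZ a (muB_mu R aX q_gt1 0 r).

(** Each relation goes to one of the same kind with its indices shifted by [hb h], up to rescaled
    measures. Consequently [DO_act], defined through a chosen representative, may be computed on any
    representative. *)
Lemma tensor_act_rel h x : lspan rel x ->
  lspan rel (fglift (tensor_act (heis_lift R X q h)) x).
Proof.
pose U := [set x | lspan rel (fglift (tensor_act (heis_lift R X q h)) x)].
have sU : is_subspace U.
  have fl := fglift_linear (tensor_act (heis_lift R X q h)).
  split=> [|a y z Uy Uz]; last by rewrite /U /= fl; apply: lspanZD.
  have := fl 0 0 0; rewrite scaler0 addr0 scale0r add0r => f00.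
  by rewrite /U /= (_ : fglift _ 0 = 0) //;
    [exact: lspan0|have := fl (-1) 0 0; rewrite scaler0 addr0 scaleN1r addNr].
move=> Sx; apply: (Sx U sU) => {Sx}x relx; rewrite /U /=; apply/quot_pi_eq0.
have flB y z : fglift (tensor_act (hl h)) (y - z) =
    fglift (tensor_act (hl h)) y - fglift (tensor_act (hl h)) z.
  have -> : y - z = (-1) *: z + y by rewrite scaleN1r addrC.
  by rewrite fglift_linear scaleN1r addrC.
have flZ a y : fglift (tensor_act (hl h)) (a *: y) = a *: fglift (tensor_act (hl h)) y.
  have -> : a *: y = (a - 1) *: y + y by rewrite scalerBl scale1r subrK.
  by rewrite fglift_linear scalerBl scale1r subrK.
case: relx => {x}.
- move=> s r a T T' n sr dT dT' mn; have srb : s + hb h < r + hb h by rewrite ltrD2r.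
  rewrite !flB flZ !tensor_actE // !piB piZ.
  have dg S : distr s r S -> distr (s + hb h) (r + hb h) (dist_act (hl h).1 S).
    exact: (dist_act_distr aX q_gt1 (ltW sr) (sh h s r)).
  have := cls_linearl a srb (dg T dT) (dg T' dT') (muBZ (qq ^ (- hc h - ha h * r) * mucoef 0 r n) _).
  by rewrite /cls -/(hl h) => ->; rewrite [X in X - _ - _]addrC addrK subrr.
- move=> s r a T n n' sr dT mn mn'; have srb : s + hb h < r + hb h by rewrite ltrD2r.
  rewrite !flB flZ !tensor_actE //; last exact: (mu_subspace _ _ _ _).2.
  have -> : (qq ^ (- hc h - ha h * r) * mucoef 0 r (a *: n + n')) *: muB 0 (r + hb h) =
      a *: ((qq ^ (- hc h - ha h * r) * mucoef 0 r n) *: muB 0 (r + hb h)) +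
      (qq ^ (- hc h - ha h * r) * mucoef 0 r n') *: muB 0 (r + hb h).
    by rewrite scalerA -scalerDl mucoef_linear mulrDr mulrCA.
  rewrite !piB piZ.
  have dg := dist_act_distr aX q_gt1 (ltW sr) (sh h s r) dT.
  have := cls_linearr a srb dg (muBZ (qq ^ (- hc h - ha h * r) * mucoef 0 r n) _)
    (muBZ (qq ^ (- hc h - ha h * r) * mucoef 0 r n') _).
  by rewrite /cls -/(hl h) => ->; rewrite [X in X - _ - _]addrC addrK subrr.
- move=> s' s r T n s's sr dT mn.
  have srb : s + hb h < r + hb h by rewrite ltrD2r.
  have s'sb : s' + hb h < s + hb h by rewrite ltrD2r.
  rewrite flB !tensor_actE // piB.
  have dg := dist_act_distr aX q_gt1 (ltW sr) (sh h s r) dT.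
  have := cls_push s'sb srb dg (muBZ (qq ^ (- hc h - ha h * r) * mucoef 0 r n) _).
  rewrite /cls => ->.
  by rewrite /hl /heis_lift /= (dist_act_push aX q_gt1 _ _ _ (ltW s's) (ltW sr)) subrr.
- move=> s r r' T n m sr rr' dT mn hm.
  have srb : s + hb h < r + hb h by rewrite ltrD2r.
  have rrb : r + hb h < r' + hb h by rewrite ltrD2r.
  have mm : mu r' r (m, 0) by rewrite /Defs.mu /= (ltW rr').
  have mt := tensE aX q_gt1 mn mm.
  have dg := dist_act_distr aX q_gt1 (ltW sr) (sh h s r) dT.
  have hg := dist_act_haar aX q_gt1 (ltW rr') (sh h r r') hm.
  have mg : mu (r' + hb h) (r + hb h) (dist_act (hl h).1 m, 0).
    by rewrite /Defs.mu /= (ltW rrb).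
  rewrite flB !tensor_actE //; last by rewrite mt; apply: muBZ.
  rewrite piB mt mucoefZ (mucoef_muB R aX q_gt1) mulr1.
  have := cls_pull srb rrb dg (muBZ (qq ^ (- hc h - ha h * r') * mucoef 0 r' n) _) hg.
  rewrite /cls /hl /heis_lift /= (dist_act_pull aX q_gt1 _ _ _ _ (ltW sr) (ltW rr')) => <-.
  rewrite (tensE aX q_gt1 (muBZ _ _) mg) mucoefZ (mucoef_muB R aX q_gt1) mulr1.
  apply/eqP; rewrite subr_eq0; apply/eqP; congr (pi (gen _ _ _ (_ *: _))).
  (* The exponents at [r] and [r'] differ by [ha h * (r' - r)], and this is the factor by which the
     group element rescales the Haar measure [m] of O(r)/O(r'). *)
  have -> : mucoef (r' + hb h) (r + hb h) (dist_act (u ^ ha h * t ^ hb h) m, 0) =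
      qq ^ (ha h * (r' - r)) * mucoef r' r (m, 0).
    rewrite /mucoef (ltW rrb) (ltW rr') /=.
    have [d ->] := haar_scale aX q_gt1 (ltW rr') hm.
    rewrite -[dist_act _ (d *: _)]/(d *: dist_act _ _).
    rewrite (dist_act_haarB R aX q_gt1 (ltW rr') (sh h r r')) /=.
    rewrite -[LHS]/(d * (_ * haarB _ _ _)) -[X in _ = _ * X]/(d * haarB r r' _).
    by rewrite !(haarB1 R aX q_gt1) ?(ltW rr') ?(ltW rrb) // !mulr1 mulrC.
  rewrite [RHS]mulrACA -expfzDr ?(q0 R q_gt1) //; congr (_ ^ _ * _); ring.
Qed.

End Colimit.

(** * The classes [phi_] and a pairing that detects vanishing in the colimit *)

Section Phi.
Variables (R : realType) (X : two_dim_data) (q : nat).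
Hypothesis aX : two_dim_axioms X q.
Hypothesis q_gt1 : (1 < q)%N.
Implicit Types (i j k l r s : int) (T S phi psi : dist R X) (h : heis).

Local Notation t := (tdt X).
Local Notation u := (tdu X).
Local Notation C := R[i].
Local Notation test := (@test R X).
Local Notation distr := (@distr R X).
Local Notation haarB := (@haarB R X).
Local Notation muB := (@muB R X).
Local Notation mu := (@mu R X).
Local Notation rel := (@tensor_rel R X : set (free_tensors R X)).
Local Notation qq := (q%:R : C).
Local Notation pi := (quot_pi rel).
Local Notation G_act := (@G_act R X q).
Local Notation phi_ := (@phi_ R X).

Lemma G_act_pi h x :
  G_act h (pi x) = pi (fglift (tensor_act (heis_lift R X q h)) x).
Proof.
rewrite /Defs.G_act /DO_act; apply/(quot_piP rel).
have -> (y z : free_tensors R X) : y - z = (-1) *: z + y by rewrite scaleN1r addrC.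
rewrite -fglift_linear; apply: (tensor_act_rel aX q_gt1).
by rewrite scaleN1r addrC; apply/quot_piP; rewrite quot_reprK.
Qed.

Lemma G_act_linear h (a : C) x y : G_act h (a *: x + y) = a *: G_act h x + G_act h y.
Proof.
rewrite -[x]quot_reprK -[y]quot_reprK -quot_pi_linear !G_act_pi.
by rewrite fglift_linear quot_pi_linear.
Qed.

Lemma distr_tl l phi : distr 0 1 phi -> distr l (l + 1) (dist_act (t ^ l) phi).
Proof.
move=> dphi; have sh := shifts_ut aX 0 1 l 0; rewrite expr0z mul1r in sh.
by have := dist_act_distr aX q_gt1 ler01 sh dphi; rewrite add0r (addrC 1).
Qed.

Lemma distr_u a phi : distr 0 1 phi -> distr 0 1 (dist_act (u ^ a) phi).
Proof.
move=> dphi; have sh := shifts_ut aX 0 1 0 a; rewrite expr0z mulr1 in sh.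
by have := dist_act_distr aX q_gt1 ler01 sh dphi; rewrite !addr0.
Qed.

Let l1 l : l < l + 1. Proof. by rewrite ltrDl. Qed.

Lemma phi_linear l (a : C) phi psi : distr 0 1 phi -> distr 0 1 psi ->
  phi_ l (a *: phi + psi) = a *: phi_ l phi + phi_ l psi.
Proof.
move=> dphi dpsi; rewrite /Defs.phi_ dist_act_linear.
by apply: cls_linearl; [exact: l1|exact: distr_tl..|exact: (muB_mu R aX q_gt1)].
Qed.

Lemma phi_0 l : phi_ l 0 = 0.
Proof.
have d0 := (distr_subspace R X ler01).1.
by have := phi_linear l (-1) d0 d0; rewrite scaler0 addr0 scaleN1r addNr.
Qed.

(** The factor involves [l + 1] and not [l] because the measure attached to level [l] is
    [muB 0 (l + 1)]. *)
Lemma G_act_phi h l phi : distr 0 1 phi ->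
  G_act h (phi_ l phi) =
  qq ^ (- hc h - ha h * (l + 1)) *: phi_ (l + hb h) (dist_act (u ^ ha h) phi).
Proof.
move=> dphi; rewrite /Defs.phi_ /cls G_act_pi.
rewrite (tensor_actE aX q_gt1); last exact: (muB_mu R aX q_gt1).
rewrite (mucoef_muB R aX q_gt1) mulr1.
have -> : dist_act (heis_lift R X q h).1 (dist_act (t ^ l) phi) =
    dist_act (t ^ (l + hb h)) (dist_act (u ^ ha h) phi).
  rewrite -!dist_act_mul /= (_ : _ * _ * t ^ l = t ^ (l + hb h) * u ^ ha h) //.
  by rewrite expfzDr ?(t0 aX) //; ring.
rewrite (addrAC l 1); apply: cls_scaler; first exact: l1.
  by apply: distr_tl; apply: distr_u.
exact: (muB_mu R aX q_gt1).
Qed.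

Lemma delta0_distr : distr 0 1 (@delta0 R X).
Proof.
have [t0 tD] := test_subspace R aX ler01.
have dE f : test 0 1 f -> @delta0 R X f = f 0 by rewrite /delta0 => /asboolP ->.
split=> [a f g tf tg|f nf]; last by rewrite /delta0; case: asboolP.
by rewrite !dE //; exact: tD.
Qed.

Lemma delta0E f : test 0 1 f -> @delta0 R X f = f 0.
Proof. by rewrite /delta0 => /asboolP ->. Qed.

(* [delta0] at level [m] integrates along [O(m + 1)], as does the Haar measure
   at level [m + 1]. *)
Lemma phi_delta0 m : phi_ m (@delta0 R X) = phi_ (m + 1) (haarB 0 1).
Proof.
rewrite /Defs.phi_; set m1 := m + 1.
have [mm1 mm2] : m < m1 /\ m1 < m1 + 1 by rewrite /m1; split; lia.
have dd := distr_tl m delta0_distr; have muBm := muB_mu R aX q_gt1 0 (m1 + 1).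
have hB := haarB_haar R aX q_gt1 (ltW mm2).
have -> : dist_act (t ^ m1) (haarB 0 1) = haarB m1 (m1 + 1).
  have sh := shifts_ut aX 0 1 m1 0; rewrite expr0z mul1r in sh.
  have := dist_act_haarB R aX q_gt1 ler01 sh.
  by rewrite mul0r scale1r add0r (addrC 1).
have mhB : mu (m1 + 1) m1 (haarB m1 (m1 + 1), 0) by rewrite /Defs.mu /= (ltW mm2).
have -> : muB 0 m1 = tens 0 (m1 + 1) m1 (muB 0 (m1 + 1)) (haarB m1 (m1 + 1), 0).
  rewrite (tensE aX q_gt1 muBm mhB) (mucoef_muB R aX q_gt1) /mucoef (ltW mm2) /=.
  by rewrite (haarB1 R aX q_gt1 (ltW mm2)) mulr1 scale1r.
(* Both classes are moved to O(m)/O(m+2): the one of [delta0] by refining the quotient, the one of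
   the Haar measure by enlarging the ambient lattice. *)
rewrite (cls_pull mm1 mm2 dd muBm hB) (cls_push mm1 mm2 hB.1 muBm).
congr cls; apply/funext => f; have mm3 := ltW (lt_trans mm1 mm2).
have [tf|nf] := pselect (test m (m1 + 1) f); last by rewrite pull_out // push_out.
rewrite pullE // pushE //.
have tF := fib_test aX (ltW mm1) (ltW mm2) hB tf.
rewrite /dist_act delta0E; last first.
  have sh := shifts_ut aX 0 1 m 0; rewrite expr0z mul1r in sh.
  by apply/(test_mul aX q_gt1 _ ler01 sh); rewrite add0r (addrC 1).
by rewrite mulr0 /fib; congr (haarB _ _ _); apply/funext => y; rewrite /restr add0r.
Qed.

Section Functional.

(* The pairing of a class with a test function on a large enough quotient
   [O(s)/O(r)]. *)
Definition pair_tensor r (f : func R X) (x : tensor R X) : C^o :=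
  let: (s1, r1, T, n) := x in
  mucoef 0 r1 n * T (restr s1 (fib r1 (haarB r1 r) f)).

Lemma pair_gen r f s1 r1 T n : fglift (pair_tensor r f) (gen s1 r1 T n) =
  mucoef 0 r1 n * T (restr s1 (fib r1 (haarB r1 r) f)).
Proof. by rewrite /gen liftU scale1r. Qed.

(** A relation is killed only by test functions on a quotient large enough for both its terms, so
    the bounds depend on [x]; a combination takes the minimum and the maximum of the bounds. For
    [RelPush] two restrictions compose, for [RelPull] two fibre integrations do. *)
Lemma pair_rel x : lspan rel x -> exists s0 r0, forall s r f,
  s <= s0 -> r0 <= r -> s <= r -> test s r f -> fglift (pair_tensor r f) x = 0.
Proof.
pose U := [set x | exists s0 r0, forall s r f,
  s <= s0 -> r0 <= r -> s <= r -> test s r f -> fglift (pair_tensor r f) x = 0].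
have flB r f y z : fglift (pair_tensor r f) (y - z) =
    fglift (pair_tensor r f) y - fglift (pair_tensor r f) z.
  have -> : y - z = (-1) *: z + y by rewrite scaleN1r addrC.
  by rewrite fglift_linear scaleN1r addrC.
have flZ r f a y : fglift (pair_tensor r f) (a *: y) = a *: fglift (pair_tensor r f) y.
  have -> : a *: y = (a - 1) *: y + y by rewrite scalerBl scale1r subrK.
  by rewrite fglift_linear scalerBl scale1r subrK.
have sU : is_subspace U.
  split=> [|a y z [s1 [r1 y0]] [s2 [r2 z0]]].
    by exists 0, 0 => s r f _ _ _ _; rewrite -(scale0r 0) flZ scale0r.
  exists (Num.min s1 s2), (Num.max r1 r2) => s r f ss rr sr tf.
  rewrite fglift_linear (y0 s) ?(z0 s) ?scaler0 ?addr0 //; lia.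
move=> Sx; apply: (Sx U sU) => {Sx}x [].
- move=> s r a T T' n _ _ _ _; exists 0, 0 => s' r' f _ _ _ _.
  rewrite !flB flZ !pair_gen; set F := restr _ _.
  by rewrite -[(a *: T + T') F]/(a * T F + T' F) -[a *: (_ * _)]/(a * _); ring.
- move=> s r a T n n' _ _ _ _; exists 0, 0 => s' r' f _ _ _ _.
  rewrite !flB flZ !pair_gen mucoef_linear; set F := restr _ _.
  by rewrite -[a *: (_ * _)]/(a * _); ring.
- move=> s' s r T n s's sr dT mn; exists s', r => s0 r0 f ss rr sr0 tf.
  have s0r : s0 <= r by lia.
  rewrite flB !pair_gen pushE; last first.
    apply: (test_restr aX ss); first by lia.
    exact: (fib_test aX s0r rr (haarB_haar R aX q_gt1 rr)).
  by rewrite (restr_restr aX) ?subrr // ltW.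
- move=> s r1 r2 T n m sr rr dT mn hm; exists s, r2 => s0 r0 f ss rr2 sr0 tf.
  have sr2 := ltW sr; have r12 := ltW rr.
  have s0r1 : s0 <= r1 by lia.
  have s0r2 : s0 <= r2 by lia.
  have r1r0 : r1 <= r0 by lia.
  have hB := haarB_haar R aX q_gt1 rr2.
  have mm : mu r2 r1 (m, 0) by rewrite /Defs.mu /= r12.
  rewrite flB !pair_gen (tensE aX q_gt1 mn mm) mucoefZ (mucoef_muB R aX q_gt1) mulr1.
  have tF := fib_test aX s0r2 rr2 hB tf.
  rewrite pullE; last by apply: (test_restr aX ss) => //; lia.
  rewrite (fib_restr aX _ sr2 r12 hm) (fib_fib aX _ s0r1 r12 rr2 hB tf).
  (* Writing [m] as a multiple of the normalised measure reduces the relation to the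
     multiplicativity of the latter: the scalar [d] comes out on both sides. *)
  have [d ->] := haar_scale aX q_gt1 r12 hm.
  rewrite -[haarB r2 r0]scale1r (pull_scale aX q_gt1) // mulr1 /mucoef r12 /=.
  rewrite -[(d *: haarB r1 r2) _]/(d * haarB r1 r2 _) (haarB1 R aX q_gt1) // mulr1.
  have -> : restr s (fib r1 (d *: haarB r1 r0) f) = d *: restr s (fib r1 (haarB r1 r0) f).
    apply/funext => z; rewrite /restr /fib -[RHS]/(d * (if _ then _ else _)).
    by case: asboolP => // _; rewrite mulr0.
  have tG : test s r1 (restr s (fib r1 (haarB r1 r0) f)).
    apply: (test_restr aX ss) => //.
    exact: (fib_test aX s0r1 r1r0 (haarB_haar R aX q_gt1 r1r0)).
  have [t0 tD] := test_subspace R aX sr2.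
  have -> : T (d *: restr s (fib r1 (haarB r1 r0) f)) = d * T (restr s (fib r1 (haarB r1 r0) f)).
    rewrite -[d *: _]addr0 dT.1 // (distr0 aX sr2 dT) addr0 //.
  by rewrite mulrA subrr.
Qed.

End Functional.

(** The value of [pair_tensor r f] on the generator underlying [phi_ m phi]; the line factor is 1
    because [muB] has coordinate 1. *)
Definition phi_pair m r f phi : C :=
  phi (fun x => restr m (fib (m + 1) (haarB (m + 1) r) f) (t ^ m * x)).

Lemma sum_phi_eq0 (ms : seq int) (phi : int -> dist R X) :
  \sum_(m <- ms) phi_ m (phi m) = 0 -> exists s0 r0, forall s r f,
    s <= s0 -> r0 <= r -> s <= r -> test s r f ->
    \sum_(m <- ms) phi_pair m r f (phi m) = 0.
Proof.
pose g m := gen m (m + 1) (dist_act (t ^ m) (phi m)) (muB 0 (m + 1)).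
have -> : \sum_(m <- ms) phi_ m (phi m) = pi (\sum_(m <- ms) g m).
  elim: ms => [|m ms IHms]; first by rewrite !big_nil; apply/esym/quot_pi_eq0; exact: lspan0.
  by rewrite !big_cons IHms -[g m]scale1r quot_pi_linear scale1r.
move=> /quot_pi_eq0/pair_rel [s0 [r0 P]]; exists s0, r0 => s r f ss rr sr tf.
rewrite -[RHS](P s r f) //; elim: ms {P} => [|m ms IHms].
  by rewrite !big_nil; have := fglift_linear (pair_tensor r f) (-1) 0 0;
     rewrite scaler0 addr0 scaleN1r addNr.
rewrite !big_cons IHms -[g m]scale1r fglift_linear scale1r pair_gen.
by rewrite (mucoef_muB R aX q_gt1) mul1r.
Qed.

End Phi.

(** * The lowest term of an element of the kernel *)

Section Lowest.
Variables (R : realType) (X : two_dim_data) (q : nat).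
Hypothesis aX : two_dim_axioms X q.
Hypothesis q_gt1 : (1 < q)%N.
Implicit Types (i j k l m r s : int) (T phi psi : dist R X).

Local Notation t := (tdt X).
Local Notation u := (tdu X).
Local Notation C := R[i].
Local Notation test := (@test R X).
Local Notation distr := (@distr R X).
Local Notation haarB := (@haarB R X).
Local Notation qq := (q%:R : C).
Local Notation phi_ := (@phi_ R X).
Local Notation Dbar := (@Dbar R X).
Local Notation delta0 := (@delta0 R X).

(** Both [h] and its inverse have residue in the valuation ring of the residue field, so
    multiplication by either preserves every level of O/O(1). *)
Lemma unit_shifts (h : X) : h != 0 -> @tdO' X h -> @tdO' X h^-1 -> shifts h 0 1 0 0.
Proof.
rewrite (O'E aX) => h0 Wh WhV; split=> // k x; rewrite !addr0.
have mulW (g y : X) : resW X 0 g -> sub 0 1 k y -> sub 0 1 k (g * y).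
  move=> [b [ o [Bb Ob Oo ->]]] /(subE aX) [b' [ o' [Bb' Ob' Oo' ->]]].
  apply/(subE aX); exists (b * b'), (o * (u ^ k * b') + b * o' + t * (o * o')).
  split; [exact: (BM aX)|exact: (OM aX)| |by rewrite !expr0z expr1z; ring].
  have OuB : tdO (u ^ k * b') by apply: (OM aX) => //; apply: (Ou_exp aX).
  apply: (OD aX); last by apply: (OM aX); [exact: (Ot aX)|exact: (OM aX)].
  by apply: (OD aX); apply: (OM aX).
split=> [/(mulW _ _ WhV)|]; last exact: mulW.
by rewrite mulKf.
Qed.

Lemma Dbar_subspace : is_subspace Dbar.
Proof.
have [d0 dD] := distr_subspace R X ler01.
split=> [|a T S [dT iT] [dS iS]]; first by split.
by split=> [|h h0 Oh OhV]; [exact: dD|rewrite dist_act_linear iT ?iS].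
Qed.

Lemma DbarZ (a : C) phi : Dbar phi -> Dbar (a *: phi).
Proof.
move=> Dp; rewrite -[_ *: _]addr0; apply: Dbar_subspace.2 => //.
exact: Dbar_subspace.1.
Qed.

Lemma Dbar_delta0 : Dbar delta0.
Proof.
split=> [|h h0 Oh OhV]; first exact: (delta0_distr R aX).
have sh := unit_shifts h0 Oh OhV.
apply/funext => f; rewrite /dist_act /Defs.delta0 mulr0.
by congr (if _ then _ else _); apply/asboolP/asboolP; rewrite -(test_mul aX q_gt1 f ler01 sh) !addr0.
Qed.

Lemma Dbar_haarB : Dbar (haarB 0 1).
Proof.
split=> [|h h0 Oh OhV]; first exact: (haarB_haar R aX q_gt1 ler01).1.
have := dist_act_haarB R aX q_gt1 ler01 (unit_shifts h0 Oh OhV).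
by rewrite !addr0 mul0r scale1r.
Qed.

Lemma Dbar_u (a : int) phi : Dbar phi -> Dbar (dist_act (u ^ a) phi).
Proof.
move=> [dp ip]; split=> [|h h0 Oh OhV]; first exact: (distr_u aX q_gt1).
by rewrite -dist_act_mul mulrC dist_act_mul ip.
Qed.

Lemma delta0_cosetf k c : lat 0 c -> ~ sub 0 1 k c -> delta0 (cosetf R 0 1 k c) = 0.
Proof.
move=> Lc nc; rewrite delta0E; last exact: (test_cosetf R aX).
by rewrite cosetf_out // sub0r => /(sub_N aX); rewrite opprK.
Qed.

(** When a ball around 0 is split into its subballs, only the one containing 0 contributes. Thus
    [phi] has the same value on all balls around 0 and vanishes on the other cosets, as does a
    multiple of [delta0]. *)
Lemma dist_delta0 phi : distr 0 1 phi ->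
  (forall k c, lat 0 c -> ~ sub 0 1 k c -> phi (cosetf R 0 1 k c) = 0) ->
  phi = phi (cosetf R 0 1 0 0) *: delta0.
Proof.
move=> dp p0; have ij : (0 : int) <= 1 by [].
have dd := delta0_distr R aX; have L0 i : lat i 0 := lat_0 aX i.
have pS l : phi (cosetf R 0 1 l 0) = phi (cosetf R 0 1 (l + 1) 0).
  have [I [r [cI ch]]] := sub_chain aX 0 1; rewrite add0r in ch.
  have lT a f g : step_fun (sub 0 1) f -> step_fun (sub 0 1) g ->
      phi (a *: f + g) = a *: phi f + phi g.
    by rewrite -(testE aX) //; apply: dp.1.
  have Lr a : lat 0 (r l a) := sub_lat aX ij (chain_r ch l a).
  have Sl0 : sub 0 1 l ((0 : X) - 0) by rewrite subr0; apply: (sub_0 aX).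
  have [a Na] := coset_split ch Sl0.
  rewrite {1}/cosetf (linear_coset ch lT l (sub_0 aX 0 1 0)) (bigD1 a) //= big1 => [|b /eqP ba].
    rewrite addr0; congr (phi _); apply/funext => x; congr ((_ : bool)%:R).
    have : `[< sub 0 1 (l + 1) (0 - (0 + r l a)) >] by rewrite Na.
    rewrite !add0r => /asboolP Sr; apply/asboolP/asboolP => Sx.
      by rewrite subr0 -(subrK (r l a) x); apply: (sub_D aX) Sx _;
         rewrite -[r l a]opprK; apply: (sub_N aX).
    by move: Sx; rewrite subr0 => Sx; apply: (sub_D aX).
  rewrite add0r -[coset _ _ _ _]/(cosetf R 0 1 (l + 1) (r l b)); apply: p0 => // Sb.
  by apply: ba; apply/eqP; rewrite -Na !add0r; apply/asboolP/(sub_N aX).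
have pN l (n : nat) : phi (cosetf R 0 1 l 0) = phi (cosetf R 0 1 (l + n%:Z) 0).
  by elim: n => [|n IHn]; rewrite ?addr0 // IHn pS -addrA -PoszD addn1.
have p00 k : phi (cosetf R 0 1 k 0) = phi (cosetf R 0 1 0 0).
  case: (leP 0 k) => k0.
    by have := pN 0 `|k|%N; rewrite add0r => ->; congr (phi (cosetf R 0 1 _ 0)); lia.
  by rewrite (pN k `|k|%N); congr (phi (cosetf R 0 1 _ 0)); lia.
have [s0 sD] := distr_subspace R X ij.
apply: (distr_eq aX ij dp).
  by rewrite -[_ *: _]addr0; apply: sD.
move=> k c Lc; rewrite -[RHS]/(_ * delta0 _).
have [Sc|nSc] := pselect (sub 0 1 k c); last by rewrite (p0 k c Lc nSc) (delta0_cosetf Lc nSc) mulr0.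
rewrite delta0E; last exact: (test_cosetf R aX).
rewrite cosetf_in ?sub0r; last exact: (sub_N aX).
rewrite mulr1 -(p00 k); congr (phi _); apply/funext => x; congr ((_ : bool)%:R).
rewrite subr0; apply/asboolP/asboolP => Sx; last exact: (sub_B aX).
by rewrite -(subrK c x); apply: (sub_D aX).
Qed.

(** The ball around t^m c meets O(m) modulo O(m+1) in the coset of t^m c; the power of q is the
    volume of the fibres along O(m+1)/O(r). *)
Lemma phi_pair_diag m r s k c phi : s <= m -> m + 1 <= r -> lat 0 c -> distr 0 1 phi ->
  phi_pair m r (cosetf R s r k (t ^ m * c)) phi =
  qq ^ (- (k * (r - (m + 1)))) * phi (cosetf R 0 1 k c).
Proof.
move=> sm mr Lc dp; have sm1 : s <= m + 1 by lia.
rewrite /phi_pair (fib_cosetf R aX q_gt1 _ _ sm1 mr).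
set a := _ ^ _; have ij : (0 : int) <= 1 by [].
have tc := test_cosetf R aX k ij Lc.
have [t0 _] := test_subspace R aX ij.
have -> : a * phi (cosetf R 0 1 k c) = phi (a *: cosetf R 0 1 k c).
  by rewrite -[a *: _]addr0 dp.1 // (distr0 aX ij dp) addr0.
congr (phi _); apply/funext => x; rewrite /restr.
rewrite -[RHS]/(a * cosetf R 0 1 k c x).
rewrite -[X in if _ then X else _]/(a * cosetf R s (m + 1) k (t ^ m * c) (t ^ m * x)).
have Lm y : lat m (t ^ m * y) <-> lat 0 y.
  by rewrite -(lat_shift aX 0 m y) add0r.
have Sm y : sub m (m + 1) k (t ^ m * y) <-> sub 0 1 k y.
  by rewrite -(sub_shift aX 0 1 k m 0) expr0z mul1r add0r addr0 (addrC 1).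
case: asboolP => [/Lm Lx|nL].
  congr (_ * (_ : bool)%:R); apply/asboolP/asboolP; rewrite -mulrBr -Sm.
    apply: (sub_capl aX); first by lia.
    by apply/Lm; apply: (lat_B aX).
  exact: (sub_lel aX).
rewrite cosetf_out ?mulr0 // => Sx; apply/nL/Lm.
by rewrite -(subrK c x); apply: (lat_D aX) (sub_lat aX ij Sx) Lc.
Qed.

(** A term of level m' > m lives on O(m'), hence inside O(m+1), and a ball of level [k] around t^m c
    does not meet O(m+1) unless [c] has level [k] modulo O(1). *)
Lemma phi_pair_above m m' r s k c phi : s <= m -> m < m' -> m' + 1 <= r ->
  lat 0 c -> ~ sub 0 1 k c -> distr 0 1 phi ->
  phi_pair m' r (cosetf R s r k (t ^ m * c)) phi = 0.
Proof.
move=> sm mm mr Lc nc dp; have sm1 : s <= m' + 1 by lia.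
rewrite /phi_pair (fib_cosetf R aX q_gt1 _ _ sm1 mr).
rewrite -[RHS](distr0 aX ler01 dp); congr (phi _); apply/funext => x; rewrite /restr.
case: asboolP => // Lx; rewrite -[LHS]/(_ * cosetf R s (m' + 1) k (t ^ m * c) (t ^ m' * x)).
rewrite cosetf_out ?mulr0 // => Sx; apply: nc.
rewrite -(sub_shift aX 0 1 k m 0) expr0z mul1r add0r addr0 (addrC 1).
apply: (sub_capl aX (i := s)); first by lia.
  by have := (lat_shift aX 0 m c).2 Lc; rewrite add0r.
rewrite (_ : t ^ m * c = t ^ m' * x - (t ^ m' * x - t ^ m * c)); last by ring.
apply: (sub_B aX); first by apply: (lat_sub aX); apply: (lat_le aX) Lx; lia.
by apply: (sub_ler aX) Sx; lia.
Qed.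

Lemma lowest_term m (ms : seq int) (phi : int -> dist R X) :
  (forall i, i \in ms -> m < i) -> (forall i, distr 0 1 (phi i)) ->
  \sum_(i <- m :: ms) phi_ i (phi i) = 0 -> exists a : C, phi m = a *: delta0.
Proof.
move=> ms_gt dp /(sum_phi_eq0 aX q_gt1) [s0 [r0 P]].
exists (phi m (cosetf R 0 1 0 0)); apply: dist_delta0 => // k c Lc nc.
(* O(s)/O(r) is taken large enough for the relations used, through [s0] and [r0], and for every term
   of the sum. *)
pose s := Num.min s0 m; pose r := Num.max r0 (\big[Num.max/m + 1]_(i <- ms) (i + 1)).
have r_m : m + 1 <= \big[Num.max/m + 1]_(i <- ms) (i + 1).
  by elim: (ms) => [|i ms' IH]; rewrite ?big_nil // big_cons le_max IH orbT.
have r_ms i : i \in ms -> i + 1 <= \big[Num.max/m + 1]_(i <- ms) (i + 1).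
  elim: (ms) => // j ms' IH; rewrite inE big_cons le_max => /predU1P[->|/IH ->].
    by rewrite lexx.
  by rewrite orbT.
have sr : s <= r by rewrite /s /r; lia.
have tf : test s r (cosetf R s r k (t ^ m * c)).
  apply: (test_cosetf R aX) => //; apply: (lat_le aX (j := m)); first by rewrite /s; lia.
  by have := (lat_shift aX 0 m c).2 Lc; rewrite add0r.
have := P s r _ _ _ sr tf; rewrite big_cons phi_pair_diag //; [|by rewrite /s /r; lia..].
rewrite big_seq big1 => [|i ims]; last first.
  apply: phi_pair_above => //; [by rewrite /s; lia|exact: ms_gt|].
  by have := r_ms i ims; rewrite /r; lia.
rewrite addr0 => P0; have := P0 _ _; rewrite /s /r => /(_ _ _)/eqP.
rewrite mulf_eq0 expfz_eq0 (negbTE (q0 R q_gt1)) andbF /= => Q; apply/eqP/Q; lia.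
Qed.

(** Since q > 1 there are two distinct residue digits, and their difference is integral but not of
    level 1. *)
Lemma exists_unit_coset : exists c : X, lat 0 c /\ ~ sub 0 1 1 c.
Proof.
have [d [dBO _ d_uniq]] := res_digits aX.
have q_gt0 : (0 < q)%N by lia.
pose i0 := Ordinal q_gt0; pose i1 := Ordinal q_gt1.
exists (d i0 - d i1); split.
  by apply/(latE aX); rewrite expr0z mul1r; apply: (OB aX); apply dBO.
by rewrite -(resWE aX) => /d_uniq /(congr1 val).
Qed.

End Lowest.

(** * The induced representation *)

Lemma big_support (V : zmodType) (s s' : seq int) (G : int -> V) :
  uniq s -> uniq s' -> (forall m, G m != 0 -> m \in s) ->
  (forall m, G m != 0 -> m \in s') -> \sum_(m <- s) G m = \sum_(m <- s') G m.
Proof.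
move=> us us' sG sG'.
have filterE r : \sum_(m <- r) G m = \sum_(m <- [seq m <- r | G m != 0]) G m.
  rewrite big_filter (bigID (fun m => G m != 0)) /= [X in _ + X]big1 ?addr0 //.
  by move=> m /negPn/eqP.
rewrite filterE [RHS]filterE; apply: perm_big; apply: uniq_perm; rewrite ?filter_uniq //.
move=> m; rewrite !mem_filter; case: (boolP (G m != 0)) => //= Gm.
by rewrite sG ?sG'.
Qed.

Lemma linear_on0 (F : fieldType) (V W : lmodType F) (U : set V) (f : V -> W) :
  is_subspace U -> linear_on U f -> f 0 = 0.
Proof.
move=> [U0 _] lf; have := lf (-1) 0 0 U0 U0.
by rewrite scaler0 addr0 scaleN1r addNr.
Qed.

Lemma subspaceT (F : fieldType) (V : lmodType F) : is_subspace (setT : set V).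
Proof. by []. Qed.

Lemma subspace_sum (F : fieldType) (V : lmodType F) (U : set V) (I : eqType) (s : seq I)
    (g : I -> V) :
  is_subspace U -> (forall i, i \in s -> U (g i)) -> U (\sum_(i <- s) g i).
Proof.
move=> [U0 UD]; elim: s => [|i s IHs] Ug; first by rewrite big_nil.
rewrite big_cons -[g i]scale1r; apply: UD; first by apply: Ug; rewrite mem_head.
by apply: IHs => j js; apply: Ug; rewrite inE js orbT.
Qed.

Lemma subspaceZ (F : fieldType) (V : lmodType F) (U : set V) a x :
  is_subspace U -> U x -> U (a *: x).
Proof. by move=> [U0 UD] Ux; rewrite -[a *: x]addr0; apply: UD. Qed.

Lemma subspaceB (F : fieldType) (V : lmodType F) (U : set V) x y :
  is_subspace U -> U x -> U y -> U (x - y).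
Proof. by move=> [U0 UD] Ux Uy; rewrite addrC -scaleN1r; apply: UD. Qed.

Lemma linear_on_sum (F : fieldType) (V W : lmodType F) (U : set V) (f : V -> W)
    (I : Type) (s : seq I) (g : I -> V) :
  is_subspace U -> linear_on U f -> (forall i, U (g i)) ->
  U (\sum_(i <- s) g i) /\ f (\sum_(i <- s) g i) = \sum_(i <- s) f (g i).
Proof.
move=> sU lf Ug; elim: s => [|i s [IHU IHf]].
  by rewrite !big_nil; split; [exact: sU.1|exact: linear_on0 lf].
rewrite !big_cons; split; first by rewrite -[g i]scale1r; apply: sU.2.
by rewrite -[g i in LHS]scale1r lf // scale1r IHf.
Qed.

Section Heis.
Implicit Types (g h : heis).
Lemma ha_mul g h : ha (g * h)%g = ha g + ha h. Proof. by []. Qed.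
Lemma hb_mul g h : hb (g * h)%g = hb g + hb h. Proof. by []. Qed.
Lemma hc_mul g h : hc (g * h)%g = hc g + hc h + ha g * hb h. Proof. by []. Qed.
Lemma ha_inv g : ha g^-1%g = - ha g. Proof. by []. Qed.
Lemma hb_inv g : hb g^-1%g = - hb g. Proof. by []. Qed.
Lemma hc_inv g : hc g^-1%g = ha g * hb g - hc g. Proof. by []. Qed.
Definition heisE := (ha_mul, hb_mul, hc_mul, ha_inv, hb_inv, hc_inv).
Lemma heis_split g : g = (Heis 0 (hb g) 0 * Heis (ha g) 0 (hc g))%g.
Proof.
case: g => [[a b] c]; rewrite /Heis /ha /hb /hc /=; congr (_, _, _) => /=;
by rewrite /ha /hb /hc /=; lia.
Qed.
End Heis.

(* Naming this module structure keeps unification from unfolding it. *)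
Definition indV (R : realType) (X : two_dim_data) : lmodType R[i] :=
  (heis -> dist R X : Type).

Section IndRep.
Variables (R : realType) (X : two_dim_data) (q : nat).
Hypothesis aX : two_dim_axioms X q.
Hypothesis q_gt1 : (1 < q)%N.
Implicit Types (i j k l m : int) (phi psi : dist R X) (g h : heis) (f : indV R X).

Local Notation C := R[i].
Local Notation phi_ := (@phi_ R X).
Local Notation Dbar := (@Dbar R X).
Local Notation sigma := (@sigma R X q).
Local Notation V := (indV R X).
Local Notation Delta m phi := (@Delta R X q m phi : V).
Local Notation Ind := (ind_sigma R X q : set (indV R X)).
Local Notation G_act := (@G_act R X q).
Local Notation act := (@ind_act _ heis _).
Local Notation at_ m := (Heis 0 m 0).

Lemma phi_scale l (a : C) phi : distr 0 1 phi -> phi_ l (a *: phi) = a *: phi_ l phi.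
Proof.
move=> dp; have -> : a *: phi = (a - 1) *: phi + phi by rewrite scalerBl scale1r subrK.
by rewrite (phi_linear aX q_gt1) // scalerBl scale1r subrK.
Qed.

Lemma sigma_linear h (a : C) phi psi :
  sigma h (a *: phi + psi) = a *: sigma h phi + sigma h psi.
Proof. by rewrite /Defs.sigma dist_act_linear scalerDr !scalerA mulrC. Qed.

Lemma sigma0 h : sigma h 0 = 0.
Proof. by have := sigma_linear h (-1) 0 0; rewrite scaler0 addr0 scaleN1r addNr. Qed.

Lemma sigma_comp h h' phi : sigma h (sigma h' phi) =
  sigma (Heis (ha h + ha h') 0 (hc h + hc h')) phi.
Proof.
rewrite /Defs.sigma /Heis /ha /hc /=.
rewrite -[dist_act _ (_ *: _)]/(_ *: dist_act _ _) scalerA -dist_act_mul.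
rewrite -!expfzDr ?(q0 R q_gt1) ?(u0 aX) //; congr (_ ^ _ *: _); ring.
Qed.

Lemma sigma1 phi h : ha h = 0 -> hc h = 0 -> sigma h phi = phi.
Proof. by rewrite /Defs.sigma => -> ->; rewrite subr0 oppr0 !expr0z scale1r dist_act_1. Qed.

Lemma Dbar_sigma h phi : Dbar phi -> Dbar (sigma h phi).
Proof. by move=> Dp; apply/DbarZ/(Dbar_u aX q_gt1). Qed.

Lemma DeltaE m phi g : hb g = m -> Delta m phi g = sigma (Heis (- ha g) 0 (- hc g)) phi.
Proof.
move=> <-; rewrite /Defs.Delta eqxx; congr (sigma _ phi).
by rewrite /Heis; congr (_, _, _); rewrite /ha /hb /hc /= ?oppr0 ?mulr0 ?sub0r.
Qed.

Lemma Delta_out m phi g : hb g != m -> Delta m phi g = 0.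
Proof. by rewrite /Defs.Delta => /negbTE ->. Qed.

Lemma Delta_at m n phi : Delta m phi (at_ n) = if n == m then phi else 0.
Proof.
have [<-|nm] := eqVneq n m; last by rewrite Delta_out.
by rewrite DeltaE //; apply: sigma1; rewrite oppr0.
Qed.

Lemma Delta_linear m (a : C) phi psi :
  Delta m (a *: phi + psi) = a *: Delta m phi + Delta m psi.
Proof.
apply/funext => g; rewrite -[RHS]/(a *: Delta m phi g + Delta m psi g).
have [hm|hm] := eqVneq (hb g) m; first by rewrite !DeltaE // sigma_linear.
by rewrite !Delta_out // scaler0 addr0.
Qed.

Lemma Delta_ind m phi : Dbar phi -> Ind (Delta m phi).
Proof.
move=> Dp; split=> [g|g h hC|].
- have [hm|hm] := eqVneq (hb g) m; first by rewrite DeltaE //; apply: Dbar_sigma.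
  by rewrite Delta_out //; apply: (Dbar_subspace R X).1.
- have hbh : hb h = 0 := hC.
  have [hm|hm] := eqVneq (hb g) m; last first.
    by rewrite !Delta_out ?heisE ?hbh ?addr0 // sigma0.
  rewrite !DeltaE ?heisE ?hbh ?addr0 // sigma_comp /Heis /ha /hc /=.
  rewrite -/(ha h) -/(hc h) -/(ha g) -/(hc g); congr (sigma (_, _, _) _);
  by rewrite ?hbh; ring.
exists [:: at_ m] => x; have [xm _|xm] := eqVneq (hb x) m; last first.
  by rewrite Delta_out // eqxx.
exists (at_ m), (Heis (ha x) 0 (hc x)); split=> //; first by rewrite inE.
by rewrite [LHS]heis_split xm.
Qed.

Lemma ind_subspace : is_subspace Ind.
Proof.
have [D0 DD] := Dbar_subspace R X; split=> [|a f f' [fD fs [s fin]] [fD' fs' [s' fin']]].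
  by split=> [x|g h _|]; [exact: D0|rewrite sigma0|exists [::] => x; rewrite eqxx].
split=> [x|g h hC|]; first exact: DD.
  by rewrite -[LHS]/(a *: f _ + f' _) fs // fs' // -sigma_linear.
exists (s ++ s') => x; rewrite -[(a *: f + f') x]/(a *: f x + f' x);
  have [fx|/fin [g [h [gs hC ->]]] _] := eqVneq (f x) 0.
  rewrite fx scaler0 add0r => /fin' [g [h [gs hC ->]]].
  by exists g, h; rewrite mem_cat gs orbT.
by exists g, h; rewrite mem_cat gs.
Qed.

Lemma ind_at f x : Ind f -> f x = sigma (Heis (- ha x) 0 (- hc x)) (f (at_ (hb x))).
Proof.
move=> [_ fs _]; rewrite {1}(heis_split x) fs //; congr (sigma _ _).
by rewrite /Heis; congr (_, _, _); rewrite /ha /hb /hc /= ?oppr0 ?mulr0 ?sub0r.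
Qed.

Lemma ind_support f : Ind f -> exists2 s : seq int, uniq s &
  forall m, f (at_ m) != 0 -> m \in s.
Proof.
move=> [_ _ [s fin]]; exists (undup (map hb s)); first exact: undup_uniq.
move=> m /fin [g [h [gs hC gh]]]; rewrite mem_undup; apply/mapP; exists g => //.
by have := congr1 hb gh; rewrite hb_mul (hC : hb h = 0) addr0.
Qed.

Lemma ind_expand f (s : seq int) : Ind f -> uniq s -> (forall m, f (at_ m) != 0 -> m \in s) ->
  f = \sum_(m <- s) Delta m (f (at_ m)).
Proof.
move=> If us sf; apply/funext => x; rewrite fct_sumE (ind_at x If).
have [xs|xs] := boolP (hb x \in s).
  rewrite (bigD1_seq (hb x)) //= DeltaE // big1 ?addr0 // => m mx.
  by rewrite Delta_out // eq_sym.
rewrite big_seq big1 => [|m ms]; last by rewrite Delta_out //; apply: contraNneq xs => ->.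
have [->|/sf] := eqVneq (f (at_ (hb x))) 0; first by rewrite sigma0.
by rewrite (negbTE xs).
Qed.

Lemma ind_sigma_ind (P : set V) : is_subspace P ->
  (forall m phi, Dbar phi -> P (Delta m phi)) -> Ind `<=` P.
Proof.
move=> sP PDelta f If; have [s us sf] := ind_support If.
rewrite (ind_expand If us sf); have [fD _ _] := If.
by apply: subspace_sum => // m _; apply: PDelta.
Qed.

(** From g (0,m,0) = (0,m+b,0) (a,0,c+am) for g = (a,b,c): moving [a] past [m] produces the central
    term [a * m]. *)
Lemma act_Delta g m phi : act g (Delta m phi) =
  Delta (m + hb g) (sigma (Heis (ha g) 0 (hc g + ha g * m)) phi).
Proof.
apply/funext => x; rewrite /ind_act.
have [xm|xm] := eqVneq (hb x) (m + hb g); last first.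
  by rewrite !Delta_out // !heisE; apply: contraNneq xm => <-; apply/eqP; ring.
rewrite (DeltaE (m := m)); last by rewrite !heisE xm; ring.
rewrite DeltaE // sigma_comp !heisE xm; congr (sigma _ _).
by rewrite /Heis /ha /hc /=; congr (_, _, _); ring.
Qed.

Lemma act_linear g (a : C) f f' :
  (act g (a *: f + f') : V) = a *: (act g f : V) + (act g f' : V).
Proof. by []. Qed.

Lemma ind_rep : is_rep Ind act.
Proof.
split=> [|g f If|g a f f' _ _|f _|g h f _] //; first exact: ind_subspace.
- move: f If; apply: (@ind_sigma_ind [set f : V | Ind (act g f)]).
    have [I0 ID] := ind_subspace; split=> [//|a f f' If If'].
    by rewrite /= act_linear; apply: ID.
  move=> m phi Dp; rewrite /= act_Delta.
  exact/Delta_ind/Dbar_sigma.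
- by apply/funext => x; rewrite /ind_act invg1 mul1g.
- by apply/funext => x; rewrite /ind_act invgM mulgA.
Qed.

Section Beta.
Variable beta : V -> DO R X.
Hypothesis beta_lin : linear_on Ind beta.
Hypothesis beta_Delta : forall m phi, Dbar phi -> beta (Delta m phi) = phi_ m phi.

Lemma betaE f (s : seq int) : Ind f -> uniq s -> (forall m, f (at_ m) != 0 -> m \in s) ->
  beta f = \sum_(m <- s) phi_ m (f (at_ m)).
Proof.
move=> If us sf; rewrite {1}(ind_expand If us sf); have [fD _ _] := If.
have [_ e] := linear_on_sum s ind_subspace beta_lin (fun m => Delta_ind m (fD (at_ m))).
by apply: (etrans e); apply: eq_bigr => m _; rewrite beta_Delta.
Qed.

Lemma beta0 : beta 0 = 0.
Proof.
exact: linear_on0 ind_subspace beta_lin.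
Qed.

(** On [Delta m phi] both sides carry q^(-c-am-a). The summand [- a] in [sigma] is what accounts for
    the level m + 1 of the measure attached to [phi_ m]. *)
Lemma beta_act g f : Ind f -> beta (act g f) = G_act g (beta f).
Proof.
move=> If; suff [] : [set f : V | Ind f /\ beta (act g f) = G_act g (beta f)] f by [].
have [_ Iact _ _ _] := ind_rep; have [I0 ID] := ind_subspace.
have Gl := G_act_linear aX q_gt1 g.
move: f If; apply: ind_sigma_ind.
  split=> [|a f f' [If ef] [If' ef']].
    split=> //; rewrite (_ : act g 0 = 0) // beta0.
    by apply/esym; apply: (linear_on0 (subspaceT _)) => a x y _ _; apply: Gl.
  split; first exact: ID.
  by rewrite act_linear !beta_lin ?Gl ?ef ?ef' //; apply: Iact.
move=> m phi Dp; split; first exact: Delta_ind.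
have Du := Dbar_u aX q_gt1 (ha g) Dp.
rewrite act_Delta !beta_Delta //; last exact: Dbar_sigma.
rewrite (G_act_phi aX q_gt1 _ _ Dp.1).
rewrite /Defs.sigma phi_scale; last exact: Du.1.
congr (_ ^ _ *: phi_ _ _).
by rewrite /Heis /ha /hc /=; ring.
Qed.

End Beta.
End IndRep.

(** * The elements [v_] and coordinates along them *)

Section Kernel.
Variables (R : realType) (X : two_dim_data) (q : nat).
Hypothesis aX : two_dim_axioms X q.
Hypothesis q_gt1 : (1 < q)%N.
Implicit Types (i j k l m : int) (phi psi : dist R X) (g h : heis) (f : indV R X).

Local Notation u := (tdu X).
Local Notation C := R[i].
Local Notation haarB := (@haarB R X).
Local Notation qq := (q%:R : C).
Local Notation delta0 := (@delta0 R X).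
Local Notation V := (indV R X).
Local Notation Delta m phi := (@Delta R X q m phi : V).
Local Notation Ind := (ind_sigma R X q : set V).
Local Notation v_ m := (v_ R X q m : V).
Local Notation act := (@ind_act _ heis _).
Local Notation at_ m := (Heis 0 m 0).

Lemma v_E m : v_ m = Delta m delta0 - Delta (m + 1) (haarB 0 1).
Proof. by apply/funext => x. Qed.

Lemma v_ind m : Ind (v_ m).
Proof.
rewrite v_E; apply: (subspaceB (ind_subspace R X q)).
  exact/(Delta_ind aX q_gt1)/(Dbar_delta0 R aX q_gt1).
exact/(Delta_ind aX q_gt1)/(Dbar_haarB R aX q_gt1).
Qed.

Lemma v_at m n : v_ m (at_ n) =
  (if n == m then delta0 else 0) - (if n == m + 1 then haarB 0 1 else 0).
Proof.
by rewrite -[LHS]/(Delta m _ (at_ n) - Delta (m + 1) _ (at_ n)) !(Delta_at q).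
Qed.

(** Multiplication by u^a fixes [delta0] and multiplies the Haar measure of the residue field by
    q^a. This cancels the extra q^(-a) that [act_Delta] produces at m + 1 compared with m, so both
    halves of [v_ m] scale alike. *)
Lemma act_v g m : act g (v_ m) = qq ^ (- hc g - ha g * m - ha g) *: v_ (m + hb g).
Proof.
rewrite (v_E m) -[LHS]/((act g (Delta m delta0) : V) - (act g (Delta (m + 1) (haarB 0 1)) : V)).
rewrite !(act_Delta aX q_gt1) v_E addrAC scalerBr.
have DZ n a phi : Delta n (a *: phi) = a *: Delta n phi.
  have -> : a *: phi = (a - 1) *: phi + phi by rewrite scalerBl scale1r subrK.
  by rewrite Delta_linear scalerBl scale1r subrK.
have sh := shifts_ut aX 0 1 0 (ha g); rewrite expr0z mulr1 in sh.
congr (_ - _); rewrite -DZ; congr (Delta _ _); rewrite /Defs.sigma /Heis /ha /hc /=.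
  have -> : dist_act (u ^ g.1.1) delta0 = delta0.
    apply/funext => f; rewrite /dist_act /Defs.delta0 mulr0.
    by congr (if _ then _ else _); apply/asboolP/asboolP;
       rewrite -(test_mul aX q_gt1 f ler01 sh) !addr0.
  by congr (_ ^ _ *: _); ring.
rewrite (dist_act_haarB R aX q_gt1 ler01 sh) !addr0 ?subr0 mulr1 scalerA -expfzDr ?(q0 R q_gt1) //.
by congr (_ ^ _ *: _); rewrite /ha; ring.
Qed.

Section Coordinates.
Variable c0 : X.
Hypothesis Lc0 : lat 0 c0.
Hypothesis nc0 : ~ sub 0 1 1 c0.

(** Reads off the coefficient of [v_ i]: at i + 1 only [v_ i] and [v_ (i + 1)] are nonzero, the
    latter through [delta0], which vanishes on the coset of [c0]. The former contributes minus the
    mass q^(-1) of that coset, whence the factor -q. *)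
Definition vcoord i f : C := - qq * f (at_ (i + 1)) (cosetf R 0 1 1 c0).

Lemma vcoord_linear i (a : C) f f' :
  vcoord i (a *: f + f') = a * vcoord i f + vcoord i f'.
Proof.
rewrite /vcoord -[(a *: f + f') _ _]/(a * f (at_ (i + 1)) _ + f' (at_ (i + 1)) _).
by ring.
Qed.

Lemma vcoord_v i j : vcoord i (v_ j) = (i == j)%:R.
Proof.
have d0 := delta0_cosetf R aX Lc0 nc0.
have hB : haarB 0 1 (cosetf R 0 1 1 c0) = qq^-1.
  by rewrite (haarB_cosetf _ aX) // subr0 mulr1.
rewrite /vcoord v_at (can_eq (addrK 1)).
set A := if i + 1 == j then _ else _; set B := if i == j then _ else _.
have A0 : A (cosetf R 0 1 1 c0) = 0 by rewrite /A; case: ifP.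
rewrite -[(A - B) _]/(A (cosetf R 0 1 1 c0) - B (cosetf R 0 1 1 c0)) A0 sub0r /B.
case: (i == j); last by rewrite -[(0 : dist R X) _]/(0 : C) oppr0 mulr0.
by rewrite hB mulrNN divff ?(q0 R q_gt1).
Qed.

Lemma vcoord_sum i (s : seq int) (c : int -> C) :
  vcoord i (\sum_(j <- s) c j *: v_ j) = \sum_(j <- s) c j * vcoord i (v_ j).
Proof.
elim: s => [|j s IHs]; last by rewrite !big_cons vcoord_linear IHs.
by rewrite !big_nil /vcoord -[X in _ * X]/(0 : C) mulr0.
Qed.

Lemma vcoord_sum_uniq i (s : seq int) (c : int -> C) : uniq s ->
  vcoord i (\sum_(j <- s) c j *: v_ j) = if i \in s then c i else 0.
Proof.
move=> us; rewrite vcoord_sum; case: ifP => [si|/negbT si].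
  rewrite (bigD1_seq i) //= vcoord_v eqxx mulr1 big1 ?addr0 // => j ji.
  by rewrite vcoord_v eq_sym (negbTE ji) mulr0.
rewrite big_seq big1 // => j js; rewrite vcoord_v.
by case: eqVneq js si => [->->|]; rewrite ?mulr0.
Qed.

(** Allowing every [s] that contains [s0] lets two expansions be added after passing to a common
    index list. *)
Lemma span_v_expand f : lspan (range (fun m => v_ m)) f -> exists s0 : seq int,
  forall s, uniq s -> {subset s0 <= s} -> f = \sum_(i <- s) vcoord i f *: v_ i.
Proof.
pose P := [set f : V | exists s0 : seq int,
  forall s, uniq s -> {subset s0 <= s} -> f = \sum_(i <- s) vcoord i f *: v_ i].
move=> sf; apply: (sf P) => {sf}; first split.
- exists [::] => s _ _; rewrite big1 // => i _.
  by rewrite /vcoord -[X in _ * X]/(0 : C) mulr0 scale0r.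
- move=> a f1 f2 [s1 P1] [s2 P2]; exists (s1 ++ s2) => s us ss.
  rewrite {1}(P1 s us) => [|i is1]; last by apply: ss; rewrite mem_cat is1.
  rewrite {1}(P2 s us) => [|i is2]; last by apply: ss; rewrite mem_cat is2 orbT.
  rewrite scaler_sumr -big_split /=; apply: eq_bigr => i _.
  by rewrite vcoord_linear scalerDl scalerA.
move=> _ [m _ <-]; exists [:: m] => s us ss; have ms : m \in s by apply: ss; rewrite inE.
rewrite (bigD1_seq m ms us) /= big1 => [|i im]; first by rewrite vcoord_v eqxx scale1r addr0.
by rewrite vcoord_v (negbTE im) scale0r.
Qed.

(** The element (1,0,0) has eigenvalue q^(-i-1) on [v_ i], and these are distinct since q > 1.
    Applying it and subtracting the eigenvalue of the first term removes that term and multiplies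
    the others by nonzero scalars, so the sum shrinks until one vector is left. *)
Lemma eigen_sum (U : set V) : is_subspace U -> (forall g f, U f -> U (act g f)) ->
  forall (s : seq int) (c : int -> C), uniq s -> s != [::] ->
  (forall i, i \in s -> c i != 0) -> U (\sum_(i <- s) c i *: v_ i) -> exists m, U (v_ m).
Proof.
move=> sU Uact; elim=> // m s IHs c us _ c0_.
have cm : c m != 0 by apply: c0_; rewrite mem_head.
case: s IHs us c0_ => [_ _ _|m' s IHs us c0_ Us].
  rewrite big_seq1 => Uv; exists m.
  by rewrite -[v_ m]scale1r -(mulVf cm) -scalerA; apply: subspaceZ.
pose lam i : C := qq ^ (- i - 1).
pose c' i := c i * (lam i - lam m).
have lam_inj i j : lam i = lam j -> i = j.
  rewrite /lam; wlog ij : i j / i <= j => [wl e|].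
    by case/orP: (le_total i j) => ij; [apply: wl|apply/esym/wl].
  have [n jn] : exists n : nat, j = i + n%:Z by exists `|j - i|%N; lia.
  have -> : - i - 1 = - j - 1 + n%:Z by lia.
  rewrite expfzDr ?(q0 R q_gt1) // -[RHS]mulr1 => /mulfI.
  rewrite expfz_neq0 ?(q0 R q_gt1) // => /(_ isT) /eqP.
  rewrite -exprnP -natrX -[1]/(1%:R) eqr_nat => qn1.
  case: n jn qn1 => [|n _ /eqP qn1]; first by lia.
  by have : (1 < q ^ n.+1)%N; [rewrite -(exp1n n.+1) ltn_exp2r|rewrite qn1].
have := us; rewrite cons_uniq => /andP [ms us'].
apply: (IHs c') => // [i is'|].
  rewrite mulf_neq0 ?subr_eq0 //; first by apply: c0_; rewrite inE is' orbT.
  by apply: contraNneq ms => /lam_inj <-.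
have Ug := Uact (Heis 1 0 0) _ Us.
have -> : \sum_(i <- m' :: s) c' i *: v_ i =
    (act (Heis 1 0 0) (\sum_(i <- [:: m, m' & s]) c i *: v_ i) : V)
    - lam m *: \sum_(i <- [:: m, m' & s]) c i *: v_ i.
  have -> : (act (Heis 1 0 0) (\sum_(i <- [:: m, m' & s]) c i *: v_ i) : V) =
      \sum_(i <- [:: m, m' & s]) (c i * lam i) *: v_ i.
    elim: [:: m, m' & s] => [|i r IHr]; first by rewrite !big_nil.
    rewrite !big_cons act_linear IHr act_v scalerA; congr (_ *: v_ _ + _).
      by congr (_ * _ ^ _); rewrite /ha /hc /=; ring.
    by rewrite /hb /= addr0.
  rewrite scaler_sumr -sumrB [RHS]big_cons scalerA -scalerBl.
  rewrite (mulrC (lam m)) subrr scale0r add0r; apply: eq_bigr => i _.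
  by rewrite scalerA -scalerBl /c' mulrBr (mulrC (lam m)).
by apply: subspaceB => //; apply: subspaceZ.
Qed.

End Coordinates.
End Kernel.

(** * The kernel of [beta] *)

Section Main.
Variables (R : realType) (X : two_dim_data) (q : nat).
Hypothesis aX : two_dim_axioms X q.
Hypothesis q_gt1 : (1 < q)%N.
Implicit Types (i j k l m : int) (phi psi : dist R X) (g h : heis) (f : indV R X).

Local Notation C := R[i].
Local Notation haarB := (@haarB R X).
Local Notation qq := (q%:R : C).
Local Notation phi_ := (@phi_ R X).
Local Notation Dbar := (@Dbar R X).
Local Notation delta0 := (@delta0 R X).
Local Notation V := (indV R X).
Local Notation Delta m phi := (@Delta R X q m phi : V).
Local Notation Ind := (ind_sigma R X q : set V).
Local Notation G_act := (@G_act R X q).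
Local Notation v_ m := (v_ R X q m : V).
Local Notation act := (@ind_act _ heis _).
Local Notation at_ m := (Heis 0 m 0).
Local Notation spanv := (lspan (range (fun m => v_ m))).

Lemma ind_eq0 f : Ind f -> (forall i, f (at_ i) = 0) -> f = 0.
Proof.
move=> If f0; rewrite (@ind_expand R X q f [::] If isT) ?big_nil // => m.
by rewrite f0 eqxx.
Qed.

Section Beta.
Variable beta : V -> DO R X.
Hypothesis beta_lin : linear_on Ind beta.
Hypothesis beta_Delta : forall m phi, Dbar phi -> beta (Delta m phi) = phi_ m phi.

Local Notation Ker := (Ker q beta : set V).

Lemma ker_subspace : is_subspace Ker.
Proof.
have sI := ind_subspace R X q; split.
  by split; [exact: sI.1|exact: (beta0 beta_lin)].
move=> a f f' [If bf] [If' bf']; split; first exact: sI.2.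
by rewrite beta_lin // bf bf' scaler0 addr0.
Qed.

Lemma ker_v m : Ker (v_ m).
Proof.
split; first exact: (v_ind R aX q_gt1).
have ID := Delta_ind aX q_gt1 m (Dbar_delta0 R aX q_gt1).
have IH := Delta_ind aX q_gt1 (m + 1) (Dbar_haarB R aX q_gt1).
have -> : v_ m = (-1) *: Delta (m + 1) (haarB 0 1) + Delta m delta0.
  by rewrite v_E scaleN1r addrC.
rewrite beta_lin // !beta_Delta ?scaleN1r ?(phi_delta0 R aX q_gt1) ?addNr //.
  exact: (Dbar_delta0 R aX q_gt1).
exact: (Dbar_haarB R aX q_gt1).
Qed.

Lemma ker_act g f : Ker f -> Ker (act g f).
Proof.
move=> [If bf]; split; first by have [_ Iact _ _ _] := ind_rep R aX q_gt1; apply: Iact.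
rewrite (beta_act aX q_gt1 beta_lin beta_Delta) // bf.
by apply: (linear_on0 (subspaceT _)) => a x y _ _; apply: (G_act_linear aX q_gt1).
Qed.

Lemma ker_lowest m (ms : seq int) f : Ker f -> uniq (m :: ms) ->
  (forall i, i \in ms -> m < i) -> (forall i, f (at_ i) != 0 -> i \in m :: ms) ->
  exists a : C, f (at_ m) = a *: delta0.
Proof.
move=> [If bf] us ms_gt sf; have [fD _ _] := If.
apply: (@lowest_term R X q aX q_gt1 m ms (fun i => f (at_ i))) => //.
  by move=> i; apply: (fD (at_ i)).1.
exact: etrans (esym (betaE aX q_gt1 beta_lin beta_Delta If us sf)) bf.
Qed.

(** Induction on the width of the support. Subtracting a multiple of [v_ m] clears the place m at
    the cost of changing the place m + 1, so the width drops as long as it is positive; width 0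
    needs a separate argument. *)
Lemma ker_width (N : nat) m f : Ker f ->
  (forall i, f (at_ i) != 0 -> m <= i <= m + N%:Z) -> spanv f.
Proof.
have [c0 [Lc0 nc0]] := exists_unit_coset aX q_gt1.
have sK := ker_subspace.
elim: N m f => [|N IHN] m f Kf sf.
  have f_out i : i != m -> f (at_ i) = 0.
    by move=> im; apply: contrapT => /eqP/sf; lia.
  have [a fa] : exists a : C, f (at_ m) = a *: delta0.
    apply: (ker_lowest (ms := [::]) Kf) => // i fi; rewrite inE.
    by have := sf i fi; lia.
  pose f' := f - a *: v_ m.
  have f'E i : f' (at_ i) = f (at_ i) - a *: (v_ m (at_ i)) by [].
  have Kf' : Ker f'.
    by apply: subspaceB => //; apply: subspaceZ => //; apply: ker_v.
  have f'1 : f' (at_ (m + 1)) = a *: haarB 0 1.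
    have mm : (m + 1 == m) = false by lia.
    by rewrite f'E v_at mm eqxx f_out ?mm // !sub0r scalerN opprK.
  (* The single term at m has been traded for [a] times the Haar measure at m + 1. As the lowest
     term of a kernel element this is again a multiple of [delta0], and evaluation on the coset of
     [c0] gives a = 0. *)
  have [b f'b] : exists b : C, f' (at_ (m + 1)) = b *: delta0.
    apply: (ker_lowest (ms := [::]) Kf') => // i; rewrite inE.
    rewrite f'E; apply: contra_neqT => im1; have [->|im] := eqVneq i m.
      have mm : (m == m + 1) = false by lia.
      by rewrite v_at eqxx mm fa subr0 subrr.
    by rewrite f_out // v_at (negbTE im) (negbTE im1) subrr scaler0 subrr.
  have a0 : a = 0.
    have := congr1 (fun T : dist R X => T (cosetf R 0 1 1 c0)) (etrans (esym f'1) f'b).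
    rewrite -[X in X = _]/(a * haarB 0 1 (cosetf R 0 1 1 c0)).
    rewrite -[X in _ = X]/(b * delta0 (cosetf R 0 1 1 c0)).
    rewrite (delta0_cosetf R aX Lc0 nc0) (haarB_cosetf R aX q_gt1 1 ler01 Lc0) mulr0.
    by move=> /eqP; rewrite mulf_eq0 expfz_eq0 (negbTE (q0 R q_gt1)) andbF orbF => /eqP.
  rewrite (ind_eq0 Kf.1); first exact: lspan0.
  move=> i; have [->|/f_out //] := eqVneq i m.
  by rewrite fa a0 scale0r.
have us : uniq (m :: [seq m + n%:Z | n <- iota 1 N.+1]).
  rewrite -[m in m :: _]addr0 -[m + 0 :: _]/[seq m + n%:Z | n <- iota 0 N.+2].
  by rewrite map_inj_uniq ?iota_uniq // => n n'; lia.
have [a fa] : exists a : C, f (at_ m) = a *: delta0.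
  apply: (ker_lowest Kf us) => [j /mapP [n]|j /sf jN].
    by rewrite mem_iota => n_ge ->; lia.
  rewrite inE; case: eqP => // jm; apply/mapP; exists `|j - m|%N; last by lia.
  by rewrite mem_iota; lia.
have -> : f = a *: v_ m + (f - a *: v_ m) by rewrite addrC subrK.
apply: lspanZD; first by apply: lspan_incl; exists m.
apply: (IHN (m + 1)); first by apply: subspaceB => //; apply: subspaceZ => //; apply: ker_v.
move=> i; rewrite -[(f - _) _]/(f (at_ i) - a *: (v_ m (at_ i))) v_at.
have [->|im] := eqVneq i m.
  have mm : (m == m + 1) = false by lia.
  by rewrite mm fa subr0 subrr eqxx.
have [->|im1] := eqVneq i (m + 1); first by lia.
by rewrite subrr scaler0 subr0 => /sf; lia.
Qed.

Lemma ker_span : spanv = Ker.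
Proof.
apply/seteqP; split=> [f|f Kf].
  by apply; [exact: ker_subspace|move=> _ [m _ <-]; apply: ker_v].
have [s us sf] := ind_support Kf.1.
(* A crude bound on the indices: the support lies between [- N] and [N], a window of width
   [N + N]. *)
pose N := (\sum_(i <- s) `|i|)%N.
have sN i : i \in s -> (`|i| <= N)%N.
  by move=> si; rewrite /N (big_rem i) //= leq_addr.
apply: (@ker_width (N + N) (- N%:Z)) => // i /sf/sN; lia.
Qed.

Lemma ker_basis : is_basis Ker (fun m => v_ m).
Proof.
have [c0 [Lc0 nc0]] := exists_unit_coset aX q_gt1.
split; first exact: ker_span.
move=> s c us sc i si.
have := vcoord_sum_uniq aX q_gt1 Lc0 nc0 i c us.
by rewrite sc si => <-; rewrite /vcoord -[X in _ * X]/(0 : C) mulr0.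
Qed.

Lemma ker_expand c0 (Lc0 : lat 0 c0) (nc0 : ~ sub 0 1 1 c0) f : Ker f ->
  exists s0 : seq int, forall s, uniq s -> {subset s0 <= s} ->
    f = \sum_(i <- s) vcoord q c0 i f *: v_ i.
Proof. by rewrite -ker_span => /(span_v_expand aX q_gt1 Lc0 nc0). Qed.

Lemma ker_irreducible : irreducible Ker act.
Proof.
have [c0 [Lc0 nc0]] := exists_unit_coset aX q_gt1.
split.
  exists (v_ 0); first exact: ker_v.
  apply/eqP => v00; have := vcoord_v R aX q_gt1 Lc0 nc0 0 0.
  rewrite v00 eqxx /vcoord -[X in _ * X]/(0 : C) mulr0 => /esym/eqP.
  by rewrite oner_eq0.
move=> U sU UK Uact.
have [[f Uf f0]|nU] := pselect (exists2 f : V, U f & f != 0); last first.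
  left; apply/seteqP; split=> [f Uf|_ ->]; last exact: sU.1.
  by apply: contrapT => f0; apply: nU; exists f => //; apply/eqP.
right; apply/seteqP; split=> //.
have [m Um] : exists m, U (v_ m).
  have [s0 fE] := ker_expand Lc0 nc0 (UK f Uf).
  pose s := [seq i <- undup s0 | vcoord q c0 i f != 0].
  have us : uniq s by rewrite filter_uniq ?undup_uniq.
  have {}fE : f = \sum_(i <- s) vcoord q c0 i f *: v_ i.
    rewrite {1}(fE (undup s0)) ?undup_uniq //; last by move=> i; rewrite mem_undup.
    rewrite big_filter (bigID (fun i => vcoord q c0 i f != 0)) /= [X in _ + X]big1 ?addr0 //.
    by move=> i /negPn/eqP ->; rewrite scale0r.
  apply: (eigen_sum aX q_gt1 sU Uact (s := s) us (c := fun i => vcoord q c0 i f)).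
  - by apply/eqP => s_nil; move: f0; rewrite fE s_nil big_nil eqxx.
  - by move=> i; rewrite mem_filter => /andP [].
  - by rewrite -fE.
rewrite -ker_span => f' spf; apply: (spf U sU) => _ [n _ <-].
have := Uact (Heis 0 (n - m) 0) _ Um.
by rewrite (act_v R aX q_gt1) /ha /hb /hc /= oppr0 mul0r !subr0 scale1r addrC subrK.
Qed.

Lemma image_beta : beta @` Ind = Psi R X.
Proof.
have sI := ind_subspace R X q.
apply/seteqP; split=> [_ [f If <-] U sU PU|x].
  suff [] : [set f : V | Ind f /\ U (beta f)] f by [].
  move: f If; apply: (ind_sigma_ind (q := q)).
    split=> [|a f f' [If Uf] [If' Uf']].
      by split; [exact: sI.1|rewrite (beta0 beta_lin); exact: sU.1].
    by split; [exact: sI.2|rewrite beta_lin //; exact: sU.2].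
  move=> m phi Dp; split; first exact: (Delta_ind aX q_gt1).
  by rewrite beta_Delta //; apply: PU; exists m => //; exists phi.
apply; first split.
- by exists 0; [exact: sI.1|exact: (beta0 beta_lin)].
- move=> a _ _ [f If <-] [f' If' <-]; exists (a *: f + f'); first exact: sI.2.
  by rewrite beta_lin.
- move=> _ [m _ [phi Dp <-]]; exists (Delta m phi); first exact: (Delta_ind aX q_gt1).
  by rewrite beta_Delta.
Qed.

(** [G_act] is given by chosen lifts and is not shown to be an action on all of [DO]. On [Psi] the
    unit and product laws are inherited from the induced representation, because [beta] is
    equivariant and surjective. *)
Lemma Psi_rep : is_rep (Psi R X) G_act.
Proof.
have [_ Iact _ I1 IM] := ind_rep R aX q_gt1.
have bact g f If := @beta_act R X q aX q_gt1 beta beta_lin beta_Delta g f If.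
split; first exact: lspan_subspace.
- move=> g x; rewrite -image_beta => -[f If <-].
  by exists (act g f); [exact: Iact|rewrite bact].
- by move=> g a x y _ _; apply: (G_act_linear aX q_gt1).
- by move=> x; rewrite -image_beta => -[f If <-]; rewrite -bact // I1.
- move=> g h x; rewrite -image_beta => -[f If <-].
  rewrite -(bact h) // -(bact g); last exact: Iact.
  by rewrite -bact // IM.
Qed.

Lemma ker_rep : is_rep Ker act.
Proof.
have [_ _ _ I1 IM] := ind_rep R aX q_gt1.
split; first exact: ker_subspace.
- by move=> g f; apply: ker_act.
- by [].
- by move=> f [If _]; apply: I1.
- by move=> g h f [If _]; apply: IM.
Qed.

Lemma beta_exact : short_exact Ker act Ind act (Psi R X) G_act id beta.
Proof.
split.
- by split; [exact: ker_rep|exact: ind_rep|exact: Psi_rep].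
- split; first by split=> // f [].
  split=> //; first by move=> f If; rewrite -image_beta; exists f.
  by move=> g f If; apply: (beta_act aX q_gt1 beta_lin beta_Delta).
- by [].
- by rewrite image_id.
- exact: image_beta.
Qed.

Section Iso.
Variable c0 : X.
Hypothesis Lc0 : lat 0 c0.
Hypothesis nc0 : ~ sub 0 1 1 c0.

Definition chiV : lmodType C := (heis -> C^o : Type).

(** Sends [v_ m] to a function supported on [hb x = m + 1]. The shift by one is forced: (a,0,c) acts
    on [v_ m] by q^(-c-a(m+1)), and in the representation induced from [chi0] this character belongs
    to the place m + 1. *)
Definition ker_to_chi (f : V) : chiV :=
  fun x => qq ^ hc x * vcoord q c0 (hb x - 1) f.

Lemma ker_to_chi_linear (a : C) f f' :
  ker_to_chi (a *: f + f') = a *: ker_to_chi f + ker_to_chi f'.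
Proof.
apply/funext => x; rewrite -[RHS]/(a * ker_to_chi f x + ker_to_chi f' x) /ker_to_chi.
by rewrite vcoord_linear; ring.
Qed.

Lemma ker_to_chi_act g f : Ker f ->
  ker_to_chi (act g f) = (act g (ker_to_chi f : heis -> C^o) : chiV).
Proof.
rewrite -ker_span.
pose P := [set f : V | ker_to_chi (act g f) = (act g (ker_to_chi f : heis -> C^o) : chiV)].
have k0 : ker_to_chi 0 = 0.
  by apply: (linear_on0 (subspaceT _)) => a x y _ _; apply: ker_to_chi_linear.
move=> sf; apply: (sf P) => {sf f}; first split.
- by rewrite /P /= (_ : act g 0 = 0) // k0.
- move=> a f f'; rewrite /P /= => e e'.
  rewrite act_linear !ker_to_chi_linear e e'.
  by apply/funext.
move=> _ [m _ <-]; rewrite /P /= (act_v R aX q_gt1).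
apply/funext => x; rewrite /ind_act /ker_to_chi.
have -> : vcoord q c0 (hb x - 1) (qq ^ (- hc g - ha g * m - ha g) *: v_ (m + hb g)) =
    qq ^ (- hc g - ha g * m - ha g) * vcoord q c0 (hb x - 1) (v_ (m + hb g)).
  by rewrite /vcoord mulrCA.
rewrite !(vcoord_v R aX q_gt1 Lc0 nc0) !heisE.
have -> : (- hb g + hb x - 1 == m) = (hb x - 1 == m + hb g) by lia.
case: eqP => [xm|_]; last by rewrite !mulr0.
have {}xm : hb x = m + hb g + 1 by lia.
rewrite !mulr1 -expfzDr ?(q0 R q_gt1) // xm; congr (_ ^ _); ring.
Qed.

Lemma ker_to_chi_ind f : Ker f -> (ind_chi0 R q : set chiV) (ker_to_chi f).
Proof.
move=> Kf; split=> // [g h hC|].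
  have hbh : hb h = 0 := hC.
  rewrite /ker_to_chi /chi0 !heisE hbh addr0 !mulr0 !addr0 sub0r opprK.
  by rewrite (addrC (hc g)) expfzDr ?(q0 R q_gt1) // mulrA.
have [s us sf] := ind_support Kf.1.
exists [seq at_ i | i <- s] => x.
rewrite /ker_to_chi /vcoord subrK => fx.
have xs : hb x \in s.
  apply: sf; apply: contra_neq fx => ->.
  by rewrite -[(0 : dist R X) _]/(0 : C) !mulr0.
exists (at_ (hb x)), (Heis (ha x) 0 (hc x)); split=> //; last exact: heis_split.
by apply/mapP; exists (hb x).
Qed.

Lemma ker_to_chi_bij : set_bij Ker (ind_chi0 R q : set chiV) ker_to_chi.
Proof.
have cE f i : vcoord q c0 i f = ker_to_chi f (at_ (i + 1)).
  by rewrite /ker_to_chi /hc /hb /= addrK expr0z mul1r.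
split.
- by move=> f; apply: ker_to_chi_ind.
- move=> f f' /set_mem Kf /set_mem Kf' ff'.
  have [s1 f1] := ker_expand Lc0 nc0 Kf.
  have [s2 f2] := ker_expand Lc0 nc0 Kf'.
  rewrite (f1 (undup (s1 ++ s2))) ?undup_uniq //; last first.
    by move=> i i1; rewrite mem_undup mem_cat i1.
  rewrite [RHS](f2 (undup (s1 ++ s2))) ?undup_uniq //; last first.
    by move=> i i1; rewrite mem_undup mem_cat i1 orbT.
  by apply: eq_bigr => i _; rewrite !cE ff'.
move=> z [_ zs [s fin]].
pose r := undup [seq hb g - 1 | g <- s].
have z_at x : z x = qq ^ hc x * z (at_ (hb x)).
  rewrite {1}(heis_split x) zs // /chi0 heisE; congr (_ ^ _ * _).
  by rewrite /ha /hb /hc /=; ring.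
exists (\sum_(i <- r) z (at_ (i + 1)) *: v_ i).
  rewrite -ker_span.
  apply: subspace_sum => [|i _]; first exact: lspan_subspace.
  by apply: lspanZ; apply: lspan_incl; exists i.
apply/funext => x; rewrite /ker_to_chi z_at.
rewrite (vcoord_sum_uniq aX q_gt1 Lc0 nc0 _ (fun i => z (at_ (i + 1)))) ?undup_uniq // subrK.
case: ifPn => // xr; congr (_ * _); apply/esym/eqP; apply: contraNT xr => zx.
have [g [h [gs hC gh]]] := fin _ zx; rewrite mem_undup; apply/mapP; exists g => //.
by have := congr1 hb gh; rewrite hb_mul (hC : hb h = 0) addr0 => <-.
Qed.

End Iso.

Lemma ker_iso : rep_isomorphic Ker act (ind_chi0 R q : set chiV) act.
Proof.
have [c0 [Lc0 nc0]] := exists_unit_coset aX q_gt1.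
exists (ker_to_chi c0); split; last exact: ker_to_chi_bij.
split=> [a f f' _ _|f|g f].
- exact: ker_to_chi_linear.
- exact: ker_to_chi_ind.
- exact: ker_to_chi_act.
Qed.

End Beta.

(** The sum runs over an arbitrarily chosen list containing the support; since [phi_ m 0 = 0], it
    does not depend on that list, and linearity is checked on a list common to both arguments. *)
Lemma exists_beta : exists beta : V -> DO R X, is_beta q beta.
Proof.
pose sup (f : V) := [set s : seq int | uniq s /\ forall m, f (at_ m) != 0 -> m \in s].
pose beta (f : V) := \sum_(m <- xget [::] (sup f)) phi_ m (f (at_ m)).
have betaE f (s : seq int) : Ind f -> uniq s -> (forall m, f (at_ m) != 0 -> m \in s) ->
    beta f = \sum_(m <- s) phi_ m (f (at_ m)).
  move=> If us sf; have [u0 f0] : sup f (xget [::] (sup f)) by apply: xgetPex; exists s.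
  by apply: big_support => // m pm; [apply: f0|apply: sf]; apply: contra_neq pm => ->;
     exact: (phi_0 R aX q_gt1).
have sI := ind_subspace R X q.
exists beta; split=> [a f f' If If'|m phi Dp].
  have [s us sf] := ind_support If; have [s' us' sf'] := ind_support If'.
  have [fD _ _] := If; have [fD' _ _] := If'.
  rewrite (betaE _ (undup (s ++ s'))) ?undup_uniq //; last 2 first.
  - exact: sI.2.
  - move=> m; rewrite mem_undup mem_cat -[(a *: f + f') _]/(a *: f (at_ m) + f' (at_ m)).
    have [->|/sf -> //] := eqVneq (f (at_ m)) 0.
    by rewrite scaler0 add0r => /sf' ->; rewrite orbT.
  rewrite (betaE f (undup (s ++ s'))) ?undup_uniq //; last first.
    by move=> m /sf ms; rewrite mem_undup mem_cat ms.
  rewrite (betaE f' (undup (s ++ s'))) ?undup_uniq //; last first.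
    by move=> m /sf' ms; rewrite mem_undup mem_cat ms orbT.
  rewrite scaler_sumr -big_split /=; apply: eq_bigr => m _.
  by rewrite -(phi_linear aX q_gt1) //; [apply: (fD _).1|apply: (fD' _).1].
rewrite (betaE (Delta m phi) [:: m]) //.
- by rewrite big_seq1 Delta_at eqxx.
- exact: (Delta_ind aX q_gt1).
- by move=> n; rewrite Delta_at inE; case: (n == m) => // /eqP.
Qed.

Lemma main_axioms :
  (exists beta : (heis -> dist R X) -> DO R X, is_beta q beta) /\
  forall beta : (heis -> dist R X) -> DO R X, is_beta q beta ->
  [/\ (forall beta', is_beta q beta' ->
         forall f, ind_sigma R X q f -> beta' f = beta f),
      short_exact (Defs.Ker q beta) (@ind_act _ heis _) (ind_sigma R X q) (@ind_act _ heis _)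
        (Psi R X) (Defs.G_act q) id beta,
      is_basis (Defs.Ker q beta) (Defs.v_ R X q),
      irreducible (Defs.Ker q beta) (@ind_act _ heis _)
    & rep_isomorphic (Defs.Ker q beta) (@ind_act _ heis _)
        (ind_chi0 R q) (@ind_act _ heis _)].
Proof.
split; first exact: exists_beta.
move=> beta [bl bD]; split.
- move=> beta' [bl' bD'] f If; have [s us sf] := ind_support If.
  by rewrite (betaE aX q_gt1 bl' bD' If us sf) (betaE aX q_gt1 bl bD If us sf).
- exact: beta_exact bl bD.
- exact: ker_basis bl bD.
- exact: ker_irreducible bl bD.
- exact: ker_iso bl bD.
Qed.

End Main.

(** * Power series *)

(* [pseries] is also a name of MathComp-Analysis. *)
Local Notation pseries := Defs.pseries.

Section Series.
Variable F : idomainType.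
Implicit Types (f g h : pseries F) (c : F) (A : set F).

Lemma ps_addE f g n : (f + g) n = f n + g n. Proof. by []. Qed.
Lemma ps_subE f g n : (f - g) n = f n - g n. Proof. by []. Qed.
Lemma ps_mulE f g n : (f * g) n = \sum_(i < n.+1) f i * g (n - i)%N. Proof. by []. Qed.
Lemma ps_oneE n : (1 : pseries F) n = (n == 0%N)%:R.
Proof. by rewrite -[LHS]/(ps_const 1 n) /ps_const; case: (n == 0%N). Qed.

Lemma ps_mul_coef0 f g : (f * g) 0%N = f 0%N * g 0%N.
Proof. by rewrite ps_mulE big_ord1. Qed.

Lemma ps_constM c f n : (ps_const c * f) n = c * f n.
Proof.
rewrite ps_mulE big_ord_recl /= subn0 big1 ?addr0 // => i _.
by rewrite /ps_const mul0r.
Qed.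

Lemma ps_XM0 f : (ps_X F * f) 0%N = 0.
Proof. by rewrite ps_mul_coef0 mul0r. Qed.

Lemma ps_XMS f n : (ps_X F * f) n.+1 = f n.
Proof.
rewrite ps_mulE big_ord_recl /= mul0r add0r big_ord_recl /= subSS subn0 mul1r.
by rewrite big1 ?addr0 // => i _; rewrite /ps_X mul0r.
Qed.

Lemma ps_XnM f n m : (ps_X F ^+ n * f) (n + m)%N = f m.
Proof. by elim: n => [|n IHn]; rewrite ?expr0 ?mul1r // exprS -mulrA addSn ps_XMS. Qed.

Lemma ps_XnM_low f n i : (i < n)%N -> (ps_X F ^+ n * f) i = 0.
Proof.
elim: n i => // n IHn [|i] lt_in; first by rewrite exprS -mulrA ps_XM0.
by rewrite exprS -mulrA ps_XMS IHn.
Qed.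

Lemma ps_split f : f = ps_const (f 0%N) + ps_X F * (fun n => f n.+1).
Proof.
apply/funext => -[|n]; rewrite ps_addE.
  by rewrite ps_XM0 addr0.
by rewrite ps_XMS /ps_const add0r.
Qed.

Lemma ps_constMc c c' : ps_const (c * c') = ps_const c * ps_const c'.
Proof.
apply/funext => n; rewrite ps_constM /ps_const.
by case: (n == 0%N); rewrite ?mulr0.
Qed.

Lemma ps_const_exp c n : ps_const (c ^+ n) = ps_const c ^+ n.
Proof. by elim: n => [|n IHn]; rewrite ?expr0 // !exprS ps_constMc IHn. Qed.

Lemma ps_X_neq0 : ps_X F != 0.
Proof. by apply/eqP => /(congr1 (@^~ 1%N)) /eqP; rewrite /ps_X /= oner_eq0. Qed.

Section Closed.
Variable A : set F.
Hypothesis A1 : A 1.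
Hypothesis AB : forall x y, A x -> A y -> A (x - y).
Hypothesis AM : forall x y, A x -> A y -> A (x * y).

Lemma closed0 : A 0. Proof. by rewrite -(subrr 1); apply: AB. Qed.
Lemma closedN x : A x -> A (- x).
Proof. by move=> Ax; rewrite -sub0r; apply: AB (closed0) Ax. Qed.
Lemma closedD x y : A x -> A y -> A (x + y).
Proof. by move=> Ax /closedN Ay; rewrite -[y]opprK; apply: AB. Qed.
Lemma closed_sum (I : Type) (s : seq I) (G : I -> F) :
  (forall i, A (G i)) -> A (\sum_(i <- s) G i).
Proof.
move=> AG; elim: s => [|i s IHs]; first by rewrite big_nil; apply: closed0.
by rewrite big_cons; apply: closedD.
Qed.

Lemma series_const c : A c -> series_of A (ps_const c).
Proof. by move=> Ac n; rewrite /ps_const; case: ifP => _ //; apply: closed0. Qed.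
Lemma series1 : series_of A 1. Proof. exact: series_const. Qed.
Lemma seriesB f g : series_of A f -> series_of A g -> series_of A (f - g).
Proof. by move=> Af Ag n; apply: AB. Qed.
Lemma seriesM f g : series_of A f -> series_of A g -> series_of A (f * g).
Proof. by move=> Af Ag n; rewrite ps_mulE; apply: closed_sum => i; apply: AM. Qed.
Lemma seriesX : series_of A (ps_X F).
Proof. by move=> n; rewrite /ps_X; case: (n == 1%N) => //; apply: closed0. Qed.
Lemma series_exp f n : series_of A f -> series_of A (f ^+ n).
Proof.
move=> Af; elim: n => [|n IHn]; first exact: series1.
by rewrite exprS; apply: seriesM.
Qed.

(* The inverse is the geometric series [\sum_n h ^+ n]. *)
Lemma series_inv h : series_of A h -> h 0%N = 0 ->
  exists2 g, series_of A g & g * (1 - h) = 1.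
Proof.
move=> Ah h0; pose G N := \sum_(i < N) h ^+ i.
have hh : h = ps_X F * (fun n => h n.+1).
  apply/funext => n; rewrite {1}(ps_split h) h0 ps_addE /ps_const.
  by case: (n == 0%N); rewrite add0r.
have hlow n i : (i < n)%N -> (h ^+ n) i = 0.
  by rewrite hh exprMn; apply: ps_XnM_low.
(* The coefficient of index [n] in the partial sums is constant from [N = n + 1] on, because
   [h ^+ N] has no terms below degree [N]. *)
have GS N n : (n < N)%N -> G N n = G n.+1 n.
  elim: N => // N IHN; rewrite ltnS leq_eqVlt => /predU1P[->//|nN].
  by rewrite /G big_ord_recr /= ps_addE hlow // addr0 -/(G N) IHN.
pose g : pseries F := fun n => G n.+1 n.
exists g => [n|].
  by rewrite /g /G fct_sumE; apply: closed_sum => i; apply: series_exp.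
apply/funext => n.
have -> : (g * (1 - h)) n = (G n.+1 * (1 - h)) n.
  by rewrite !ps_mulE; apply: eq_bigr => i _; rewrite GS.
have -> : G n.+1 * (1 - h) = 1 - h ^+ n.+1.
  by rewrite mulrC -[in RHS](expr1n _ n.+1) subrXX; congr (_ * _);
     apply: eq_bigr => i _; rewrite expr1n mul1r.
by rewrite ps_subE hlow // subr0.
Qed.

End Closed.
End Series.

Lemma ord_digits (T : Type) (q : nat) (k : finType) (d : k -> T) (P : T -> T -> Prop)
    (S : set T) : #|k| = q -> (forall i, S (d i)) ->
  (forall b, S b -> exists i, P b (d i)) -> (forall i j, P (d i) (d j) -> i = j) ->
  exists d' : 'I_q -> T, [/\ forall i, S (d' i),
    forall b, S b -> exists i, P b (d' i) & forall i j, P (d' i) (d' j) -> i = j].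
Proof.
move=> kq dS d_ex d_uniq; pose e (i : 'I_q) := enum_val (cast_ord (esym kq) i).
exists (d \o e); split=> [i|b /d_ex [i Pi]|i j /d_uniq /enum_val_inj /cast_ord_inj //].
  exact: dS.
exists (cast_ord kq (enum_rank i)); rewrite /= /e.
by rewrite cast_ordK enum_rankK.
Qed.

(** A complete discrete valuation ring with uniformizer [u] and [q] residue classes, described
    without a valuation so that F_q[[u]] and rings of integers defined by integral equations fit
    alike. It serves for the residue field of F((t)), and for the coefficient field M, with [t] in
    place of [u], in the third case. *)
Record local_axioms (F : fieldType) (OF : set F) (u : F) (q : nat) : Prop := LocalAxioms {
  lf1 : OF 1;
  lfB : forall x y, OF x -> OF y -> OF (x - y);
  lfM : forall x y, OF x -> OF y -> OF (x * y);
  lfu0 : u != 0;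
  lfu : OF u;
  lf_absorb : forall x, exists k : nat, OF (u ^+ k * x);
  lf_digits : exists d : 'I_q -> F, [/\ forall i, OF (d i),
    forall b, OF b -> exists i, exists2 c, OF c & b - d i = u * c
    & forall i j, (exists2 c, OF c & d i - d j = u * c) -> i = j];
  lf_complete : forall x : nat -> F, (forall n, OF (x n)) ->
    (forall n, exists2 c, OF c & x n.+1 - x n = u ^+ n * c) ->
    exists2 y, OF y & forall n, exists2 c, OF c & y - x n = u ^+ n * c
}.

(** * The fields F((t)), and the local field F_q((u)) *)

Section Laurent.
Variables (F : fieldType) (OF : set F) (u : F) (q : nat).
Hypothesis aF : local_axioms OF u q.
Local Notation X := (laurent_data OF u).
Local Notation fr := (@tofrac (pseries F)).
Local Notation A := (series_of OF).

Lemma fr_inj : injective fr.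
Proof. by move=> f g /eqP; rewrite tofrac_eq => /eqP. Qed.

Lemma laurent_BE f : tdB (fr f : X) <-> A f.
Proof.
split=> [[n [g Ag]] |Af]; last by exists 0%N; exists f; rewrite ?expr0 ?mul1r.
rewrite -tofracXn -tofracM => /fr_inj gf m.
by rewrite -(ps_XnM f n m) -gf.
Qed.

(** Membership in [resW] is a condition modulo [t], and so concerns the constant coefficient only.
    It turns the axioms on residues into those of [local_axioms]. *)
Lemma laurent_resW (n : nat) f : resW X n%:Z (fr f) <->
  exists2 c, OF c & f 0%N = u ^+ n * c.
Proof.
have [A1 AB AM] : [/\ OF 1, forall x y, OF x -> OF y -> OF (x - y)
  & forall x y, OF x -> OF y -> OF (x * y)] by case: aF.
split=> [[b1 [ o1 [Bb [b _ bE] [ o _ <-]]]]|[c Oc f0]].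
  rewrite -bE in Bb *; move/laurent_BE: Bb => Ab.
  rewrite -exprnP -tofracXn -!tofracM -tofracD => /fr_inj ->.
  exists (b 0%N) => //; rewrite ps_addE -ps_const_exp ps_constM ps_XM0 addr0 //.
exists (fr (ps_const c)), (fr (fun n => f n.+1)); split.
- by apply/laurent_BE; apply: series_const.
- by exists (ps_const c).
- by exists (fun n => f n.+1).
rewrite -exprnP -tofracXn -!tofracM -tofracD; congr fr.
by rewrite -ps_const_exp -ps_constMc -f0; apply: ps_split.
Qed.

Lemma laurent_axioms : two_dim_axioms X q.
Proof.
have [A1 AB AM u0 Au abs [d [Od d_ex d_uniq]] compl] := aF.
have frB f g : fr f - fr g = fr (f - g) by rewrite tofracB.
have BP (x : X) : tdB x <-> exists n, (fr @` A) (fr (ps_X F) ^+ n * x) by [].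
have frA f : A f -> tdB (fr f : X) by move/laurent_BE.
have tX0 : fr (ps_X F) != 0 by rewrite tofrac_eq0; apply: ps_X_neq0.
have cu : ps_const u * ps_const u^-1 = 1 by rewrite -ps_constMc mulfV.
have frV : (fr (ps_const u))^-1 = fr (ps_const u^-1).
  have fu0 : fr (ps_const u) != 0.
    rewrite tofrac_eq0; apply/eqP => /(congr1 (@^~ 0%N)) /eqP.
    by rewrite /ps_const /= (negbTE u0).
  by apply: (mulfI fu0); rewrite mulfV // -tofracM cu tofrac1.
split.
- by exists 1; rewrite ?tofrac1.
- by move=> _ _ [f _ <-] [g _ <-]; exists (f - g); rewrite ?tofracB.
- by move=> _ _ [f _ <-] [g _ <-]; exists (f * g); rewrite ?tofracM.
- by rewrite -[1]tofrac1; apply: frA; apply: series1.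
- move=> x y [n [f Af fx]] [m [g Ag gy]]; exists (n + m)%N.
  exists (ps_X F ^+ m * f - ps_X F ^+ n * g).
    by apply: seriesB => //; apply: seriesM => //; apply: series_exp => //; apply: seriesX.
  by rewrite tofracB !tofracM !tofracXn fx gy exprD; ring.
- move=> x y [n [f Af fx]] [m [g Ag gy]]; exists (n + m)%N.
  exists (f * g); first exact: seriesM.
  by rewrite !tofracM fx gy exprD; ring.
- exact: tX0.
- by rewrite tofrac_eq0; apply/eqP => /(congr1 (@^~ 0%N)) /eqP; rewrite /ps_const /= (negbTE u0).
- by exists (ps_X F).
- move=> [f _ /(congr1 (fun x => fr (ps_X F) * x))].
  rewrite mulfV // -tofracM -[in RHS]tofrac1 => /fr_inj /(congr1 (@^~ 0%N)) /eqP.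
  by rewrite ps_XM0 ps_oneE eq_sym oner_eq0.
- by exists (ps_const u).
- by exists (ps_const u^-1) => //; rewrite frV.
- by apply: frA; apply: seriesX.
- by exists 1%N; exists 1; [exact: series1|rewrite expr1 mulfV // tofrac1].
- by apply: frA; apply: series_const.
- apply/seteqP; split=> [_ [f Of <-]|x].
    by apply/(laurent_resW 0); exists (f 0%N); rewrite ?expr0 ?mul1r.
  move=> [b [ o [Bb [f _ fb] [g _ <-] xE]]]; rewrite -fb in Bb xE.
  move: Bb => /laurent_BE Af; exists (f + ps_X F * g).
    by rewrite /= ps_addE ps_XM0 addr0.
  by rewrite xE expr0z mul1r tofracD tofracM.
- move=> _ [f _ <-]; have [k Ok] := abs (f 0%N); exists k.
  rewrite -[tdu X]/(fr (ps_const u)) -tofracXn -tofracM; apply/(laurent_resW 0).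
  by exists (u ^+ k * f 0%N) => //; rewrite expr0 mul1r ps_mul_coef0 -ps_const_exp.
- exists (fun i => fr (ps_const (d i))); split=> [i|b Bb [f _ fb]|i j].
  + by split; [apply: frA; apply: series_const|exists (ps_const (d i))].
  + rewrite -fb in Bb *; move: Bb => /laurent_BE Af.
    have [i [c Oc fc]] := d_ex (f 0%N) (Af 0%N); exists i.
    by rewrite -tofracB; apply/(laurent_resW 1); exists c => //; rewrite expr1.
  + rewrite -tofracB => /(laurent_resW 1) [c Oc]; rewrite expr1 => dd.
    by apply: d_uniq; exists c.
move=> x xBO xW.
have /choice [f fP] n : exists f, A f /\ x n = fr f.
  have [Bx [f _ fx]] := xBO n; rewrite -fx in Bx.
  by exists f; split=> //; apply/laurent_BE.
have [n|n|y Oy yx] := compl (fun n => f n 0%N).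
- by case: (fP n).
- have := xW n; rewrite (fP n).2 (fP n.+1).2 -tofracB => /laurent_resW [c Oc fc].
  by exists c.
exists (fr (ps_const y)) => n; rewrite (fP n).2 -tofracB; apply/laurent_resW.
by have [c Oc yc] := yx n; exists c.
Qed.
End Laurent.

Lemma frac_decomp (D : idomainType) (x : {fraction D}) :
  exists a b : D, b != 0 /\ x = tofrac a / tofrac b.
Proof.
elim/quotW: x => r; exists (frac r).1, (frac r).2; have dr := denom_ratioP r; split=> //.
have fd : tofrac (frac r).2 != 0 by rewrite tofrac_eq0.
apply: (mulIf fd); rewrite mulfVK //.
unlock tofrac; rewrite -[LHS]FracField.pi_mul.
apply/eqmodP; rewrite /= FracField.equivfE /FracField.mulf !numden_Ratio ?oner_eq0 ?mulf_neq0 //.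
- by rewrite !mulr1 mulrC.
- exact: oner_neq0.
- exact: oner_neq0.
Qed.

Lemma ps_low (F : idomainType) (f : pseries F) n : (forall i, (i < n)%N -> f i = 0) ->
  f = ps_X F ^+ n * (fun m => f (n + m)%N).
Proof.
move=> f0; apply/funext => i; case: (ltnP i n) => [lt_in|le_ni]; last first.
  by rewrite -{2}(subnKC le_ni) ps_XnM subnKC.
by rewrite f0 // ps_XnM_low.
Qed.

Lemma mulf_cancel (K : fieldType) (a x y : K) : x != 0 -> y != 0 ->
  a = y * (x * (a / (x * y))).
Proof. by move=> x0 y0; field; rewrite x0 y0. Qed.

Lemma laurent_local (k : finFieldType) (q : nat) : #|k| = q ->
  local_axioms (F := laurent k) (range (@tofrac (pseries k))) (tofrac (ps_X k)) q.
Proof.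
move=> kq; pose fr := @tofrac (pseries k).
have fr_inj : injective fr by move=> f g /eqP; rewrite tofrac_eq => /eqP.
have X0 : fr (ps_X k) != 0 by rewrite tofrac_eq0; apply: ps_X_neq0.
split.
- by exists 1; rewrite ?tofrac1.
- by move=> _ _ [f _ <-] [g _ <-]; exists (f - g); rewrite ?tofracB.
- by move=> _ _ [f _ <-] [g _ <-]; exists (f * g); rewrite ?tofracM.
- exact: X0.
- by exists (ps_X k).
- move=> x; have [a [b [b0 ->]]] := frac_decomp x.
  have exb : exists n, b n != 0.
    apply: contrapT => /forallNP nb; move/eqP: b0; apply; apply/funext => n.
    by apply/eqP; apply: contraT => /nb.
  (* The denominator is a power of the variable times a series [c] with nonzero constant term, which
     is inverted as a geometric series after normalisation. *)
  case: (ex_minnP exb) => n bn bmin.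
  have bE : b = ps_X k ^+ n * (fun m => b (n + m)%N).
    by apply: ps_low => i lt_in; apply/eqP; apply: contraTT lt_in => /bmin; rewrite -leqNgt.
  pose c : pseries k := fun m => b (n + m)%N; rewrite -/c in bE.
  have c0 : c 0%N != 0 by rewrite /c addn0.
  pose h : pseries k := 1 - ps_const (c 0%N)^-1 * c.
  have [|g _ gh] := @series_inv k setT I (fun _ _ _ _ => I) (fun _ _ _ _ => I) h (fun=> I).
    by rewrite /h ps_subE ps_oneE ps_constM mulVf // subrr.
  have cg : c * (ps_const (c 0%N)^-1 * g) = 1.
    by rewrite -gh /h opprB addrC subrK; ring.
  have c_neq0 : fr c != 0.
    by rewrite tofrac_eq0; apply: contraNneq c0 => ->.
  exists n; exists (a * (ps_const (c 0%N)^-1 * g)) => //.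
  apply: (mulfI c_neq0); rewrite -[LHS]tofracM mulrCA cg mulr1 bE tofracM tofracXn.
  rewrite -/fr -/c; have Xn0 : fr (ps_X k) ^+ n != 0 by rewrite expf_neq0.
  exact: mulf_cancel.
- apply: (ord_digits (k := k) (d := fun c => fr (ps_const c))
    (P := fun b d => exists2 c, range fr c & b - d = fr (ps_X k) * c)) => //.
  + by move=> _ [f _ <-]; exists (f 0%N); exists (fr (fun n => f n.+1));
      [exists (fun n => f n.+1)|rewrite -tofracB -tofracM {1}(ps_split f) addrC addKr].
  + move=> i j [_ [g _ <-]]; rewrite -tofracB -tofracM => /fr_inj /(congr1 (@^~ 0%N)).
    by rewrite ps_XM0 ps_subE /ps_const /= => /eqP; rewrite subr_eq0 => /eqP.
move=> x xO xS.
have /choice [f fP] n : exists f, x n = fr f by have [f _ <-] := xO n; exists f.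
have fS n i : (i < n)%N -> f n.+1 i = f n i.
  move=> lt_in; have [_ [c _ <-]] := xS n.
  rewrite !fP -tofracB -tofracXn -tofracM => /fr_inj /(congr1 (@^~ i)).
  by move=> e; apply/eqP; rewrite -subr_eq0 -ps_subE e ps_XnM_low.
(* Consecutive terms agree below degree [n], so the coefficient of degree [i] is final from index
   [i + 1] on. *)
pose y : pseries k := fun i => f i.+1 i.
have fy n i : (i < n)%N -> f n i = y i.
  elim: n => // n IHn; rewrite ltnS leq_eqVlt => /predU1P[->//|lt_in].
  by rewrite fS // IHn.
exists (fr y); first by exists y.
move=> n; exists (fr (fun m => (y - f n) (n + m)%N)); first by exists (fun m => (y - f n) (n + m)%N).
rewrite fP -tofracB -tofracXn -tofracM; congr tofrac.
by apply: ps_low => i lt_in; rewrite ps_subE fy // subrr.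
Qed.

(** * The integers of a p-adic field *)

Section Valuation.
Variables (K : fieldType) (v : K -> int).
Hypothesis dv : discrete_valuation v.
Implicit Types (x y : K) (m n : int).

Lemma dvalM x y : x != 0 -> y != 0 -> v (x * y) = v x + v y.
Proof. by case: dv => vM _ _; apply: vM. Qed.

Lemma dval1 : v 1 = 0.
Proof. by have : v 1 = v 1 + v 1; [rewrite -dvalM ?mulr1 ?oner_neq0|lia]. Qed.

Lemma dvalV x : x != 0 -> v x^-1 = - v x.
Proof.
by move=> x0; have := dvalM x0 (invr_neq0 x0); rewrite mulfV // dval1; lia.
Qed.

Lemma dvalX x (n : nat) : x != 0 -> v (x ^+ n) = n%:Z * v x.
Proof.
move=> x0; elim: n => [|n IHn]; first by rewrite expr0 dval1 mul0r.
by rewrite exprS dvalM ?expf_neq0 // IHn; lia.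
Qed.

Lemma dvalN x : x != 0 -> v (- x) = v x.
Proof.
have N0 : (-1 : K) != 0 by rewrite oppr_eq0 oner_eq0.
have vN1 : v (-1) = 0.
  by have := dvalM N0 N0; rewrite mulrNN mulr1 dval1; lia.
by move=> x0; rewrite -mulN1r dvalM // vN1 add0r.
Qed.

Lemma vball0 n : vball v n 0. Proof. by left. Qed.

Lemma vballP n x : vball v n x <-> (x != 0 -> n <= v x).
Proof.
split=> [[->|//]|]; first by rewrite eqxx.
by case: (eqVneq x 0) => [->|x0 /(_ isT)]; [left|right].
Qed.

Lemma vball_le m n x : m <= n -> vball v n x -> vball v m x.
Proof. by move=> mn /vballP nx; apply/vballP => /nx; lia. Qed.

Lemma vballN n x : vball v n x -> vball v n (- x).
Proof. by move=> /vballP nx; apply/vballP; rewrite oppr_eq0 => x0; rewrite dvalN ?nx. Qed.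

Lemma vballD n x y : vball v n x -> vball v n y -> vball v n (x + y).
Proof.
have [->|x0] := eqVneq x 0; first by rewrite add0r.
have [->|y0] := eqVneq y 0; first by rewrite addr0.
move=> /vballP/(_ x0) nx /vballP/(_ y0) ny; apply/vballP => xy0.
by case: dv => _ vD _; apply: le_trans (vD x y x0 y0 xy0); rewrite le_min nx ny.
Qed.

Lemma vballB n x y : vball v n x -> vball v n y -> vball v n (x - y).
Proof. by move=> nx /vballN; apply: vballD. Qed.

Lemma vballM m n x y : vball v m x -> vball v n y -> vball v (m + n) (x * y).
Proof.
have [->|x0] := eqVneq x 0; first by rewrite mul0r => _ _; apply: vball0.
have [->|y0] := eqVneq y 0; first by rewrite mulr0 => _ _; apply: vball0.
move=> /vballP/(_ x0) nx /vballP/(_ y0) ny; apply/vballP => _.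
by rewrite dvalM //; lia.
Qed.

Lemma vballM0 n x y : vball v 0 x -> vball v n y -> vball v n (x * y).
Proof. by move=> Ox /(vballM Ox); rewrite add0r. Qed.

Lemma vball01 : vball v 0 1.
Proof. by right; rewrite dval1. Qed.

Lemma vballX (n : nat) x : vball v 1 x -> vball v n%:Z (x ^+ n).
Proof.
move=> x1; elim: n => [|n IHn]; first exact: vball01.
by rewrite exprS (_ : n.+1%:Z = 1 + n%:Z); [apply: vballM|lia].
Qed.

Lemma vball_unif n z x : z != 0 -> v z = 1 -> vball v n x ->
  exists2 y, vball v 0 y & x = z ^ n * y.
Proof.
move=> z0 vz /vballP nx; have ze : z ^ n != 0 by rewrite expfz_neq0.
exists (z ^ (- n) * x); last by rewrite mulrA -expfzDr // subrr mul1r.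
apply/vballP; rewrite mulf_eq0 expfz_eq0 (negbTE z0) andbF /= => x0.
have vze m : v (z ^ m) = m.
  case: m => m; first by rewrite -exprnP dvalX // vz; lia.
  by rewrite NegzE -exprz_inv -exprnP dvalX ?invr_eq0 // dvalV // vz; lia.
by rewrite dvalM ?expfz_neq0 // vze; have := nx x0; lia.
Qed.

(** The proof that [v] is a valuation is an argument, so that the subring instance can recover this
    hypothesis from the predicate alone. *)
Definition val_ring_pred (_ : discrete_valuation v) : {pred K} :=
  fun x => `[< vball v 0 x >].

Lemma val_ring_subring : subring_closed (val_ring_pred dv).
Proof.
split=> [|x y /asboolP Ox /asboolP Oy|x y /asboolP Ox /asboolP Oy]; apply/asboolP.
- exact: vball01.
- exact: vballB.
- by have := vballM Ox Oy; rewrite addr0.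
Qed.

End Valuation.

HB.instance Definition _ (K : fieldType) (v : K -> int) (dv : discrete_valuation v) :=
  GRing.isSubringClosed.Build K (val_ring_pred dv) (val_ring_subring dv).

Record val_ring (K : fieldType) (v : K -> int) (dv : discrete_valuation v) :=
  ValRing { val_ring_val :> K; _ : val_ring_val \in val_ring_pred dv }.

HB.instance Definition _ (K : fieldType) (v : K -> int) (dv : discrete_valuation v) :=
  [isSub for @val_ring_val K v dv].
HB.instance Definition _ (K : fieldType) (v : K -> int) (dv : discrete_valuation v) :=
  [Choice of val_ring dv by <:].
HB.instance Definition _ (K : fieldType) (v : K -> int) (dv : discrete_valuation v) :=
  [SubChoice_isSubComNzRing of val_ring dv by <:].

Section Integers.
Variables (Q : fieldType) (v : Q -> int) (L : fieldExtType Q).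
Hypothesis dv : discrete_valuation v.
Local Notation OL := (integers v L).
Local Notation Zp := (val_ring dv).
Local Notation iota := (in_alg L \o (val : Zp -> Q)).

(** Passing to polynomials over the ring type [val_ring dv] makes the closure properties of integral
    elements available for [integers]. *)
Lemma integersP x : OL x <-> integralOver iota x.
Proof.
split=> [[P [monP PO rP]]|[P monP rP]].
  pose P' : {poly Zp} := \poly_(i < size P) insubd (0 : Zp) P`_i.
  have P'E : map_poly val P' = P.
    apply/polyP => i; rewrite coef_map coef_poly; case: ltnP => [_|/leq_sizeP -> //].
      by rewrite /= insubdK //; apply/asboolP.
  exists P'; last by rewrite map_poly_comp P'E.
  apply/eqP; apply: val_inj; have v0 : val (0 : Zp) = 0 by [].
  by rewrite /= -(lead_coef_map_inj val_inj v0 P') P'E; apply/eqP.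
exists (map_poly val P); split.
- by rewrite monic_map.
- by move=> i; rewrite coef_map /=; case: (P`_i) => a Pa; apply/asboolP.
- by rewrite -map_poly_comp.
Qed.

Lemma integers_B x y : OL x -> OL y -> OL (x - y).
Proof. by rewrite !integersP; apply: integral_sub. Qed.
Lemma integers_M x y : OL x -> OL y -> OL (x * y).
Proof. by rewrite !integersP; apply: integral_mul. Qed.
Lemma integers_1 : OL 1.
Proof. by apply/integersP; apply: integral1. Qed.
Lemma integers_alg a : vball v 0 a -> OL (a%:A).
Proof.
move=> Oa; have za : a \in val_ring_pred dv by apply/asboolP.
by apply/integersP; rewrite -[a%:A]/(iota (ValRing za)); apply: integral_id.
Qed.
End Integers.

Section Padic.
Variables (Q : fieldType) (v : Q -> int) (L : fieldExtType Q) (pi : L).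
Hypothesis dv : discrete_valuation v.
Hypothesis v_complete : forall s : nat -> Q,
  (forall n, exists N, forall i j, (N <= i)%N -> (N <= j)%N -> vball v n (s i - s j)) ->
  exists l, forall n, exists N, forall i, (N <= i)%N -> vball v n (s i - l).
Hypothesis pi0 : pi != 0.
Hypothesis maxE : max_ideal v L = [set pi * x | x in integers v L].
Local Notation OL := (integers v L).
Implicit Types (x y : L) (P : {poly Q}).

Let O1 : OL 1 := integers_1 L dv.
Let OB x y : OL x -> OL y -> OL (x - y) := @integers_B _ _ L dv x y.
Let OM x y : OL x -> OL y -> OL (x * y) := @integers_M _ _ L dv x y.
Let O0 : OL 0. Proof. by rewrite -(subrr 1); apply: OB. Qed.
Let ON x : OL x -> OL (- x).
Proof. by move=> Ox; rewrite -sub0r; apply: OB. Qed.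
Let OD x y : OL x -> OL y -> OL (x + y).
Proof. by move=> Ox /ON Oy; rewrite -[y]opprK; apply: OB. Qed.
Let OX x n : OL x -> OL (x ^+ n).
Proof. by move=> Ox; elim: n => [|n IHn]; rewrite ?expr0 // exprS; apply: OM. Qed.
Let Osum (I : Type) (s : seq I) (G : I -> L) : (forall i, OL (G i)) -> OL (\sum_(i <- s) G i).
Proof. by move=> OG; elim: s => [|i s IHs]; rewrite ?big_nil ?big_cons //; apply: OD. Qed.
Let Oalg a : vball v 0 a -> OL a%:A := @integers_alg _ _ L dv a.

Lemma pi_integral : OL pi.
Proof.
have : max_ideal v L pi by rewrite maxE; exists 1; rewrite ?mulr1.
by case.
Qed.

Lemma piV_integral : ~ OL pi^-1.
Proof.
have : max_ideal v L pi by rewrite maxE; exists 1; rewrite ?mulr1.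
by move=> [_ [/eqP|//]]; rewrite (negbTE pi0).
Qed.

Lemma integral_unitP y : OL y -> (exists2 c, OL c & y = pi * c) \/ OL y^-1.
Proof.
move=> Oy; have [OyV|nOyV] := pselect (OL y^-1); first by right.
have : max_ideal v L y by split=> //; right.
by rewrite maxE => -[c Oc <-]; left; exists c.
Qed.

(** If [a] had negative valuation, dividing the monic equation by the leading power of [a] would
    express 1 as a sum of elements of positive valuation. *)
Lemma val_ring_closed P a : P \is monic -> (forall i, vball v 0 P`_i) -> root P a ->
  vball v 0 a.
Proof.
move=> monP PO /eqP; rewrite horner_coef => rP; apply/vballP => a0.
rewrite leNgt; apply/negP => va.
have P0 : (0 < size P)%N by rewrite size_poly_gt0 monic_neq0.
have aV : vball v 1 a^-1 by right; rewrite (dvalV dv a0); lia.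
have sP : size P = (size P).-1.+1 by rewrite prednK.
rewrite sP big_ord_recr /= -[P`_(size P).-1]/(lead_coef P) (eqP monP) mul1r in rP.
have : vball v 1 1.
  have -> : 1 = - \sum_(i < (size P).-1) P`_i * a^-1 ^+ ((size P).-1 - i).
    have := congr1 ( *%R (a^-1 ^+ (size P).-1)) rP.
    rewrite mulr0 mulrDr -exprMn mulVf // expr1n addrC => /eqP.
    rewrite addr_eq0 => /eqP ->; congr (- _); rewrite big_distrr /=.
    apply: eq_bigr => i _; rewrite mulrCA; congr (_ * _).
    rewrite -{1}(subnK (ltnW (ltn_ord i))) exprD -mulrA -exprMn mulVf //.
    by rewrite expr1n mulr1.
  apply: (vballN dv); elim/big_ind: _ => [|x y|i _].
  - exact: vball0.
  - exact: (vballD dv).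
  - have -> : (1 : int) = 0 + 1 by [].
    apply: (vballM dv) => //; apply: (vball_le (n := ((size P).-1 - i)%N%:Z)).
      by have := ltn_ord i; lia.
    exact: (vballX dv).
by move/vballP => /(_ (oner_neq0 _)); rewrite (dval1 dv).
Qed.

Section Uniformizer.
Variable w : Q.
Hypothesis w0 : w != 0.
Hypothesis vw : v w = 1.
Local Notation wA := (w%:A : L).

Lemma w_ball : vball v 1 w. Proof. by right; rewrite vw. Qed.
Lemma w_integral : OL wA.
Proof. by apply: Oalg; apply: vball_le w_ball. Qed.

Lemma wV_integral : ~ OL wA^-1.
Proof.
have -> : wA^-1 = in_alg L w^-1 by rewrite fmorphV.
move=> [P [monP PO]]; rewrite fmorph_root => /(val_ring_closed monP PO) /vballP.
by rewrite invr_eq0 w0 (dvalV dv w0) vw => /(_ isT).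
Qed.

Lemma w_pi : exists2 c, OL c & wA = pi * c.
Proof. by case: (integral_unitP w_integral) => // /wV_integral. Qed.

Lemma horner_integral (P : {poly L}) x : (forall i, OL P`_i) -> OL x -> OL P.[x].
Proof.
by move=> PO Ox; rewrite horner_coef; apply: Osum => i; apply: OM => //; apply: OX.
Qed.

(* Cut the integral equation of [pi] at its first unit coefficient. *)
Lemma pi_power_w : exists e : nat, [/\ (0 < e)%N & exists2 c, OL c & pi ^+ e = wA * c].
Proof.
have [P [monP PO rP]] := pi_integral.
have Pun : exists i, ~~ `[< vball v 1 P`_i >].
  exists (size P).-1; apply/asboolP; rewrite -[P`_ _]/(lead_coef P) (eqP monP).
  by move/vballP => /(_ (oner_neq0 _)); rewrite (dval1 dv).
case: (ex_minnP Pun) => m /asboolP nPm mmin.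
have Pm0 : P`_m != 0 by apply/eqP => Pm; apply: nPm; rewrite Pm; apply: vball0.
pose PL := map_poly (in_alg L) P.
have PLi i : PL`_i = (P`_i)%:A by rewrite coef_map.
pose P1 := take_poly m PL; pose P2 := drop_poly m PL.
have PE : P1.[pi] + P2.[pi] * pi ^+ m = 0.
  by rewrite -[in RHS](eqP rP) -/PL -(poly_take_drop m PL) hornerD hornerM hornerXn.
have [c1 Oc1 P1E] : exists2 c, OL c & P1.[pi] = wA * c.
  rewrite horner_coef; elim/big_ind: _ => [|x y [c Oc ->] [c' Oc' ->]|i _].
  - by exists 0; rewrite ?mulr0.
  - by exists (c + c'); [apply: OD|rewrite mulrDr].
  rewrite coef_take_poly; case: ltnP => im; last by exists 0; rewrite ?mul0r ?mulr0.
  have Pi1 : vball v 1 P`_i.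
    apply: contrapT => nP; have /mmin : ~~ `[< vball v 1 P`_i >] by apply/asboolP.
    by rewrite leqNgt im.
  have [a Oa Pia] := vball_unif dv w0 vw Pi1.
  exists (a%:A * pi ^+ i); first by apply: OM; [exact: Oalg|apply: OX; apply: pi_integral].
  by rewrite PLi Pia expr1z mulrA -!in_algE -rmorphM.
have P2O i : OL P2`_i by rewrite coef_drop_poly PLi; apply: Oalg.
have OP2 : OL P2.[pi] by apply: horner_integral; [exact: P2O|exact: pi_integral].
(* The value of [P2] at [pi] is congruent to [P_m] modulo [pi]. Since [P_m] is a unit, divisibility
   by [pi] would make the inverse of [pi] integral. *)
have nP2 c : OL c -> P2.[pi] <> pi * c.
  move=> Oc P2c.
  have [d Od P2d] : exists2 d, OL d & P2.[pi] = (P`_m)%:A + pi * d.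
    exists (drop_poly 1 P2).[pi].
      by apply: horner_integral; [move=> i; rewrite coef_drop_poly|exact: pi_integral].
    rewrite -{1}(poly_take_drop 1 P2) hornerD hornerM hornerXn expr1 mulrC; congr (_ + _).
    rewrite [take_poly 1 P2](_ : _ = ((P`_m)%:A)%:P) ?hornerC //.
    apply/polyP => -[|i]; rewrite coef_take_poly coefC //=.
    by rewrite coef_drop_poly add0n PLi.
  case: piV_integral.
  have PmV : vball v 0 (P`_m)^-1.
    apply/vballP => _; rewrite (dvalV dv Pm0).
    have := PO m => /vballP /(_ Pm0); move: nPm => /vballP; lia.
  have -> : pi^-1 = (c - d) * ((P`_m)^-1)%:A.
    apply: (mulfI pi0); rewrite mulfV // mulrA mulrBr -P2c P2d addrK.
    by rewrite -!in_algE -rmorphM mulfV // rmorph1.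
  by apply: OM; [exact: OB|exact: Oalg].
have OP2V : OL (P2.[pi])^-1 by case: (integral_unitP OP2) => // -[c /nP2].
have P2n0 : P2.[pi] != 0 by apply/eqP => P20; apply: (nP2 0 O0); rewrite mulr0.
(* One factor [pi] more than the equation provides, which makes the exponent visibly positive. *)
exists m.+1; split=> //; exists (- c1 / P2.[pi] * pi).
  by apply: OM; [apply: OM => //; exact: ON|exact: pi_integral].
rewrite exprSr !mulrA; congr (_ * _); apply: (mulIf P2n0).
rewrite mulfVK //; apply/eqP; rewrite mulrN -P1E -addr_eq0 addrC mulrC.
by rewrite mulrC [pi ^+ m * _]mulrC PE.
Qed.

Lemma wA_exp (n : nat) : wA ^+ n = (w ^+ n)%:A.
Proof. by rewrite -!in_algE rmorphXn. Qed.

Lemma pi_w_pow (n : nat) : exists e : nat, exists2 c, OL c & pi ^+ e = wA ^+ n * c.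
Proof.
have [e [_ [c Oc ec]]] := pi_power_w; exists (e * n)%N, (c ^+ n); first exact: OX.
by rewrite exprM ec exprMn.
Qed.

(** Clearing the denominators of the minimal polynomial shows that [w ^+ m * x] is integral for
    large [m], and some power of [pi] is divisible by [w ^+ m]. *)
Lemma integral_absorb x : exists n : nat, OL (pi ^+ n * x).
Proof.
have /polyOver1P [P PE] := minPolyOver 1%AS x.
have monP : P \is monic by rewrite -(map_monic (in_alg L)) -PE monic_minPoly.
have rP : root (map_poly (in_alg L) P) x by rewrite -PE root_minPoly.
have P0 : (0 < size P)%N by rewrite size_poly_gt0 monic_neq0.
pose d := (size P).-1; have sP : size P = d.+1 by rewrite prednK.
pose m := (\sum_(i < size P) `|v P`_i|)%N.
have Pm i : vball v (- m%:Z) P`_i.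
  apply/vballP => Pi0; have [sPi|/leq_sizeP Pi] := ltnP i (size P); last first.
    by rewrite Pi ?eqxx in Pi0.
  have : (`|v P`_i| <= m)%N by rewrite /m (bigD1 (Ordinal sPi)) //= leq_addr.
  by clear; lia.
(* A monic equation for [w ^+ m * x]: for i < d the factor [w ^+ (m * (d - i))] clears the
   coefficient, whose valuation is at least [- m]. *)
pose P1 := \poly_(i < d.+1) (P`_i * w ^+ (m * (d - i))).
have P1d : P1`_d = 1.
  rewrite coef_poly leqnn subnn muln0 expr0 mulr1.
  by rewrite -[P`_d]/(lead_coef P); apply/eqP.
have sP1 : size P1 = d.+1.
  by apply: size_poly_eq; rewrite -[w ^+ _ in X in X != 0]/(w ^+ _);
     move: P1d; rewrite coef_poly leqnn => ->; apply: oner_neq0.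
have Oy : OL (wA ^+ m * x).
  exists P1; split.
  - by apply/eqP; rewrite /lead_coef sP1.
  - move=> i; rewrite coef_poly; case: ltnP => // [id|_]; last exact: vball0.
    have [->|di] := eqVneq i d.
      rewrite subnn muln0 expr0 mulr1 -[P`_d]/(lead_coef P) (eqP monP).
      exact: vball01.
    have -> : (0 : int) = - m%:Z + m%:Z by rewrite addNr.
    apply: (vballM dv) => //; apply: (vball_le (n := (m * (d - i))%N%:Z)).
      by have : (m * 1 <= m * (d - i))%N; [rewrite leq_mul2l; lia|lia].
    exact/(vballX dv)/w_ball.
  - apply/eqP; rewrite (@horner_coef_wide _ d.+1); last by rewrite size_map_poly sP1.
    rewrite (eq_bigr (fun i : 'I_d.+1 => wA ^+ (m * d) * ((P`_i)%:A * x ^+ i))) => [|i _].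
      rewrite -big_distrr /= (_ : \sum_(i < d.+1) _ = 0) ?mulr0 //.
      rewrite -[RHS](eqP rP) horner_coef size_map_poly sP.
      by apply: eq_bigr => i _; rewrite coef_map.
    have -> : wA ^+ (m * d) = wA ^+ (m * (d - i)) * (wA ^+ m) ^+ i.
      by rewrite -exprM -exprD -mulnDr subnK // -ltnS; exact: ltn_ord.
    rewrite coef_map coef_poly ltn_ord /= -in_algE rmorphM rmorphXn /= exprMn.
    ring.
have [e [c Oc ec]] := pi_w_pow m; exists e.
by rewrite ec -mulrA (mulrC c) mulrA; apply: OM.
Qed.

Section Complete.
Variables (q : nat) (d : 'I_q -> L).
Hypothesis Od : forall i, OL (d i).
Hypothesis d_ex : forall b, OL b -> exists i, exists2 c, OL c & b - d i = pi * c.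

Lemma digit_reps (e : nat) : exists (I : finType) (Y : I -> L), (forall i, OL (Y i)) /\
  forall b, OL b -> exists i, exists2 c, OL c & b - Y i = pi ^+ e * c.
Proof.
elim: e => [|e [I [Y [OY Y_ex]]]].
  exists unit, (fun=> 0); split=> // b Ob; exists tt, b => //.
  by rewrite subr0 expr0 mul1r.
exists (I * 'I_q)%type, (fun a => Y a.1 + pi ^+ e * d a.2); split=> [a|b Ob].
  by apply: OD => //; apply: OM => //; apply/OX/pi_integral.
have [i [c Oc bc]] := Y_ex b Ob; have [j [c' Oc' cc]] := d_ex Oc.
exists (i, j), c' => //=.
by rewrite opprD addrA bc -mulrBr cc exprSr mulrA.
Qed.

(** Completeness of Q is transferred to L. Modulo [w] there are finitely many representatives [Y i],
    so an integral element expands in powers of [w] with coefficients among them; grouping by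
    representative leaves finitely many series over Q, which converge there. *)
Lemma integral_complete (x : nat -> L) : (forall n, OL (x n)) ->
  (forall n, exists2 c, OL c & x n.+1 - x n = pi ^+ n * c) ->
  exists2 y, OL y & forall n, exists2 c, OL c & y - x n = pi ^+ n * c.
Proof.
move=> Ox xS; have [e [e0 [c0 Oc0 ec0]]] := pi_power_w.
have [I [Y [OY Y_ex0]]] := digit_reps e.
have Y_ex b : exists ic : I * L, OL b -> OL ic.2 /\ b = Y ic.1 + wA * ic.2.
  have [Ob|nOb] := pselect (OL b); last first.
    by have [i _] := Y_ex0 0 O0; exists (i, 0).
  have [i [c Oc bc]] := Y_ex0 b Ob; exists (i, c0 * c) => _.
  by split; [exact: OM|rewrite mulrA -ec0 -bc addrC subrK].
have {Y_ex} /choice [sel selP] := Y_ex.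
have x_diff n m : exists2 c, OL c & x (n + m)%N - x n = pi ^+ n * c.
  elim: m => [|m [c Oc IHm]]; first by exists 0; rewrite // addn0 subrr mulr0.
  have [c' Oc' xc'] := xS (n + m)%N; exists (c + pi ^+ m * c').
    by apply: OD => //; apply: OM => //; apply/OX/pi_integral.
  by rewrite addnS -(subrK (x (n + m)%N) (x _.+1)) xc' -addrA IHm mulrDr addrC exprD mulrA.
(* The subsequence of step [e] is Cauchy for powers of [w], because [pi ^+ e] is divisible by
   [w]. *)
pose z n := x (e * n)%N.
have /choice [b bP] n : exists b, OL b /\ z n.+1 = z n + wA ^+ n * b.
  have [c Oc xc] := x_diff (e * n)%N e; exists (c0 ^+ n * c).
  split; first by apply: OM => //; apply: OX.
  by rewrite /z mulnS addnC mulrA -exprMn -ec0 -exprM -xc addrC subrK.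
(* [r n] is the remainder after [n] digits: its sum with the increment [b n] is split into the next
   digit [Y (s n)] and [w] times the next remainder. *)
pose r := fix r n := if n is n'.+1 then (sel (r n' + b n')).2 else z 0%N.
pose s n := (sel (r n + b n)).1.
have Or n : OL (r n).
  elim: n => [|n IHn]; first exact: Ox.
  by have [] := selP _ (OD IHn (bP n).1).
have rS n : r n + b n = Y (s n) + wA * r n.+1.
  by have [_ {1}->] := selP _ (OD (Or n) (bP n).1).
have zE n : z n = \sum_(m < n) wA ^+ m * Y (s m) + wA ^+ n * r n.
  elim: n => [|n IHn]; first by rewrite big_ord0 add0r expr0 mul1r.
  rewrite (bP n).2 IHn -addrA -mulrDr rS mulrDr addrA exprSr -mulrA.
  by rewrite big_ord_recr.
(* The partial sums of the series in [w] collecting the positions at which the digit is [Y i]. *)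
pose S i n : Q := \sum_(m < n) (if s m == i then w ^+ m else 0).
have Sdiff i n m : vball v n%:Z (S i (n + m)%N - S i n).
  elim: m => [|m IHm]; first by rewrite addn0 subrr; apply: vball0.
  rewrite addnS /S big_ord_recr /= addrAC; apply: (vballD dv) => //.
  case: ifP => _; last exact: vball0.
  by apply: (vball_le (n := (n + m)%N%:Z)); [lia|exact/(vballX dv)/w_ball].
have /choice [c cP] i : exists c, forall n : nat, vball v n%:Z (c - S i n).
  have [n|l lP] := v_complete (s := S i).
    exists `|n|%N => j k nj nk; rewrite -(subrK (S i `|n|%N) (S i j)) -addrA.
    apply: (vball_le (n := `|n|%N%:Z)); first by lia.
    apply: (vballD dv); first by rewrite -(subnKC nj).
    by rewrite -opprB; apply: (vballN dv); rewrite -(subnKC nk).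
  exists l => n; have [N NP] := lP n.
  rewrite -(subrK (S i (n + N)%N) l) -addrA; apply: (vballD dv) => //.
  by rewrite -opprB; apply: (vballN dv); apply: NP; rewrite leq_addl.
pose y := \sum_i c i *: Y i.
have sumE n : \sum_(m < n) wA ^+ m * Y (s m) = \sum_i S i n *: Y i.
  under [RHS]eq_bigr do rewrite /S scaler_suml; rewrite exchange_big /=.
  apply: eq_bigr => m _; rewrite (bigD1 (s m)) //= eqxx big1 ?addr0.
    by rewrite wA_exp mulr_algl.
  by move=> i; rewrite eq_sym => /negbTE ->; rewrite scale0r.
have cS n i : exists2 a, OL a & (c i - S i n) *: Y i = wA ^+ n * a.
  have [a Oa ->] := vball_unif dv w0 vw (cP i n); exists (a *: Y i).
    by rewrite -mulr_algl; apply: OM => //; apply: Oalg.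
  by rewrite -scalerA wA_exp mulr_algl.
have yz n : exists2 a, OL a & y - z n = wA ^+ n * a.
  have /choice [a aP] : forall i, exists a, OL a /\ (c i - S i n) *: Y i = wA ^+ n * a.
    by move=> i; have [a Oa ea] := cS n i; exists a.
  exists (\sum_i a i - r n); first by apply: OB => //; apply: Osum => i; case: (aP i).
  rewrite mulrBr zE sumE opprD addrA /y -sumrB big_distrr /=; congr (_ - _).
  by apply: eq_bigr => i _; rewrite -scalerBl; case: (aP i).
have [a0 Oa0 ya0] := yz 0%N.
exists y => [|n]; first by rewrite -(subrK (z 0%N) y) ya0 expr0 mul1r; apply: OD => //; apply: Ox.
have [a Oa ya] := yz n; have [c' Oc' xc'] := x_diff n (e * n - n)%N.
(* Divisibility by [w ^+ n] is turned back into divisibility by [pi ^+ n]. *)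
have [b' Ob' wb'] := w_pi.
exists (b' ^+ n * a + c'); first by apply: OD => //; apply: OM => //; apply: OX.
rewrite mulrDr -xc' subnKC ?leq_pmull // -/(z n) mulrA -exprMn -wb' -ya.
by rewrite addrA subrK.
Qed.
End Complete.

End Uniformizer.
End Padic.

Lemma padic_local (p : nat) (k : finFieldType) (Q : fieldType) (j : {rmorphism rat -> Q})
    (v : Q -> int) (L : fieldExtType Q) (pi : L) (q : nat) :
  #|k| = q -> padic_extension p k j v pi -> local_axioms (integers v L) pi q.
Proof.
move=> kq [[ [dv _ compl] _] [rho [rho1 rhoD rhoM rho_surj rho_max]] pi0 maxE].
have [_ _ [w w0 vw]] := dv.
have Opi := pi_integral dv maxE.
have rhoB x y : integers v L x -> integers v L y -> rho (x - y) = rho x - rho y.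
  move=> Ox Oy; have Oxy := integers_B dv Ox Oy.
  by apply: (addIr (rho y)); rewrite -rhoD ?subrK.
have dig : exists d : 'I_q -> L, [/\ forall i, integers v L (d i),
    forall b, integers v L b -> exists i, exists2 c, integers v L c & b - d i = pi * c
    & forall i j, (exists2 c, integers v L c & d i - d j = pi * c) -> i = j].
  have /choice [d dP] a : exists x, integers v L x /\ rho x = a.
    by have [x Ox <-] := rho_surj a; exists x.
  apply: (ord_digits (k := k) (d := d)
    (P := fun b b' => exists2 c, integers v L c & b - b' = pi * c)) => //.
  - by move=> a; case: (dP a).
  - move=> b Ob; exists (rho b); have [Od rd] := dP (rho b).
    have : max_ideal v L (b - d (rho b)).
      by apply/rho_max; [exact: (integers_B dv)|rewrite rhoB // rd subrr].
    by rewrite maxE => -[c Oc <-]; exists c.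
  - move=> a a' [c Oc dc]; have [[Oa ra] [Oa' ra']] := (dP a, dP a').
    apply/eqP; rewrite -ra -ra' -subr_eq0 -rhoB //; apply/eqP/rho_max.
      exact: (integers_B dv).
    by rewrite maxE dc; exists c.
split=> //.
- exact: integers_1.
- by move=> x y; apply: integers_B.
- by move=> x y; apply: integers_M.
- exact: (integral_absorb dv pi0 maxE w0 vw).
have [d [Od d_ex _]] := dig.
exact: (integral_complete dv compl pi0 maxE w0 vw Od d_ex).
Qed.

(** * The field [M{{u}}] *)

Section Curly.
Variables (Q : fieldType) (v : Q -> int) (M : fieldExtType Q).
Variables (K : fieldType) (iota : pseries M -> K) (w : K -> int) (t : M) (q : nat).
Local Notation OM := (integers v M).
Local Notation A := (series_of OM).
Hypothesis aM : local_axioms OM t q.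
Hypothesis maxE : max_ideal v M = [set t * x | x in OM].
Hypothesis cK : is_curly v iota w.
Implicit Types (f g h : pseries M) (x y z : K).

Let OM1 : OM 1 := lf1 aM.
Let OMB := @lfB _ _ _ _ aM.
Let OMM := @lfM _ _ _ _ aM.
Let t0 : t != 0 := lfu0 aM.
Let OMt : OM t := lfu aM.
Let OM0 : OM 0. Proof. by rewrite -(subrr 1); apply: OMB. Qed.
Let dw : discrete_valuation w. Proof. by case: cK => _ _ _ _ []. Qed.

Local Notation ct := (ps_const t).
Local Notation T := (iota ct).
Local Notation U := (iota (ps_X M)).

Let AB f g : A f -> A g -> A (f - g). Proof. exact: (seriesB OMB). Qed.
Let AM f g : A f -> A g -> A (f * g). Proof. exact: (seriesM OM1 OMB OMM). Qed.
Let A1 : A 1. Proof. exact: series1. Qed.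
Let A0 : A 0. Proof. by rewrite -(subrr 1); apply: AB. Qed.
Let AX : A (ps_X M). Proof. exact: (seriesX OM1 OMB). Qed.
Let Aexp f n : A f -> A (f ^+ n). Proof. exact: series_exp. Qed.
Let Ac c : OM c -> A (ps_const c). Proof. exact: (series_const OM1 OMB). Qed.
Let At : A ct. Proof. exact: Ac. Qed.

Lemma iota1 : iota 1 = 1. Proof. by case: cK. Qed.
Lemma iotaD f g : A f -> A g -> iota (f + g) = iota f + iota g.
Proof. by case: cK => _ + _ _ _; apply. Qed.
Lemma iotaM f g : A f -> A g -> iota (f * g) = iota f * iota g.
Proof. by case: cK => _ _ + _ _; apply. Qed.
Lemma iota0 : iota 0 = 0.
Proof. by apply: (addIr (iota 0)); rewrite -iotaD // !add0r. Qed.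
Lemma iotaB f g : A f -> A g -> iota (f - g) = iota f - iota g.
Proof.
move=> Af Ag; have Afg := AB Af Ag.
by apply: (addIr (iota g)); rewrite -iotaD ?subrK.
Qed.
Lemma iotaX f n : A f -> iota (f ^+ n) = iota f ^+ n.
Proof.
move=> Af; elim: n => [|n IHn]; first by rewrite !expr0 iota1.
by rewrite !exprS iotaM ?IHn //; apply: Aexp.
Qed.
Lemma iota_neq0 f : A f -> f != 0 -> iota f != 0.
Proof. by case: cK => _ _ _ + _ Af f0; case/(_ f Af f0). Qed.
Lemma iota_ball f : A f -> vball w 0 (iota f).
Proof.
have [->|f0 Af] := eqVneq f 0; first by rewrite iota0; left.
by right; case: cK => _ _ _ + _; case/(_ f Af f0).
Qed.

Lemma iota_ball1 f : A f ->
  vball w 1 (iota f) <-> forall n, exists2 c, OM c & f n = t * c.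
Proof.
move=> Af; have [->|f0] := eqVneq f 0.
  by rewrite iota0; split=> _; [exists 0; rewrite ?mulr0|left].
have maxP : series_of (max_ideal v M) f <-> forall n, exists2 c, OM c & f n = t * c.
  by split=> fm n; have := fm n; rewrite maxE => -[c Oc]; [move<-|move->]; exists c.
have [if0 _ if1] : [/\ iota f != 0, 0 <= w (iota f) &
  0 < w (iota f) <-> series_of (max_ideal v M) f].
  by case: cK => _ _ _ + _; apply.
rewrite -maxP -if1; split=> [/vballP/(_ if0) //|]; by right.
Qed.

Lemma divides_t f : A f -> vball w 1 (iota f) -> exists2 g, A g & f = ct * g.
Proof.
move=> Af /(iota_ball1 Af) fm; have /choice [g gP] n : exists c, OM c /\ f n = t * c.
  by have [c] := fm n; exists c.
exists g => [n|]; first by case: (gP n).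
by apply/funext => n; rewrite ps_constM; case: (gP n).
Qed.

Lemma T0 : T != 0.
Proof.
apply: iota_neq0 => //; apply/eqP => /(congr1 (@^~ 0%N)) /eqP.
by rewrite /ps_const /= (negbTE t0).
Qed.

Lemma T_ball1 : vball w 1 T.
Proof.
apply/iota_ball1 => // n; exists (n == 0%N)%:R; last first.
  by rewrite /ps_const; case: (n == 0%N); rewrite ?mulr1 ?mulr0.
by case: (n == 0%N).
Qed.

(** Each factor [t] taken out lowers the valuation of the image by [w T >= 1], so the division
    stops, and it stops only at valuation 0. *)
Lemma primitive_part f : A f -> f != 0 ->
  exists n g, [/\ A g, f = ct ^+ n * g & w (iota g) = 0].
Proof.
have /vballP/(_ T0) wT := T_ball1.
have [m] := ubnP `|w (iota f)|%N; elim: m f => // m IHm f mf Af f0.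
have fi0 := iota_neq0 Af f0.
have /vballP/(_ fi0) wf := iota_ball Af.
have [wf0|wf1] : w (iota f) = 0 \/ 1 <= w (iota f) by lia.
  by exists 0%N, f; rewrite expr0 mul1r.
have [|g Ag fg] := divides_t Af; first by right.
have g0 : g != 0 by apply: contraNneq f0 => g0; rewrite fg g0 mulr0.
have wfg : w (iota f) = w T + w (iota g).
  by rewrite fg iotaM // (dvalM dw) ?T0 ?iota_neq0.
have /vballP/(_ (iota_neq0 Ag g0)) wg := iota_ball Ag.
have [|//|//|n [h [Ah gh wh]]] := IHm g; first by lia.
by exists n.+1, h; rewrite exprS -mulrA -gh.
Qed.

(** The valuation is only known to be normalised on some element. Density replaces that element by a
    fraction of series of valuation 1; splitting off powers of [t] shows that its valuation is an
    integer multiple of [w T], which must then be 1. *)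
Lemma wT : w T = 1.
Proof.
have /vballP/(_ T0) wT := T_ball1.
have [_ _ [z z0 wz]] := dw.
have [y [f [g [Af Ag g0 yE]]] zy] : exists2 y, (exists f g,
    [/\ A f, A g, g != 0 & y = iota f / iota g]) & vball w 2 (z - y).
  by case: cK => _ _ _ _ [_ + _]; apply.
have gi0 := iota_neq0 Ag g0.
have y0 : y != 0.
  by apply/eqP => y0; move: zy; rewrite y0 subr0 => /vballP/(_ z0); rewrite wz.
have wy1 : 1 <= w y.
  have /vballP : vball w 1 (z - (z - y)).
    by apply: (vballB dw); [right; rewrite wz|apply: vball_le zy].
  by rewrite subKr; apply.
have wy : w y = 1.
  have [//|wy2] : w y = 1 \/ 2 <= w y by lia.
  have /vballP/(_ z0) : vball w 2 z.
    by rewrite -(subrK y z); apply: (vballD dw) zy _; right.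
  by rewrite wz.
have f0 : f != 0 by apply: contraNneq y0 => f0; rewrite yE f0 iota0 mul0r.
have [n [f' [Af' fE wf]]] := primitive_part Af f0.
have [m [g' [Ag' gE wg]]] := primitive_part Ag g0.
have f'0 : f' != 0 by apply: contraNneq f0 => f'0; rewrite fE f'0 mulr0.
have g'0 : g' != 0 by apply: contraNneq g0 => g'0; rewrite gE g'0 mulr0.
have wE l h : A h -> h != 0 -> w (iota h) = 0 -> w (iota (ct ^+ l * h)) = l%:Z * w T.
  move=> Ah h0 wh; rewrite iotaM ?iotaX //; last exact: Aexp.
  by rewrite (dvalM dw) ?expf_neq0 ?T0 ?iota_neq0 // (dvalX dw) ?T0 // wh addr0.
move: wy; rewrite yE (dvalM dw) ?invr_eq0 ?iota_neq0 // (dvalV dw) ?iota_neq0 //.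
rewrite fE gE !wE // -mulrBl; move: (n%:Z - m%:Z) (w T) wT => a b b1 ab.
have [a0|a1] : a <= 0 \/ 1 <= a by lia.
  by nia.
by nia.
Qed.

Lemma ball1T x : vball w 0 x -> vball w 1 (T * x).
Proof. by move=> Ox; rewrite mulrC; apply: (vballM0 dw) Ox T_ball1. Qed.

Lemma ball1P x : vball w 1 x <-> exists2 y, vball w 0 y & x = T * y.
Proof.
split=> [/(vball_unif dw T0 wT)|[y Oy ->]]; last exact: ball1T.
by rewrite expr1z.
Qed.

Local Notation X := (curly_data v iota w t).

(** For n large [t ^+ n / b] is integral in M, so every denominator from M may be taken to be a
    power of [t]. *)
Lemma curly_BP x : @tdB X x <-> exists n g, A g /\ T ^+ n * x = iota g.
Proof.
split=> [[a [b [f [Oa Ob b0 Af ->]]]]|[n [g [Ag gx]]]]; last first.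
  exists 1, (t ^+ n), g; split=> //.
  - by elim: n {gx} => [//|n IHn]; rewrite exprS; apply: OMM.
  - by rewrite expf_neq0.
  - rewrite -/(1 : pseries M) iota1 ps_const_exp iotaX // -gx mul1r mulKf //.
    by rewrite expf_neq0 ?T0.
have [n On] := lf_absorb aM b^-1.
exists n, (ps_const a * ps_const (t ^+ n * b^-1) * f); split.
  by apply: (AM (AM (Ac _) (Ac _))).
have b1 : ps_const b * ps_const (t ^+ n * b^-1) = ct ^+ n.
  by rewrite -ps_constMc mulrCA mulfV // mulr1 ps_const_exp.
have bi0 : iota (ps_const b) != 0.
  apply: iota_neq0; first exact: Ac.
  by apply/eqP => /(congr1 (@^~ 0%N)) /eqP; rewrite /ps_const /= (negbTE b0).
rewrite -iotaX // -b1 !iotaM //; try by [apply: Ac|apply: AM; apply: Ac].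
by field.
Qed.

(** If [T ^+ n * x] comes from a series, [x] lies in O and n > 0, then that series has positive
    valuation, hence is divisible by [t], and [n] can be lowered. *)
Lemma curly_BO x : @tdB X x -> @tdO X x -> exists2 g, A g & x = iota g.
Proof.
move=> /curly_BP [n [g [Ag gx]]] Ox; elim: n g Ag gx => [|n IHn] g Ag.
  by rewrite mul1r; exists g.
move=> gx; have [|h Ah gh] := divides_t Ag.
  rewrite -gx exprS -mulrA; apply: ball1T.
  rewrite -iotaX //; exact: (vballM0 dw) (iota_ball (Aexp n At)) Ox.
apply: (IHn h Ah); apply: (mulfI T0).
by rewrite mulrA -exprS gx gh iotaM.
Qed.

Lemma curly_iotaB f : A f -> @tdB X (iota f).
Proof. by move=> Af; apply/curly_BP; exists 0%N, f; rewrite mul1r. Qed.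

Lemma curly_resW (n : nat) x : resW X n%:Z x <->
  exists2 g, A g & vball w 1 (x - U ^+ n * iota g).
Proof.
split=> [[b [ o [Bb Ob Oo ->]]]|[g Ag /ball1P [ o Oo xE]]].
  have [g Ag ->] := curly_BO Bb Ob; exists g => //.
  by rewrite addrC addKr; apply/ball1P; exists o.
exists (iota g), o; split=> //; first exact: curly_iotaB.
  exact: iota_ball.
by rewrite -[_ ^ _]/(U ^+ n) -[tdt X * o]xE addrC subrK.
Qed.

(** Modulo [t] a series belongs to level [n] when its reduction is divisible by the n-th power of
    the variable. *)
Lemma curly_resW_iota (n : nat) f : A f -> resW X n%:Z (iota f) <->
  forall i, (i < n)%N -> exists2 c, OM c & f i = t * c.
Proof.
move=> Af; have AXn g : A g -> A (ps_X M ^+ n * g) by move=> Ag; apply: AM => //; apply: Aexp.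
rewrite curly_resW; split=> [[g Ag + i lt_in]|fm].
  rewrite -iotaX // -iotaM -?iotaB //; try by [apply: AXn|apply: Aexp].
  have Afg := AB Af (AXn _ Ag).
  by move=> /(iota_ball1 Afg) /(_ i); rewrite ps_subE ps_XnM_low // subr0.
have Ag : A (fun m => f (n + m)%N) by move=> m; apply: Af.
exists (fun m => f (n + m)%N) => //.
rewrite -iotaX // -iotaM -?iotaB //; try by [apply: AXn|apply: Aexp].
apply/(iota_ball1 (AB Af (AXn _ Ag))) => i; rewrite ps_subE.
have [lt_in|le_ni] := ltnP i n; first by rewrite ps_XnM_low // subr0; apply: fm.
by exists 0 => //; rewrite -(subnKC le_ni) ps_XnM subrr mulr0.
Qed.

(* A denominator prime to [t] is [u^k] times a unit of [O_M[[u]]] modulo [t]. *)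
Lemma curly_absorb x : @tdO X x -> exists k : nat, resW X 0 (U ^+ k * x).
Proof.
move=> Ox.
have [y [f [g [Af Ag g0 yE]]] xy] : exists2 y, (exists f g,
    [/\ A f, A g, g != 0 & y = iota f / iota g]) & vball w 1 (x - y).
  by case: cK => _ _ _ _ [_ + _]; apply.
have Oy : vball w 0 y.
  by rewrite -(subKr x y); apply: (vballB dw) Ox _; apply: vball_le xy.
have [n [g' [Ag' gE wg]]] := primitive_part Ag g0.
have g'0 : g' != 0 by apply: contraNneq g0 => g'0; rewrite gE g'0 mulr0.
have gi0 : iota g' != 0 by apply: iota_neq0.
have [|//|f' Af' fE] := curly_BO (x := y * iota g').
- apply/curly_BP; exists n, f; split=> //; rewrite yE gE iotaM ?iotaX //; last exact: Aexp.
  have Tn0 : T ^+ n != 0 by rewrite expf_neq0 ?T0.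
  by field; rewrite gi0 Tn0.
- exact: (vballM0 dw) Oy (iota_ball Ag').
have exg : exists k, `[< ~ exists2 c, OM c & g' k = t * c >].
  apply: contrapT => /forallNP ng; have : vball w 1 (iota g').
    by apply/(iota_ball1 Ag') => k; apply: contrapT => nk; apply: (ng k); apply/asboolP.
  by move/vballP => /(_ gi0); rewrite wg.
case: (ex_minnP exg) => k /asboolP gk kmin.
have gkV : OM (g' k)^-1.
  apply: contrapT => nV; apply: gk; have : max_ideal v M (g' k) by split=> //; right.
  by rewrite maxE => -[c Oc <-]; exists c.
have gk0 : g' k != 0 by apply/eqP => gk0; apply: gk; exists 0; rewrite ?mulr0.
pose h : pseries M := fun m => g' (k + m)%N.
have Ah : A h by move=> m; apply: Ag'.
have Aku : A (ps_const (g' k)^-1) by apply: Ac.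
have [||e Ae eh] := series_inv OM1 OMB OMM (h := 1 - ps_const (g' k)^-1 * h).
- exact: (AB A1 (AM Aku Ah)).
- by rewrite ps_subE ps_oneE ps_constM /h addn0 mulVf // subrr.
pose e' := e * ps_const (g' k)^-1; have Ae' : A e' by apply: AM.
have he : h * e' = 1 by rewrite -eh /e'; ring.
have Afe : A (f' * e') by apply: AM.
have AXk : A (ps_X M ^+ k) by apply: Aexp.
exists k; apply/(curly_resW 0); exists (f' * e') => //.
rewrite expr0 mul1r.
(* From [y * iota g' = iota f'] and [h * e' = 1]. The first summand is small because [y]
   approximates [x], the second because [g'] agrees modulo [t] with its part from degree [k] on. *)
have -> : U ^+ k * x - iota (f' * e') = U ^+ k * (x - y) +
    y * iota e' * iota (ps_X M ^+ k * h - g').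
  have -> : iota (ps_X M ^+ k * h - g') = U ^+ k * iota h - iota g'.
    by rewrite iotaB ?iotaM ?iotaX //; apply: AM.
  rewrite iotaM // -fE.
  have hei : iota h * iota e' = 1 by rewrite -iotaM // he iota1.
  by ring: hei.
apply: (vballD dw); first by rewrite -iotaX //; apply: (vballM0 dw) xy; apply: iota_ball.
apply: (vballM0 dw).
  by apply: (vballM0 dw) Oy _; apply: iota_ball.
apply/iota_ball1; first by apply: AB => //; apply: AM.
move=> i; rewrite ps_subE; have [lt_ik|le_ki] := ltnP i k.
  have : ~~ `[< ~ exists2 c, OM c & g' i = t * c >].
    by apply: contraTN lt_ik => /kmin; rewrite -leqNgt.
  move/asboolPn/contrapT => [c Oc ->]; exists (0 - c); first exact: OMB.
  by rewrite ps_XnM_low // mulrBr mulr0.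
by exists 0 => //; rewrite -{1}(subnKC le_ki) ps_XnM /h subnKC // subrr mulr0.
Qed.

Lemma curly_axioms : two_dim_axioms X q.
Proof.
have [d [Od d_ex d_uniq]] := lf_digits aM.
have BM' f : A f -> tdB (iota f : X) /\ tdO (iota f : X).
  by move=> Af; split; [apply: curly_iotaB|apply: iota_ball].
(* A positive valuation would make every coefficient of the variable divisible by [t], in particular
   1, so that [t] would be a unit. *)
have wU : w U = 0.
  have U0 : U != 0 by apply: iota_neq0 => //; apply: ps_X_neq0.
  have /vballP/(_ U0) w0 := iota_ball AX.
  have [//|w1] : w U = 0 \/ 1 <= w U by lia.
  have /(iota_ball1 AX)/(_ 1%N) [c Oc] : vball w 1 U by right.
  rewrite /ps_X /= => tc.
  have : max_ideal v M t by rewrite maxE; exists 1; rewrite ?mulr1.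
  move=> [_ [/eqP|]]; first by rewrite (negbTE t0).
  by rewrite (_ : t^-1 = c) //; apply: (mulfI t0); rewrite mulfV.
have U0 : U != 0 by apply: iota_neq0 => //; apply: ps_X_neq0.
split.
- exact: (vball01 dw).
- by move=> x y; apply: (vballB dw).
- by move=> x y; apply: (vballM0 dw).
- by rewrite -iota1; apply: curly_iotaB.
- move=> x y /curly_BP [n [f [Af fx]]] /curly_BP [m [g [Ag gy]]].
  apply/curly_BP; exists (n + m)%N, (ct ^+ m * f - ct ^+ n * g).
  have Am l h : A h -> A (ct ^+ l * h) by move=> Ah; apply: AM => //; apply: Aexp.
  split; first by apply: AB; apply: Am.
  rewrite iotaB; [|exact: Am..]; rewrite !iotaM ?iotaX -?fx -?gy //; try exact: Aexp.
  by rewrite exprD; ring.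
- move=> x y /curly_BP [n [f [Af fx]]] /curly_BP [m [g [Ag gy]]].
  apply/curly_BP; exists (n + m)%N, (f * g); split; first exact: AM.
  by rewrite iotaM // -fx -gy exprD; ring.
- exact: T0.
- exact: U0.
- exact: iota_ball.
- by move/vballP; rewrite invr_eq0 T0 (dvalV dw) ?T0 // wT => /(_ isT).
- exact: iota_ball.
- by right; rewrite (dvalV dw) // wU.
- exact: curly_iotaB.
- by apply/curly_BP; exists 1%N, 1; rewrite expr1 mulfV ?T0 // iota1.
- exact: curly_iotaB.
- apply/funext => x; apply/propext; rewrite (curly_resW 0) expr0.
  split=> [[Ox [f Af xf]]|[f Af]]; first by exists f; rewrite ?mul1r.
  rewrite mul1r => xf; split; last by exists f.
  by rewrite -[x](subrK (iota f)); apply: (vballD dw) (iota_ball Af); apply: vball_le xf.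
- exact: curly_absorb.
- exists (fun i => iota (ps_const (d i))); split=> [i|b Bb Ob|i j].
  + by apply: BM'; apply: Ac.
  + have [f Af ->] := curly_BO Bb Ob; have [i [c Oc fc]] := d_ex _ (Af 0%N).
    have Adi := Ac (Od i); exists i; rewrite -iotaB //.
    apply/(curly_resW_iota 1 (AB Af Adi)) => -[] // _.
    by exists c; rewrite // ps_subE.
  + have [Adi Adj] := (Ac (Od i), Ac (Od j)); rewrite -iotaB //.
    by move=> /(curly_resW_iota 1 (AB Adi Adj)) /(_ 0%N isT) dij; apply: d_uniq.
move=> x xBO xW.
have /choice [f fP] n : exists f, A f /\ x n = iota f.
  by have [Bx Ox] := xBO n; have [f Af ->] := curly_BO Bx Ox; exists f.
pose y : pseries M := fun i => f i.+1 i.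
(* The diagonal series [y] is the limit: the coefficient of degree [i] of [f n] is constant modulo
   [t] from [n = i + 1] on, which is all that [resW] sees. *)
have Ay : A y by move=> i; apply: (fP i.+1).1.
exists (iota y) => n; have [Af ->] := fP n; rewrite -iotaB //.
apply/(curly_resW_iota n (AB Ay Af)).
elim: n Af => // n IHn Af i; rewrite ltnS leq_eqVlt => /predU1P[->|lt_in].
  by exists 0; rewrite // ps_subE subrr mulr0.
have [Afn Ef] := fP n; have [c Oc yc] := IHn Afn i lt_in.
have := xW n; rewrite Ef (fP n.+1).2 -iotaB //.
move=> /(curly_resW_iota n (AB Af Afn)) /(_ i lt_in) [c' Oc' fc'].
exists (c - c'); first exact: OMB.
by rewrite mulrBr -yc -fc' !ps_subE; ring.
Qed.
End Curly.

Theorem theorem1 (R : realType) (p n q : nat) (k : finFieldType)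
    (X : two_dim_data) :
  prime p -> (0 < n)%N -> q = (p ^ n)%N -> #|k| = q ->
  two_dim_local_field p k X ->
  (exists beta : (heis -> dist R X) -> DO R X, is_beta q beta) /\
  forall beta : (heis -> dist R X) -> DO R X, is_beta q beta ->
  [/\ (forall beta', is_beta q beta' ->
         forall f, ind_sigma R X q f -> beta' f = beta f),
      short_exact (Ker q beta) (@ind_act _ heis _) (ind_sigma R X q) (@ind_act _ heis _)
        (Psi R X) (G_act q) id beta,
      is_basis (Ker q beta) (v_ R X q),
      irreducible (Ker q beta) (@ind_act _ heis _)
    & rep_isomorphic (Ker q beta) (@ind_act _ heis _)
        (ind_chi0 R q) (@ind_act _ heis _)].
Proof.
move=> pp n0 qE kq XP.
have q_gt1 : (1 < q)%N by rewrite qE -(exp1n n) ltn_exp2r ?prime_gt1.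
apply: main_axioms => //; case: XP => [|Q j v L u pL|Q j v M t K iota w pM cK].
- exact/laurent_axioms/laurent_local.
- exact: laurent_axioms (padic_local kq pL).
- by apply: curly_axioms (padic_local kq pM) _ cK; case: pM.
Qed.
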